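(* Let $u_0, u_1 \in C^\infty(\mathbf{R}^3)$ be any real-valued spherically symmetric smooth functions. Then there exists a unique global smooth solution $u: \mathbf{R} \times \mathbf{R}^3 \to \mathbf{R}$ (that is, $u \in C^\infty(\mathbf{R}\times\mathbf{R}^3)$) to the equation $$ -\partial_{tt} u + \Delta u = u^5 \log(2+u^2) $$ on $\mathbf{R}\times\mathbf{R}^3$ with initial position $u(0,x) = u_0(x)$ and initial velocity $\partial_t u(0,x) = u_1(x)$ for all $x \in \mathbf{R}^3$.
   Context: Here $\Delta$ is the Laplacian in the spatial variable $x \in \mathbf{R}^3$. A function on $\mathbf{R}^3$ is spherically symmetric if it depends only on $|x|$. No decay or compact support of the initial data is assumed. *)

(* Defs.v *)
From Stdlib Require Import Reals List.
From Coquelicot Require Import Coquelicot.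
Import ListNotations.
Open Scope R_scope.

Definition R3 : Type := (R * R * R)%type.

Definition basis3 : list R3 := [(1, 0, 0); (0, 1, 0); (0, 0, 1)].

(* Points of R x R^3 are pairs (t, x). *)
Definition basis4 : list (R * R3) :=
  (1, (0, 0, 0)) :: map (fun e => (0, e)) basis3.

Definition partial {V : NormedModule R_AbsRing} (e : V) (f : V -> R) (p : V) : R :=
  Derive (fun h : R => f (plus p (scal h e))) 0.

Definition ex_partial {V : NormedModule R_AbsRing} (e : V) (f : V -> R) (p : V) : Prop :=
  ex_derive (fun h : R => f (plus p (scal h e))) 0.

(* All iterated partial derivatives of f along the vectors of B, up to order k,
   exist everywhere and are jointly continuous. This is the class C^k when B is
   a basis of V. *)
Fixpoint Ck {V : NormedModule R_AbsRing} (B : list V) (k : nat) (f : V -> R) : Prop :=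
  (forall p : V, continuous f p) /\
  match k with
  | O => True
  | S k' => forall e : V, In e B ->
      (forall p : V, ex_partial e f p) /\ Ck B k' (partial e f)
  end.

Definition smooth3 (f : R3 -> R) : Prop := forall k : nat, Ck basis3 k f.

Definition smooth4 (f : R * R3 -> R) : Prop := forall k : nat, Ck basis4 k f.

Definition norm3 (x : R3) : R :=
  let '(x1, x2, x3) := x in sqrt (x1 ^ 2 + x2 ^ 2 + x3 ^ 2).

Definition spherically_symmetric (f : R3 -> R) : Prop :=
  forall x y : R3, norm3 x = norm3 y -> f x = f y.

Definition laplacian (f : R3 -> R) (x : R3) : R :=
  fold_right Rplus 0 (map (fun e => partial e (partial e f) x) basis3).

Definition solves_wave (u : R * R3 -> R) : Prop :=
  forall (t : R) (x : R3),
    - Derive_n (fun s => u (s, x)) 2 t + laplacian (fun y => u (t, y)) x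
    = u (t, x) ^ 5 * ln (2 + u (t, x) ^ 2).

Definition has_initial_data (u : R * R3 -> R) (u0 u1 : R3 -> R) : Prop :=
  forall x : R3, u (0, x) = u0 x /\ Derive (fun t => u (t, x)) 0 = u1 x.

(* Main.v *)
(** Put [v(t,r) = r u(t,r)], extended to an odd function of [r]. The function [P = v_t + v_r] is transported
    along the characteristics [t + r = const] with source [- r f(u)], where [f(u) = u^5 log(2 + u^2)], and [u]
    is recovered as [U(t,r) = 1/2 int_{-1}^1 P(t, x r) dx]. So the radial problem becomes a nonsingular
    fixed-point equation for [P] on the plane, which Picard iteration solves globally once [f] is truncated.

    The truncation is removed by a bound on [P] independent of it. Energy conservation gives
    [r U^2 <= 2 E]; the multiplier [v_r] (Morawetz) bounds the integral of [r (u f(u) - 2 F(u))], which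
    dominates that of [r u^6 log(2 + u^2)]. Together they control the integral of [(r f'(U))^2] over a time
    slab on which [|U| <= D] by [log(2 + D^2)] times the Morawetz integral of the slab. If this is small, then
    Hardy's inequality on each characteristic shows that the [L^2] norm (over characteristics) of the supremum
    of [P_t] at most doubles on the slab, and [|P|] grows by at most a fixed factor [C]. After [k] slabs
    [D = C^k X0], so [log(2 + D^2) = O(k)] and the next slab may consume [c / k] of the Morawetz integral.
    That integral is finite and the harmonic series diverges, so finitely many slabs reach any given time.

    The derivative of [P] in [r] solves a linear equation of the same type, whence smoothness in [(t, r)]; an
    even smooth [g] satisfies [g'(r) = r b(r)] with [b] even and smooth, whence smoothness in [(t, x)].
    Uniqueness, without symmetry, is an energy estimate for the difference of two solutions with a weight
    supported in a cube shrinking at unit speed. *)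

(* The data have no decay, so their energy may be infinite. On a cone [Rabs t + Rabs r <= K] the
   solution depends on [P0] only through [[-K, K]], so the bounds are proved for data cut off
   outside. The cutoff acts on [r u0] and [r u1] rather than on [P0]: this keeps the integral of
   [P0] equal to zero, without which [v] would not have compact support at time 0. Negative times
   are reached by the reflection [(t, r) -> (- t, - r)]. The choice of [P] is what closes the
   estimates. A bound on [P] bounds its average [U]; and the change of [P_t] along [t + r = const]
   involves, besides [r f'(U)], only [U_t], which is an average of [P_t]. So no derivative is lost,
   and Hardy's inequality pays for the averages reaching values of [P_t] on other characteristics.
   The truncation is affine outside [[-n, n]]: the source becomes Lipschitz on every cone, while the
   signs of the energy and of the virial and the growth bound on [f'] persist with constants
   independent of [n]. Once [n] exceeds the bound on [U], the truncated solution is genuine. *)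
Require Import Defs.
From Stdlib Require Import Reals.
From Stdlib Require Import Lra Lia Psatz Classical ClassicalChoice FunctionalExtensionality List.
From Coquelicot Require Import Coquelicot.
Open Scope R_scope.

(** * Jointly continuous functions and their integrals *)

Ltac abs_lra :=
  unfold Rmin, Rmax; repeat destruct Rle_dec; unfold Rabs; repeat destruct Rcase_abs; lra.

Ltac sq x := assert (0 <= x ^ 2) by apply pow2_ge_0.

Definition cont {T U : UniformSpace} (f : T -> U) : Prop := forall z, continuous f z.
Definition c2 (f : R -> R -> R) : Prop := cont (fun z : R * R => f (fst z) (snd z)).
Definition c3 (f : R -> R -> R -> R) : Prop :=
  cont (fun z : R * R * R => f (fst (fst z)) (snd (fst z)) (snd z)).

Lemma cont_id {T : UniformSpace} : cont (fun z : T => z).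
Proof. intros z; apply continuous_id. Qed.

Lemma cont_const {T U : UniformSpace} (c : U) : cont (fun _ : T => c).
Proof. intros z; apply continuous_const. Qed.

Lemma cont_comp {T U V : UniformSpace} (f : T -> U) (g : U -> V) :
  cont f -> cont g -> cont (fun z => g (f z)).
Proof. intros Hf Hg z; apply continuous_comp; auto. Qed.

Lemma cont_fst {T U V : UniformSpace} (f : T -> U * V) :
  cont f -> cont (fun z => fst (f z)).
Proof. intros Hf; apply (cont_comp f (fun p : U * V => fst p) Hf); intros p; apply continuous_fst. Qed.

Lemma cont_snd {T U V : UniformSpace} (f : T -> U * V) :
  cont f -> cont (fun z => snd (f z)).
Proof. intros Hf; apply (cont_comp f (fun p : U * V => snd p) Hf); intros p; apply continuous_snd. Qed.

Lemma cont_pair {T U V : UniformSpace} (f : T -> U) (g : T -> V) :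
  cont f -> cont g -> cont (fun z => (f z, g z)).
Proof.
intros Hf Hg z; apply (continuous_comp_2 f g (fun a b => (a, b))); auto.
apply continuous_ext with (f := fun p : U * V => p).
- intros [a b]; reflexivity.
- apply continuous_id.
Qed.

Lemma cont_plus {T : UniformSpace} (f g : T -> R) :
  cont f -> cont g -> cont (fun z => f z + g z).
Proof. intros Hf Hg z; apply (continuous_plus f g); auto. Qed.

Lemma cont_opp {T : UniformSpace} (f : T -> R) : cont f -> cont (fun z => - f z).
Proof. intros Hf z; apply (continuous_opp f); auto. Qed.

Lemma cont_minus {T : UniformSpace} (f g : T -> R) :
  cont f -> cont g -> cont (fun z => f z - g z).
Proof. intros Hf Hg z; apply (continuous_minus f g); auto. Qed.

Lemma cont_mult {T : UniformSpace} (f g : T -> R) :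
  cont f -> cont g -> cont (fun z => f z * g z).
Proof. intros Hf Hg z; apply (continuous_mult f g); auto. Qed.

Lemma cont_div {T : UniformSpace} (f : T -> R) c : cont f -> cont (fun z => f z / c).
Proof. intros Hf; unfold Rdiv; apply cont_mult; auto using cont_const. Qed.

Lemma cont_pow {T : UniformSpace} (f : T -> R) n : cont f -> cont (fun z => f z ^ n).
Proof.
intros Hf; induction n as [|n IH]; simpl.
- apply cont_const.
- apply cont_mult; auto.
Qed.

Lemma cont_abs {T : UniformSpace} (f : T -> R) : cont f -> cont (fun z => Rabs (f z)).
Proof. intros Hf z; apply (continuous_comp f Rabs); auto. apply continuous_Rabs. Qed.

Lemma cont_min {T : UniformSpace} (f g : T -> R) :
  cont f -> cont g -> cont (fun z => Rmin (f z) (g z)).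
Proof.
intros Hf Hg; replace (fun z => Rmin (f z) (g z))
  with (fun z => (f z + g z - Rabs (f z - g z)) / 2).
- apply cont_div, cont_minus; [apply cont_plus; auto|]; apply cont_abs, cont_minus; auto.
- extensionality z; unfold Rmin, Rabs; destruct Rle_dec; destruct Rcase_abs; lra.
Qed.

Lemma cont_max {T : UniformSpace} (f g : T -> R) :
  cont f -> cont g -> cont (fun z => Rmax (f z) (g z)).
Proof.
intros Hf Hg; replace (fun z => Rmax (f z) (g z))
  with (fun z => (f z + g z + Rabs (f z - g z)) / 2).
- apply cont_div, cont_plus; [apply cont_plus; auto|]; apply cont_abs, cont_minus; auto.
- extensionality z; unfold Rmax, Rabs; destruct Rle_dec; destruct Rcase_abs; lra.
Qed.

Lemma cont_comp1 {T : UniformSpace} (g : R -> R) (f : T -> R) :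
  cont g -> cont f -> cont (fun z => g (f z)).
Proof. intros Hg Hf; apply (cont_comp f g); auto. Qed.

Lemma cont_comp2 {T : UniformSpace} (g : R -> R -> R) (a b : T -> R) :
  c2 g -> cont a -> cont b -> cont (fun z => g (a z) (b z)).
Proof.
intros Hg Ha Hb.
apply (cont_comp (fun z => (a z, b z)) (fun p : R * R => g (fst p) (snd p))); auto.
apply cont_pair; auto.
Qed.

Lemma cont_comp3 {T : UniformSpace} (g : R -> R -> R -> R) (a b c : T -> R) :
  c3 g -> cont a -> cont b -> cont c -> cont (fun z => g (a z) (b z) (c z)).
Proof.
intros Hg Ha Hb Hc.
apply (cont_comp (fun z => (a z, b z, c z))
   (fun p : R * R * R => g (fst (fst p)) (snd (fst p)) (snd p))); auto.
apply cont_pair; auto; apply cont_pair; auto.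
Qed.

Lemma cont_derive (f df : R -> R) : (forall x, is_derive f x (df x)) -> cont f.
Proof.
intros H x; apply (ex_derive_continuous f); exists (df x); apply H.
Qed.

Lemma cont_exp : cont exp.
Proof. apply cont_derive with exp; intros x; apply is_derive_exp. Qed.

(** Compactness of [[a, b]] makes the modulus of continuity at [z0] uniform in [x]. Continuity of
    parametric integrals and of suprema over a segment both rest on this. *)
Lemma tube {T : UniformSpace} (f : T -> R -> R) (a b : R) :
  cont (fun z : T * R => f (fst z) (snd z)) ->
  forall z0 (eps : posreal), exists d : posreal, forall z, ball z0 d z ->
    forall x, a <= x <= b -> Rabs (f z x - f z0 x) < eps.
Proof.
intros Hf z0 eps.
assert (He : 0 < eps / 2) by (destruct eps; simpl; lra).
assert (H1 : forall x, exists d : posreal, forall z y, ball z0 d z -> Rabs (y - x) < d ->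
   Rabs (f z y - f z0 x) < eps / 2).
{ intros x.
  destruct (Hf (z0, x) (ball (f z0 x) (mkposreal _ He))) as [d Hd].
  - apply locally_ball.
  - exists d; intros z y Hz Hy.
    apply (Hd (z, y)); split; simpl; auto. }

destruct (choice _ H1) as [d Hd].
destruct (compactness_value_1d a b d) as [d0 Hd0].
exists d0; intros z Hz x Hx.
specialize (Hd0 x Hx); apply NNPP in Hd0; destruct Hd0 as [t [Ht [Hxt Hdt]]].
assert (A1 := Hd t z x (ball_le _ _ _ Hdt _ Hz) Hxt).
assert (A2 := Hd t z0 x (ball_center _ _) Hxt).
replace (f z x - f z0 x) with ((f z x - f z0 t) - (f z0 x - f z0 t)) by ring.
eapply Rle_lt_trans; [apply Rabs_triang|]; rewrite Rabs_Ropp; lra.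
Qed.

Lemma cont_ex_RInt (f : R -> R) a b : cont f -> ex_RInt f a b.
Proof. intros H; apply (ex_RInt_continuous (V := R_CompleteNormedModule)); auto. Qed.

Lemma cont_RInt_01 {T : UniformSpace} (f : T -> R -> R) :
  cont (fun z : T * R => f (fst z) (snd z)) -> cont (fun z => RInt (f z) 0 1).
Proof.
intros Hf z0.
assert (Hs : forall z, cont (f z)).
{ intros z; apply (cont_comp (fun x : R => (z, x)) _ (cont_pair _ _ (cont_const z) cont_id) Hf). }
apply filterlim_locally; intros eps.
assert (He : 0 < eps / 2) by (destruct eps; simpl; lra).
destruct (tube f 0 1 Hf z0 (mkposreal _ He)) as [d Hd].
exists d; intros z Hz.
change (Rabs (RInt (f z) 0 1 - RInt (f z0) 0 1) < eps).
rewrite <- (RInt_minus (f z) (f z0)) by auto using cont_ex_RInt.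
eapply Rle_lt_trans; [apply abs_RInt_le_const with (M := eps / 2)|].
- lra.
- apply cont_ex_RInt; apply (cont_minus (f z) (f z0)); auto.
- intros t Ht; left; apply (Hd z Hz t Ht).
- destruct eps; simpl in *; lra.
Qed.

(** Rescaling to a fixed interval moves the limits into the integrand, so that continuity in
    variable limits reduces to joint continuity of an integrand. *)
Lemma RInt_to_01 (f : R -> R) a b :
  cont f -> RInt f a b = (b - a) * RInt (fun x => f (a + x * (b - a))) 0 1 :> R.
Proof.
intros Hf.
assert (Hc : cont (fun x => f ((b - a) * x + a))).
{ apply cont_comp1; auto. apply cont_plus; [apply cont_mult|];
  first [apply cont_const | apply cont_id]. }
transitivity (RInt f ((b - a) * 0 + a) ((b - a) * 1 + a)).
- f_equal; ring.
- rewrite <- (RInt_comp_lin f) by auto using cont_ex_RInt.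
  rewrite (RInt_scal (V := R_CompleteNormedModule) (fun y => f ((b - a) * y + a)))
    by auto using cont_ex_RInt.
  apply (f_equal (Rmult (b - a))), RInt_ext; intros; f_equal; ring.
Qed.

Lemma cont_RInt {T : UniformSpace} (f : T -> R -> R) (a b : T -> R) :
  cont (fun z : T * R => f (fst z) (snd z)) -> cont a -> cont b ->
  cont (fun z => RInt (f z) (a z) (b z)).
Proof.
intros Hf Ha Hb.
assert (Hs : forall z, cont (f z)).
{ intros z; apply (cont_comp (fun x : R => (z, x)) _ (cont_pair _ _ (cont_const z) cont_id) Hf). }
replace (fun z => RInt (f z) (a z) (b z)) with
  (fun z => (b z - a z) * RInt (fun x => f z (a z + x * (b z - a z))) 0 1).
2:{ extensionality z; symmetry; apply RInt_to_01; auto. }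
apply cont_mult; [apply cont_minus; auto|].
apply (cont_RInt_01 (fun z x => f z (a z + x * (b z - a z)))).
apply (cont_comp (fun zx : T * R => (fst zx, a (fst zx) + snd zx * (b (fst zx) - a (fst zx))))
  (fun z : T * R => f (fst z) (snd z))); auto.
assert (Ha' := cont_comp (fun z : T * R => fst z) a (cont_fst _ cont_id) Ha).
assert (Hb' := cont_comp (fun z : T * R => fst z) b (cont_fst _ cont_id) Hb).
apply cont_pair; [apply cont_fst, cont_id|].
apply cont_plus; auto; apply cont_mult; [apply cont_snd, cont_id|].
apply cont_minus; auto.
Qed.

Lemma cont_curry {T U : UniformSpace} (f : T -> R -> U) z :
  cont (fun p : T * R => f (fst p) (snd p)) -> cont (f z).
Proof.
intros Hf; apply (cont_comp (fun x : R => (z, x)) (fun p : T * R => f (fst p) (snd p))); auto.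
apply cont_pair; [apply cont_const|apply cont_id].
Qed.

(** Continuity is derived from the syntax of the term; opaque functions are handled by hypotheses of
    the context, which is why many proofs below begin by asserting the continuity of the functions
    involved. *)
Ltac cont_step :=
  match goal with
  | H : ?P |- ?Q => constr_eq P Q; exact H
  | H : cont ?g |- cont ?h => constr_eq g h; exact H
  | H : cont ?g |- cont (fun z => ?g' z) => constr_eq g g'; exact H
  | |- c2 _ => unfold c2; cbv beta
  | |- c3 _ => unfold c3; cbv beta
  | |- cont (fun z => z) => apply cont_id
  | |- cont (fun _ => ?c) => first [apply cont_const | exact (cont_const _)]
  | |- cont (fun z => @?f z + @?g z) => apply (cont_plus f g)
  | |- cont (fun z => @?f z - @?g z) => apply (cont_minus f g)
  | |- cont (fun z => @?f z * @?g z) => apply (cont_mult f g)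
  | |- cont (fun z => - @?f z) => apply (cont_opp f)
  | |- cont (fun z => @?f z / ?c) => apply (cont_div f c)
  | |- cont (fun z => @?f z ^ ?n) => apply (cont_pow f n)
  | |- cont (fun z => Rabs (@?f z)) => apply (cont_abs f)
  | |- cont (fun z => Rmin (@?f z) (@?g z)) => apply (cont_min f g)
  | |- cont (fun z => Rmax (@?f z) (@?g z)) => apply (cont_max f g)
  | |- cont (fun z => exp (@?f z)) => apply (cont_comp1 exp f cont_exp)
  | |- cont (fun z => fst (@?f z)) => apply (cont_fst f)
  | |- cont (fun z => snd (@?f z)) => apply (cont_snd f)
  | |- cont (fun z => (@?f z, @?g z)) => apply (cont_pair f g)
  | |- cont (fun z => RInt (@?f z) (@?a z) (@?b z)) => apply (cont_RInt f a b); cbv beta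
  | H : c3 ?g |- cont (fun z => ?g' (@?a z) (@?b z) (@?c z)) => constr_eq g g'; apply (cont_comp3 g a b c H)
  | H : c2 ?g |- cont (fun z => ?g' (@?a z) (@?b z)) => constr_eq g g'; apply (cont_comp2 g a b H)
  | H : c2 ?g |- cont (?g' ?x) => constr_eq g g'; apply (cont_curry g x H)
  | H : cont ?g |- cont (fun z => ?g' (@?a z)) => constr_eq g g'; apply (cont_comp1 g a H)
  end.
Ltac cont_tac := repeat cont_step.

Ltac real_eq := match goal with |- @eq _ ?a ?b => change (@eq R a b) end.

Section Integrals.

Lemma RI_plus (f g : R -> R) a b : cont f -> cont g ->
  RInt (fun x => f x + g x) a b = RInt f a b + RInt g a b :> R.
Proof. intros Hf Hg; apply (RInt_plus f g); auto using cont_ex_RInt. Qed.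

Lemma RI_minus (f g : R -> R) a b : cont f -> cont g ->
  RInt (fun x => f x - g x) a b = RInt f a b - RInt g a b :> R.
Proof. intros Hf Hg; apply (RInt_minus f g); auto using cont_ex_RInt. Qed.

Lemma RI_scal (f : R -> R) c a b : cont f ->
  RInt (fun x => c * f x) a b = c * RInt f a b :> R.
Proof. intros Hf; apply (RInt_scal (V := R_CompleteNormedModule) f); auto using cont_ex_RInt. Qed.

Lemma RI_chasles (f : R -> R) a b c : cont f -> RInt f a b + RInt f b c = RInt f a c :> R.
Proof. intros Hf; apply (RInt_Chasles f); auto using cont_ex_RInt. Qed.

Lemma RI_swap (f : R -> R) a b : cont f -> RInt f b a = - RInt f a b :> R.
Proof. intros Hf; symmetry; apply (opp_RInt_swap f); auto using cont_ex_RInt. Qed.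

Lemma RI_point (f : R -> R) a : RInt f a a = 0 :> R.
Proof. apply (RInt_point a f). Qed.

Lemma RI_const (c : R) a b : RInt (fun _ => c) a b = (b - a) * c :> R.
Proof. apply (RInt_const a b c). Qed.

Lemma RI_le (f g : R -> R) a b : a <= b -> cont f -> cont g ->
  (forall x, a <= x <= b -> f x <= g x) -> RInt f a b <= RInt g a b.
Proof.
intros Hab Hf Hg H; apply RInt_le; auto using cont_ex_RInt.
intros x Hx; apply H; lra.
Qed.

Lemma RI_ge_0 (f : R -> R) a b : a <= b -> cont f ->
  (forall x, a <= x <= b -> 0 <= f x) -> 0 <= RInt f a b.
Proof.
intros Hab Hf H; apply RInt_ge_0; auto using cont_ex_RInt.
intros x Hx; apply H; lra.
Qed.

Lemma RI_abs_le (f g : R -> R) a b : a <= b -> cont f -> cont g ->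
  (forall x, a <= x <= b -> Rabs (f x) <= g x) -> Rabs (RInt f a b) <= RInt g a b.
Proof.
intros Hab Hf Hg H; eapply Rle_trans; [apply abs_RInt_le; auto using cont_ex_RInt|].
apply RI_le; auto. cont_tac.
Qed.

Lemma RI_abs_const (f : R -> R) a b M : a <= b -> cont f ->
  (forall x, a <= x <= b -> Rabs (f x) <= M) -> Rabs (RInt f a b) <= (b - a) * M.
Proof. intros Hab Hf H; apply abs_RInt_le_const; auto using cont_ex_RInt. Qed.

Lemma RI_ext (f g : R -> R) a b :
  (forall x, Rmin a b <= x <= Rmax a b -> f x = g x) -> RInt f a b = RInt g a b :> R.
Proof. intros H; apply (RInt_ext f g); intros; apply H; lra. Qed.

Lemma RI_FTC (f : R -> R) a x : cont f -> is_derive (fun y => RInt f a y) x (f x).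
Proof.
intros Hf; apply (is_derive_RInt f (fun y => RInt f a y) a x); auto.
apply filter_forall; intros y; apply (RInt_correct f); auto using cont_ex_RInt.
Qed.

Lemma RI_derive (f df : R -> R) a b : (forall x, is_derive f x (df x)) -> cont df ->
  RInt df a b = f b - f a :> R.
Proof.
intros H Hc; apply (is_RInt_unique df a b (f b - f a)).
apply (is_RInt_derive f df a b); auto.
Qed.

Lemma RI_lin (f : R -> R) u v a b : cont f ->
  u * RInt (fun y => f (u * y + v)) a b = RInt f (u * a + v) (u * b + v) :> R.
Proof.
intros Hf; rewrite <- (RInt_comp_lin f) by auto using cont_ex_RInt.
symmetry; apply (RInt_scal (V := R_CompleteNormedModule) (fun y => f (u * y + v))).
apply cont_ex_RInt; cont_tac.
Qed.

Lemma RI_ge_0_zero (f : R -> R) a b : a < b -> cont f ->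
  (forall x, a <= x <= b -> 0 <= f x) -> RInt f a b = 0 ->
  forall x, a < x < b -> f x = 0.
Proof.
intros Hab Hf Hp H0 x Hx.
destruct (Req_dec (f x) 0) as [|Hn]; auto; exfalso.
assert (Hfx : 0 < f x) by (specialize (Hp x); lra).
destruct (Hf x (ball (f x) (mkposreal _ Hfx)) (locally_ball _ _)) as [d Hd].
set (e := Rmin (d / 2) (Rmin (x - a) (b - x))).
assert (He : 0 < e /\ e <= d / 2 /\ e <= x - a /\ e <= b - x).
{ unfold e; destruct d as [d Hd0]; simpl; repeat split.
  - repeat apply Rmin_glb_lt; lra.
  - apply Rmin_l.
  - eapply Rle_trans; [apply Rmin_r|apply Rmin_l].
  - eapply Rle_trans; [apply Rmin_r|apply Rmin_r]. }
assert (G : 0 < RInt f x (x + e)).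
{ apply RInt_gt_0; [lra| |auto].
  intros y Hy.
  assert (B : ball (f x) (f x) (f y)).
  { apply Hd. change (Rabs (y - x) < d). rewrite Rabs_pos_eq; destruct d; simpl in *; lra. }
  change (Rabs (f y - f x) < f x) in B. apply Rabs_def2 in B; lra. }
assert (G1 := RI_ge_0 f a x); assert (G2 := RI_ge_0 f (x + e) b).
rewrite <- (RI_chasles f a x b), <- (RI_chasles f x (x + e) b) in H0 by auto.
assert (0 <= RInt f a x) by (apply G1; [lra|auto|intros; apply Hp; lra]).
assert (0 <= RInt f (x + e) b) by (apply G2; [lra|auto|intros; apply Hp; lra]).
lra.
Qed.

Lemma cauchy_schwarz (f g : R -> R) a b : a <= b -> cont f -> cont g ->
  (RInt (fun x => f x * g x) a b) ^ 2 <= RInt (fun x => f x ^ 2) a b * RInt (fun x => g x ^ 2) a b.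
Proof.
intros Hab Hf Hg.
set (A := RInt (fun x => f x ^ 2) a b); set (B := RInt (fun x => f x * g x) a b);
set (C := RInt (fun x => g x ^ 2) a b).
assert (H : forall u v, 0 <= u ^ 2 * A + 2 * u * v * B + v ^ 2 * C).
{ intros u v.
  replace (u ^ 2 * A + 2 * u * v * B + v ^ 2 * C)
    with (RInt (fun x => (u * f x + v * g x) ^ 2) a b).
  - apply RI_ge_0; auto; [cont_tac|]. intros; apply pow2_ge_0.
  - unfold A, B, C; rewrite <- !RI_scal, <- !RI_plus by cont_tac.
    apply RI_ext; intros; ring. }
assert (c2_A : 0 <= A) by (specialize (H 1 0); lra).
assert (HC : 0 <= C) by (specialize (H 0 1); lra).
(* These choices give [C (A C - B^2) >= 0] and [A (A C - B^2) >= 0]. There remains [A = C = 0],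
   where [(1, - B)] gives [- 2 B^2 >= 0]. *)
assert (H1 := H C (- B)); assert (H2 := H (- B) A).
destruct (Req_dec A 0) as [E|E].
- destruct (Req_dec C 0) as [E'|E'].
  + assert (H3 := H 1 (- B)); nra.
  + assert (0 < C) by lra. nra.
- assert (0 < A) by lra. nra.
Qed.

End Integrals.

(** * Differentiation rules, differentiation under the integral, Fubini *)

Lemma is_derive_eq (f : R -> R) (x l l' : R) : is_derive f x l -> l = l' -> is_derive f x l'.
Proof. intros H <-; exact H. Qed.

Lemma der_const (c x : R) : is_derive (fun _ : R => c) x 0.
Proof. apply (is_derive_const c x). Qed.

Lemma der_id (x : R) : is_derive (fun y : R => y) x 1.
Proof. apply (is_derive_id (K := R_AbsRing) x). Qed.

Lemma der_plus (f g : R -> R) (x a b : R) :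
  is_derive f x a -> is_derive g x b -> is_derive (fun y => f y + g y) x (a + b).
Proof. intros Hf Hg; apply (is_derive_plus f g x a b Hf Hg). Qed.

Lemma der_minus (f g : R -> R) (x a b : R) :
  is_derive f x a -> is_derive g x b -> is_derive (fun y => f y - g y) x (a - b).
Proof. intros Hf Hg; apply (is_derive_minus f g x a b Hf Hg). Qed.

Lemma der_opp (f : R -> R) (x a : R) :
  is_derive f x a -> is_derive (fun y => - f y) x (- a).
Proof. intros Hf; apply (is_derive_opp f x a Hf). Qed.

Lemma der_mult (f g : R -> R) (x a b : R) :
  is_derive f x a -> is_derive g x b -> is_derive (fun y => f y * g y) x (a * g x + f x * b).
Proof.
intros Hf Hg; apply (is_derive_mult f g x a b Hf Hg); intros; apply Rmult_comm.
Qed.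

Lemma der_scal (f : R -> R) (c x a : R) :
  is_derive f x a -> is_derive (fun y => c * f y) x (c * a).
Proof. intros Hf; apply (is_derive_scal f x c a Hf). Qed.

Lemma der_comp (f g : R -> R) (x a b : R) :
  is_derive f (g x) a -> is_derive g x b -> is_derive (fun y => f (g y)) x (b * a).
Proof. intros Hf Hg; apply (is_derive_comp f g x a b Hf Hg). Qed.

Lemma der_pow2 (f : R -> R) (x a : R) :
  is_derive f x a -> is_derive (fun y => f y ^ 2) x (2 * f x * a).
Proof.
intros Hf; eapply is_derive_eq.
- apply (is_derive_pow f 2 x a Hf).
- simpl; ring.
Qed.

Lemma c2_continuity_2d f : c2 f -> forall x y, continuity_2d_pt f x y.
Proof. intros H x y; apply continuity_2d_pt_filterlim; apply (H (x, y)). Qed.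

(** Total differentiability follows from the existence of both partial derivatives and the
    continuity of one of them, here [gx]. *)
Lemma der_comp2 (g gx gy : R -> R -> R) (a b : R -> R) (t da db : R) :
  c2 gx -> (forall x y, is_derive (fun x => g x y) x (gx x y)) -> (forall x y, is_derive (g x) y (gy x y)) ->
  is_derive a t da -> is_derive b t db ->
  is_derive (fun t => g (a t) (b t)) t (da * gx (a t) (b t) + db * gy (a t) (b t)).
Proof.
intros Hc Hx Hy Ha Hb.
assert (D := is_derive_filterdiff g (a t) (b t) gx (gy (a t) (b t))).
eapply filterdiff_ext_lin.
- apply (filterdiff_comp'_2 a b g t (fun y => scal y da) (fun y => scal y db)
   (fun u v => plus (scal u (gx (a t) (b t))) (scal v (gy (a t) (b t))))).
  + apply Ha.
  + apply Hb.
  + apply D.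
    * apply filter_forall; intros [u v]; apply Hx.
    * apply Hy.
    * apply Hc.
- intros y; simpl. unfold scal, plus; simpl; unfold mult; simpl. ring.
Qed.

Lemma derive_RInt_param (f df : R -> R -> R) a b x :
  (forall s, cont (f s)) -> c2 df -> (forall s y, is_derive (fun t => f t y) s (df s y)) ->
  is_derive (fun s => RInt (f s) a b) x (RInt (df x) a b).
Proof.
intros Hf Hd H.
assert (E : (fun u v : R => Derive (fun z : R => f z v) u) = df).
{ extensionality u; extensionality v; apply is_derive_unique, H. }
eapply is_derive_eq; [apply (is_derive_RInt_param f a b x)|].
- apply filter_forall; intros s y _; exists (df s y); apply H.
- intros y _; rewrite E; apply c2_continuity_2d; auto.
- apply filter_forall; intros s; apply (cont_ex_RInt (f s)); auto.
- apply RI_ext; intros y _; apply is_derive_unique, H.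
Qed.

Lemma derive_zero_const (f : R -> R) : (forall x, is_derive f x 0) -> forall a b, f a = f b.
Proof.
intros H a b.
assert (E := RI_derive f (fun _ => 0) a b H (cont_const 0)).
rewrite RI_const in E; lra.
Qed.

Lemma derive_le_mono (f df : R -> R) a b : a <= b ->
  (forall x, is_derive f x (df x)) -> (forall x, a <= x <= b -> 0 <= df x) -> f a <= f b.
Proof.
intros Hab H Hp.
destruct (MVT_gen f a b df) as [c [Hc E]].
- intros; apply H.
- intros x _; apply continuity_pt_filterlim, (cont_derive f df H).
- rewrite Rmin_left, Rmax_right in Hc by auto.
  assert (0 <= df c * (b - a)) by (apply Rmult_le_pos; [apply Hp; auto|lra]). lra.
Qed.

(** As functions of the upper limit [b], both sides vanish at [a] and have the same derivative. *)
Lemma fubini (f : R -> R -> R) a b c d : c2 f ->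
  RInt (fun x => RInt (fun y => f x y) c d) a b = RInt (fun y => RInt (fun x => f x y) a b) c d :> R.
Proof.
intros Hf.
set (g := fun z => RInt (fun x => RInt (fun y => f x y) c d) a z
  - RInt (fun y => RInt (fun x => f x y) a z) c d).
assert (H : forall z, is_derive g z 0).
{ intros z; eapply is_derive_eq.
  - apply der_minus.
    + apply (RI_FTC (fun x => RInt (fun y => f x y) c d)). cont_tac.
    + apply (derive_RInt_param (fun z y => RInt (fun x => f x y) a z) (fun z y => f z y)).
      * intros s; cont_tac.
      * cont_tac.
      * intros s y; apply (RI_FTC (fun x => f x y)). cont_tac.
  - ring. }
assert (E := derive_zero_const g H a b); unfold g in E.
rewrite RI_point in E.
assert (Z : RInt (fun y => RInt (fun x => f x y) a a) c d = 0 :> R).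
{ rewrite (RI_ext _ (fun _ => 0)); [rewrite RI_const; ring|intros; apply RI_point]. }
rewrite Z in E; lra.
Qed.

(** * Compactness, Gronwall-type iteration and the averaging operator *)

(** The maximum over a segment is again continuous in the parameter, so it can be taken one variable
    at a time: bounds and uniform continuity on boxes need only compactness of segments. *)
Lemma sup_segment {T : UniformSpace} (f : T -> R -> R) a b : a <= b ->
  cont (fun p : T * R => f (fst p) (snd p)) ->
  exists m : T -> R, cont m /\ (forall z x, a <= x <= b -> Rabs (f z x) <= m z)
    /\ (forall z c, (forall x, a <= x <= b -> Rabs (f z x) <= c) -> m z <= c).
Proof.
intros Hab Hf.
assert (H : forall z, exists m, (forall x, a <= x <= b -> Rabs (f z x) <= m)
    /\ (forall c, (forall x, a <= x <= b -> Rabs (f z x) <= c) -> m <= c)).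
{ intros z.
  assert (Hz : cont (fun x => Rabs (f z x))) by (apply cont_abs, (cont_curry f z Hf)).
  destruct (continuity_ab_maj (fun x => Rabs (f z x)) a b Hab) as [x0 [H1 H2]].
  - intros c _; apply continuity_pt_filterlim, Hz.
  - exists (Rabs (f z x0)); split; auto. }
destruct (choice _ H) as [m Hm]; exists m.
split; [|split; intros z; destruct (Hm z); auto].
intros z0; apply filterlim_locally; intros eps.
assert (He : 0 < eps / 2) by (destruct eps; simpl; lra).
destruct (tube f a b Hf z0 (mkposreal _ He)) as [d Hd].
exists d; intros z Hz.
change (Rabs (m z - m z0) < eps).
assert (A1 : m z <= m z0 + eps / 2).
{ apply (proj2 (Hm z)); intros x Hx.
  assert (B := Hd z Hz x Hx); simpl in B.
  assert (C := proj1 (Hm z0) x Hx).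
  replace (f z x) with ((f z x - f z0 x) + f z0 x) by ring.
  eapply Rle_trans; [apply Rabs_triang|]; lra. }
assert (A2 : m z0 <= m z + eps / 2).
{ apply (proj2 (Hm z0)); intros x Hx.
  assert (B := Hd z Hz x Hx); simpl in B; rewrite Rabs_minus_sym in B.
  assert (C := proj1 (Hm z) x Hx).
  replace (f z0 x) with ((f z0 x - f z x) + f z x) by ring.
  eapply Rle_trans; [apply Rabs_triang|]; lra. }
apply Rabs_def1; destruct eps; simpl in *; lra.
Qed.

Lemma bounded1 (f : R -> R) M : cont f -> 0 <= M ->
  exists B, 0 <= B /\ forall x, Rabs x <= M -> Rabs (f x) <= B.
Proof.
intros Hf HM.
destruct (sup_segment (fun _ : R => f) (-M) M) as [m [Hm [H1 _]]]; [lra|cont_tac|].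
exists (m 0); split.
- eapply Rle_trans; [apply Rabs_pos|apply (H1 0 0); lra].
- intros x Hx; apply H1; apply Rabs_le_between; auto.
Qed.

Lemma bounded2 (f : R -> R -> R) M N : c2 f -> 0 <= M -> 0 <= N ->
  exists B, 0 <= B /\ forall x y, Rabs x <= M -> Rabs y <= N -> Rabs (f x y) <= B.
Proof.
intros Hf HM HN.
destruct (sup_segment f (-N) N) as [m [Hm [H1 _]]]; [lra|exact Hf|].
destruct (bounded1 m M Hm HM) as [B [HB H2]].
exists B; split; auto; intros x y Hx Hy.
eapply Rle_trans; [apply H1; apply Rabs_le_between; auto|].
eapply Rle_trans; [apply Rle_abs|auto].
Qed.

Lemma bounded3 (f : R -> R -> R -> R) M N K : c3 f -> 0 <= M -> 0 <= N -> 0 <= K ->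
  exists B, 0 <= B /\ forall x y z, Rabs x <= M -> Rabs y <= N -> Rabs z <= K -> Rabs (f x y z) <= B.
Proof.
intros Hf HM HN HK.
destruct (sup_segment (fun (p : R * R) z => f (fst p) (snd p) z) (-K) K) as [m [Hm [H1 _]]];
  [lra|exact Hf|].
destruct (bounded2 (fun x y => m (x, y)) M N) as [B [HB H2]]; auto.
{ unfold c2; apply cont_comp; auto; cont_tac. }
exists B; split; auto; intros x y z Hx Hy Hz.
eapply Rle_trans; [apply (H1 (x, y) z); apply Rabs_le_between; auto|].
eapply Rle_trans; [apply Rle_abs|auto].
Qed.

Lemma unif_cont1 (f : R -> R) M eps : cont f -> 0 <= M -> 0 < eps ->
  exists d, 0 < d /\ forall x h, Rabs x <= M -> Rabs h <= d -> Rabs (f (x + h) - f x) <= eps.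
Proof.
intros Hf HM He.
destruct (sup_segment (fun h x => f (x + h) - f x) (-M) M) as [m [Hm [H1 H2]]]; [lra|cont_tac|].
destruct (Hm 0 (ball (m 0) (mkposreal _ He)) (locally_ball _ _)) as [[d Hd0] Hd].
exists (d / 2); split; [lra|]; intros x h Hx Hh.
assert (B : ball (m 0) eps (m h)).
{ apply Hd; change (Rabs (h - 0) < d); rewrite Rminus_0_r; lra. }
change (Rabs (m h - m 0) < eps) in B.
assert (m 0 <= 0).
{ apply H2; intros y _; rewrite Rplus_0_r, Rminus_diag, Rabs_R0; lra. }
apply Rabs_def2 in B.
eapply Rle_trans; [apply (H1 h x); apply Rabs_le_between; auto|]; lra.
Qed.

(** The increments [(h, k)] are kept as parameters while suprema are taken over [z], [y] and [x] in
    turn. What results is continuous in [(h, k)] and nonpositive at the origin. *)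
Lemma unif_cont3 (f : R -> R -> R -> R) M N K eps : c3 f -> 0 <= M -> 0 <= N -> 0 <= K -> 0 < eps ->
  exists d, 0 < d /\ forall x y z h k, Rabs x <= M -> Rabs y <= N -> Rabs z <= K ->
    Rabs h <= d -> Rabs k <= d -> Rabs (f x (y + h) (z + k) - f x y z) <= eps.
Proof.
intros Hf HM HN HK He.
destruct (sup_segment (fun (p : R * R * R * R) z =>
  f (snd (fst p)) (snd p + fst (fst (fst p))) (z + snd (fst (fst p))) - f (snd (fst p)) (snd p) z) (-K) K)
  as [m1 [Hm1 [H1 H1']]]; [lra|cont_tac|].
destruct (sup_segment (fun (p : R * R * R) y => m1 (p, y)) (-N) N)
  as [m2 [Hm2 [H2 H2']]]; [lra|apply cont_comp; auto; cont_tac|].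
destruct (sup_segment (fun (p : R * R) x => m2 (p, x)) (-M) M)
  as [m [Hm [H3 H3']]]; [lra|apply cont_comp; auto; cont_tac|].
destruct (Hm (0, 0) (ball (m (0, 0)) (mkposreal _ He)) (locally_ball _ _)) as [[d Hd0] Hd].
assert (Hpos : forall q, 0 <= m1 q).
{ intros q; eapply Rle_trans; [apply Rabs_pos|apply (H1 q 0); lra]. }
assert (Hpos2 : forall q, 0 <= m2 q).
{ intros q; eapply Rle_trans; [apply Rabs_pos|apply (H2 q 0); lra]. }
exists (d / 2); split; [lra|]; intros x y z h k Hx Hy Hz Hh Hk.
assert (B : ball (m (0, 0)) eps (m (h, k))).
{ apply Hd; split; [change (Rabs (h - 0) < d)|change (Rabs (k - 0) < d)];
    rewrite Rminus_0_r; lra. }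
change (Rabs (m (h, k) - m (0, 0)) < eps) in B.
assert (m (0, 0) <= 0).
{ apply H3'; intros x' _; rewrite Rabs_pos_eq by auto.
  apply H2'; intros y' _; rewrite Rabs_pos_eq by auto.
  apply H1'; intros z' _; simpl; rewrite !Rplus_0_r, Rminus_diag, Rabs_R0; lra. }
apply Rabs_def2 in B.
assert (C1 := H1 (h, k, x, y) z); assert (C2 := H2 (h, k, x) y); assert (C3 := H3 (h, k) x).
simpl in C1, C2, C3.
apply Rabs_le_between in Hx; apply Rabs_le_between in Hy; apply Rabs_le_between in Hz.
specialize (C1 Hz); specialize (C2 Hy); specialize (C3 Hx).
rewrite Rabs_pos_eq in C2, C3 by auto. lra.
Qed.

Lemma mvt_bound (f df : R -> R) a b M : (forall x, is_derive f x (df x)) ->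
  (forall x, Rmin a b <= x <= Rmax a b -> Rabs (df x) <= M) -> Rabs (f b - f a) <= M * Rabs (b - a).
Proof.
intros H HM; destruct (MVT_gen f a b df) as [c [Hc E]].
- intros; apply H.
- intros x _; apply continuity_pt_filterlim, (cont_derive f df H).
- rewrite E, Rabs_mult; apply Rmult_le_compat_r; [apply Rabs_pos|auto].
Qed.

Lemma half_limit x a b : (forall n : nat, x <= a + b * (1 / 2) ^ n) -> x <= a.
Proof.
intros H.
apply (is_lim_seq_le (fun _ => x) (fun n => a + b * (1 / 2) ^ n) x a H (is_lim_seq_const x)).
replace (Finite a) with (Finite (a + b * 0)) by (f_equal; ring).
apply is_lim_seq_plus'; [apply is_lim_seq_const|].
apply (is_lim_seq_scal_l (fun n => (1 / 2) ^ n) b 0), is_lim_seq_geom; rewrite Rabs_pos_eq; lra.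
Qed.

(** A substitute for Gronwall's lemma: a bound that improves from [m] to [eps + m / 2] improves to
    its fixed point [2 * eps]. The formula is the exact [n]-th iterate of [B]. *)
Lemma iterate_half (Bd : R -> Prop) eps B : 0 <= eps -> 0 <= B -> Bd B ->
  (forall m, 0 <= m -> Bd m -> Bd (eps + m / 2)) ->
  forall n : nat, Bd (2 * eps + (B - 2 * eps) * (1 / 2) ^ n).
Proof.
intros He HB H0 HS n.
assert (Hh : forall n, 0 <= (1 / 2) ^ n <= 1).
{ intros k; split; [apply pow_le; lra|].
  assert (A := pow_incr (1 / 2) 1 k); rewrite pow1 in A; apply A; lra. }
induction n as [|n IH]; simpl.
- replace (2 * eps + (B - 2 * eps) * 1) with B by ring; auto.
- replace (2 * eps + (B - 2 * eps) * (1 / 2 * (1 / 2) ^ n))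
    with (eps + (2 * eps + (B - 2 * eps) * (1 / 2) ^ n) / 2) by field.
  apply HS; auto. specialize (Hh n); nra.
Qed.

(** Integration in time gains the factor [1 / lam] on the weight [exp (lam * Rabs s)], for either
    sign of [t]. A large [lam] thus turns a Volterra operator into a contraction without any
    restriction on the time. *)
Lemma exp_int (g : R -> R) C lam t : cont g -> 0 <= C -> 0 < lam ->
  (forall s, Rmin 0 t <= s <= Rmax 0 t -> Rabs (g s) <= C * exp (lam * Rabs s)) ->
  Rabs (RInt g 0 t) <= C / lam * exp (lam * Rabs t).
Proof.
intros Hg HC Hl H.
assert (K : forall (h : R -> R) T, cont h -> 0 <= T ->
  (forall s, 0 <= s <= T -> Rabs (h s) <= C * exp (lam * s)) ->
  Rabs (RInt h 0 T) <= C / lam * exp (lam * T)).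
{ intros h T Hh HT Hb.
  eapply Rle_trans; [apply (RI_abs_le h (fun s => C * exp (lam * s))); auto|].
  - cont_tac.
  - rewrite (RI_derive (fun s => C / lam * exp (lam * s))).
    + rewrite Rmult_0_r, exp_0.
      assert (0 <= C / lam) by (apply Rdiv_le_0_compat; auto). lra.
    + intros s; eapply is_derive_eq.
      * apply der_scal. apply der_comp; [apply is_derive_exp|apply der_scal, der_id].
      * field; lra.
    + cont_tac. }
destruct (Rle_dec 0 t) as [Ht|Ht].
- rewrite (Rabs_pos_eq t) by auto; apply K; auto.
  intros s Hs; rewrite Rmin_left, Rmax_right in H by auto.
  rewrite <- (Rabs_pos_eq s) at 2 by lra; auto.
- rewrite (Rabs_left t) by lra.
  assert (E := RI_lin g (-1) 0 0 (-t) Hg).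
  replace (-1 * 0 + 0) with 0 in E by ring; replace (-1 * - t + 0) with t in E by ring.
  rewrite <- E, Rabs_mult; replace (Rabs (-1)) with 1 by (rewrite Rabs_left; lra); rewrite Rmult_1_l.
  apply K; [cont_tac|lra|].
  intros s Hs; rewrite Rmin_right, Rmax_left in H by lra.
  replace s with (Rabs (-1 * s + 0)) at 2; [apply H; lra|].
  rewrite Rabs_left1; lra.
Qed.

(* If [v = r u] is odd in [r] and [P = v_t + v_r], then [u = avg 0 P]: the average replaces the
   singular division by [r]. The weights [x ^ j] appear on differentiating in [r]. *)
Definition avg (j : nat) (Z : R -> R -> R) (t r : R) : R :=
  / 2 * RInt (fun x => x ^ j * Z t (x * r)) (-1) 1.

Section Average.
Variables (j : nat) (Z : R -> R -> R).
Hypothesis HZ : c2 Z.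

Lemma avg_integrand_cont t r : cont (fun x => x ^ j * Z t (x * r)).
Proof. cont_tac. Qed.

Lemma c2_avg : c2 (avg j Z).
Proof. unfold avg; cont_tac. Qed.

Lemma abs_pow_le_1 x : -1 <= x <= 1 -> Rabs (x ^ j) <= 1.
Proof.
intros Hx; rewrite <- RPow_abs, <- (pow1 j); apply pow_incr.
split; [apply Rabs_pos|apply Rabs_le; lra].
Qed.

Lemma avg_bound t r M : (forall x, -1 <= x <= 1 -> Rabs (Z t (x * r)) <= M) -> Rabs (avg j Z t r) <= M.
Proof.
intros H; unfold avg; rewrite Rabs_mult, (Rabs_pos_eq (/ 2)) by lra.
assert (Rabs (RInt (fun x => x ^ j * Z t (x * r)) (-1) 1) <= (1 - -1) * M); [|lra].
apply RI_abs_const; [lra|cont_tac|].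
intros x Hx; rewrite Rabs_mult.
assert (A := abs_pow_le_1 x Hx); assert (B := H x Hx).
assert (0 <= Rabs (x ^ j)) by apply Rabs_pos; assert (0 <= Rabs (Z t (x * r))) by apply Rabs_pos.
nra.
Qed.

Lemma avg_der_r (Zr : R -> R -> R) t r : c2 Zr -> (forall t r, is_derive (Z t) r (Zr t r)) ->
  is_derive (avg j Z t) r (avg (S j) Zr t r).
Proof.
intros Hc H; unfold avg; apply der_scal.
apply (derive_RInt_param (fun r x => x ^ j * Z t (x * r)) (fun r x => x ^ S j * Zr t (x * r))); try cont_tac.
- intros s; cont_tac.
- intros s y; eapply is_derive_eq.
  + apply der_scal. apply (der_comp (Z t) (fun s => y * s)); [apply H|apply der_scal, der_id].
  + simpl; ring.
Qed.

Lemma avg_der_t (Zt : R -> R -> R) t r : c2 Zt -> (forall t r, is_derive (fun s => Z s r) t (Zt t r)) ->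
  is_derive (fun s => avg j Z s r) t (avg j Zt t r).
Proof.
intros Hc H; unfold avg; apply der_scal.
apply (derive_RInt_param (fun t x => x ^ j * Z t (x * r)) (fun t x => x ^ j * Zt t (x * r))); try cont_tac.
- intros s; cont_tac.
- intros s y; apply (der_scal (fun s => Z s (y * r))), H.
Qed.

End Average.

Lemma avg_minus j Z Z' t r : c2 Z -> c2 Z' ->
  avg j Z t r - avg j Z' t r = avg j (fun t r => Z t r - Z' t r) t r.
Proof.
intros HZ HZ'; unfold avg.
rewrite <- Rmult_minus_distr_l, <- RI_minus by (apply avg_integrand_cont; auto).
f_equal; apply RI_ext; intros; ring.
Qed.

(** This is [r u = v]: in [P = v_t + v_r] the term [v_t] is odd and [v_r] is even in [r], so the
    symmetric integral of [P] is [2 v]. *)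
Lemma avg0_mult Z t r : c2 Z -> r * avg 0 Z t r = / 2 * RInt (Z t) (- r) r.
Proof.
intros HZ; unfold avg.
assert (E := RI_lin (Z t) r 0 (-1) 1 (cont_curry Z t HZ)).
replace (r * -1 + 0) with (- r) in E by ring; replace (r * 1 + 0) with r in E by ring.
rewrite <- E; rewrite <- Rmult_assoc, (Rmult_comm r), Rmult_assoc; do 2 f_equal.
apply RI_ext; intros x _; simpl; rewrite Rmult_1_l; f_equal; ring.
Qed.

Lemma avg0_even Z t r : c2 Z -> avg 0 Z t (- r) = avg 0 Z t r.
Proof.
intros HZ; unfold avg; f_equal.
assert (E := RI_lin (fun x => x ^ 0 * Z t (x * r)) (-1) 0 (-1) 1 (avg_integrand_cont 0 Z HZ t r)).
replace (-1 * -1 + 0) with 1 in E by ring; replace (-1 * 1 + 0) with (-1) in E by ring.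
rewrite (RI_swap _ (-1) 1) in E by (apply avg_integrand_cont; auto).
apply Rmult_eq_reg_l with (-1); [|lra].
transitivity (- RInt (fun x : R => x ^ 0 * Z t (x * r)) (-1) 1); [|ring].
rewrite <- E; f_equal; apply RI_ext; intros x _; simpl; do 2 f_equal; ring.
Qed.

(** * The characteristic integral equation *)

(* Integration of [Z_t - Z_r = G] along the characteristic [s |-> r + t - s] through [(t, r)]. The cones
   [Rabs t + Rabs r <= K] are domains of dependence, see [cone_path] and [cone_scal]. *)
Definition duhamel (j : nat) (Z0 : R -> R) (G : R -> R -> R -> R) (Z : R -> R -> R) (t r : R) : R :=
  Z0 (r + t) + RInt (fun s => G s (r + t - s) (avg j Z s (r + t - s))) 0 t.

Definition lipschitz_on (G : R -> R -> R -> R) (L K : R) : Prop :=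
  forall s x y y', Rabs s + Rabs x <= K -> Rabs (G s x y - G s x y') <= L * Rabs (y - y').

Lemma cone_path t r s : Rmin 0 t <= s <= Rmax 0 t -> Rabs s + Rabs (r + t - s) <= Rabs t + Rabs r.
Proof.
abs_lra.
Qed.

Lemma cone_scal t r x K : -1 <= x <= 1 -> Rabs t + Rabs r <= K -> Rabs t + Rabs (x * r) <= K.
Proof.
intros Hx H; rewrite Rabs_mult; assert (Rabs x <= 1) by (apply Rabs_le; lra).
assert (0 <= Rabs r) by apply Rabs_pos; nra.
Qed.

Lemma c2_duhamel j Z0 G Z : cont Z0 -> c3 G -> c2 Z -> c2 (duhamel j Z0 G Z).
Proof.
intros H0 HG HZ; assert (c2_A := c2_avg j Z HZ); unfold duhamel; cont_tac.
Qed.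

(** Characteristics run back to time 0, and averages, stay inside the cone, so the estimate on a
    cone refers only to that cone. The weight gains [1 / (2 * L)] against the Lipschitz constant
    [L], whence the factor one half. *)
Lemma duhamel_contract j Z0 G Z Z' K L m : c3 G -> c2 Z -> c2 Z' -> 0 < L -> 0 <= m ->
  lipschitz_on G L K ->
  (forall t r, Rabs t + Rabs r <= K -> Rabs (Z t r - Z' t r) <= m * exp (2 * L * Rabs t)) ->
  forall t r, Rabs t + Rabs r <= K ->
    Rabs (duhamel j Z0 G Z t r - duhamel j Z0 G Z' t r) <= m / 2 * exp (2 * L * Rabs t).
Proof.
intros HG HZ HZ' HL Hm Hlip H t r Htr; unfold duhamel.
assert (c2_A := c2_avg j Z HZ); assert (HA' := c2_avg j Z' HZ').
replace (Z0 (r + t) + RInt (fun s : R => G s (r + t - s) (avg j Z s (r + t - s))) 0 t -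
  (Z0 (r + t) + RInt (fun s : R => G s (r + t - s) (avg j Z' s (r + t - s))) 0 t))
  with (RInt (fun s : R => G s (r + t - s) (avg j Z s (r + t - s))
    - G s (r + t - s) (avg j Z' s (r + t - s))) 0 t).
2:{ rewrite RI_minus; [real_eq; ring|cont_tac|cont_tac]. }
replace (m / 2) with (L * m / (2 * L)) by (field; lra).
apply exp_int; [cont_tac|nra|lra|].
intros s Hs; assert (Hc := cone_path t r s Hs).
eapply Rle_trans; [apply Hlip; lra|].
rewrite Rmult_assoc; apply Rmult_le_compat_l; [lra|].
rewrite avg_minus by auto.
apply avg_bound; [unfold c2; cont_tac|].
intros x Hx; apply H, cone_scal; auto; lra.
Qed.

Lemma unif_limit (f : nat -> R -> R -> R) : (forall n, c2 (f n)) ->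
  (forall K, 0 <= K -> exists C, 0 <= C /\ forall n t r, Rabs t + Rabs r <= K ->
     Rabs (f (S n) t r - f n t r) <= C * (1 / 2) ^ n) ->
  exists Z, c2 Z /\ forall K, 0 <= K -> exists C, 0 <= C /\ forall n t r, Rabs t + Rabs r <= K ->
     Rabs (Z t r - f n t r) <= C * (1 / 2) ^ n.
Proof.
intros Hf H.
assert (Hh : forall n : nat, 0 < (1 / 2) ^ n) by (intros; apply pow_lt; lra).
assert (HK : forall K, 0 <= K -> exists C, 0 <= C /\ forall n k t r, Rabs t + Rabs r <= K ->
     Rabs (f (n + k)%nat t r - f n t r) <= C * (1 / 2) ^ n).
{ intros K HK; destruct (H K HK) as [C [HC H1]]; exists (2 * C); split; [lra|].
  intros n k t r Htr.
  (* Subtracting the power [n + k] makes the bound stable under induction on [k]. *)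
  assert (A : Rabs (f (n + k)%nat t r - f n t r) <= 2 * C * ((1 / 2) ^ n - (1 / 2) ^ (n + k))).
  { induction k as [|k IH].
    - rewrite Nat.add_0_r, !Rminus_diag, Rabs_R0; lra.
    - assert (B := H1 (n + k)%nat t r Htr). rewrite Nat.add_succ_r; simpl.
      replace (f (S (n + k)) t r - f n t r)
        with ((f (S (n + k)) t r - f (n + k)%nat t r) + (f (n + k)%nat t r - f n t r)) by ring.
      eapply Rle_trans; [apply Rabs_triang|]. lra. }
  specialize (Hh (n + k)%nat). nra. }
assert (Hlim : forall t r, exists l : R, is_lim_seq (fun n => f n t r) l).
{ intros t r.
  destruct (HK (Rabs t + Rabs r)) as [C [HC H1]].
  { assert (A := Rabs_pos t); assert (B := Rabs_pos r); lra. }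
  apply ex_lim_seq_cauchy_corr; intros eps.
  destruct (pow_lt_1_zero (1 / 2)) with (y := eps / (2 * C + 1)) as [N HN].
  { rewrite Rabs_pos_eq; lra. }
  { apply Rdiv_lt_0_compat; [apply cond_pos|lra]. }
  assert (HN' := HN N (le_n N)); rewrite Rabs_pos_eq in HN' by (left; auto).
  apply Rmult_lt_compat_r with (r := 2 * C + 1) in HN'; [|lra].
  unfold Rdiv in HN' at 2; rewrite Rmult_assoc, Rinv_l, Rmult_1_r in HN' by lra.
  exists N; intros n m Hn Hm.
  assert (A1 := H1 N (n - N)%nat t r (Rle_refl _)); assert (A2 := H1 N (m - N)%nat t r (Rle_refl _)).
  replace (N + (n - N))%nat with n in A1 by lia; replace (N + (m - N))%nat with m in A2 by lia.
  replace (f n t r - f m t r) with ((f n t r - f N t r) - (f m t r - f N t r)) by ring.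
  eapply Rle_lt_trans; [apply Rabs_triang|]; rewrite Rabs_Ropp.
  specialize (Hh N); nra. }
destruct (choice (fun (z : R * R) l => is_lim_seq (fun n => f n (fst z) (snd z)) (Finite l))) as [Z HZ].
{ intros z; apply Hlim. }
assert (HB : forall K, 0 <= K -> exists C, 0 <= C /\ forall n t r, Rabs t + Rabs r <= K ->
     Rabs (Z (t, r) - f n t r) <= C * (1 / 2) ^ n).
{ intros K HK0; destruct (HK K HK0) as [C [HC H1]]; exists C; split; auto.
  intros n t r Htr.
  assert (A : is_lim_seq (fun k => Rabs (f (n + k)%nat t r - f n t r)) (Rabs (Z (t, r) - f n t r))).
  { apply (is_lim_seq_abs _ (Z (t, r) - f n t r)).
    apply is_lim_seq_minus'; [|apply is_lim_seq_const].
    apply is_lim_seq_ext with (fun k => f (k + n)%nat t r).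
    - intros k; f_equal; lia.
    - apply (is_lim_seq_incr_n (fun n => f n t r)), (HZ (t, r)). }
  apply (is_lim_seq_le _ (fun _ => C * (1 / 2) ^ n) _ (C * (1 / 2) ^ n)
    (fun k => H1 n k t r Htr) A (is_lim_seq_const _)). }
exists (fun t r => Z (t, r)); split; auto.
intros [t0 r0]; apply filterlim_locally; intros eps; simpl.
(* This cone contains every point whose coordinates differ from those of [(t0, r0)] by less than
   1. *)
set (K := Rabs t0 + Rabs r0 + 2).
destruct (HB K) as [C [HC H1]].
{ unfold K; assert (A := Rabs_pos t0); assert (B := Rabs_pos r0); lra. }
destruct (pow_lt_1_zero (1 / 2)) with (y := eps / 3 / (C + 1)) as [N HN].
{ rewrite Rabs_pos_eq; lra. }
{ apply Rdiv_lt_0_compat; [|lra]. destruct eps; simpl; lra. }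
assert (HN' := HN N (le_n N)); rewrite Rabs_pos_eq in HN' by (left; auto).
apply Rmult_lt_compat_r with (r := C + 1) in HN'; [|lra].
replace (eps / 3 / (C + 1) * (C + 1)) with (eps / 3) in HN' by (field; lra).
assert (He : 0 < eps / 3) by (destruct eps; simpl; lra).
destruct (Hf N (t0, r0) (ball (f N t0 r0) (mkposreal _ He)) (locally_ball _ _)) as [d Hd].
assert (Hd1 : 0 < Rmin d 1) by (apply Rmin_glb_lt; [apply cond_pos|lra]).
exists (mkposreal _ Hd1); intros [t r] [Bt Br]; simpl in Bt, Br.
change (Rabs (t - t0) < Rmin d 1) in Bt; change (Rabs (r - r0) < Rmin d 1) in Br.
assert (Rmin d 1 <= d) by apply Rmin_l; assert (Rmin d 1 <= 1) by apply Rmin_r.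
assert (B : ball (f N t0 r0) (mkposreal _ He) (f N t r)).
{ apply (Hd (t, r)); split; [change (Rabs (t - t0) < d)|change (Rabs (r - r0) < d)]; lra. }
change (Rabs (f N t r - f N t0 r0) < eps / 3) in B.
change (Rabs (Z (t, r) - Z (t0, r0)) < eps).
assert (A1 := H1 N t r); assert (A2 := H1 N t0 r0).
assert (Rabs t <= Rabs t0 + Rabs (t - t0)).
{ replace t with (t0 + (t - t0)) at 1 by ring; apply Rabs_triang. }
assert (Rabs r <= Rabs r0 + Rabs (r - r0)).
{ replace r with (r0 + (r - r0)) at 1 by ring; apply Rabs_triang. }
specialize (A1 ltac:(unfold K; lra)); specialize (A2 ltac:(unfold K; lra)).
replace (Z (t, r) - Z (t0, r0)) with ((Z (t, r) - f N t r) + (f N t r - f N t0 r0)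
  + - (Z (t0, r0) - f N t0 r0)) by ring.
eapply Rle_lt_trans; [apply Rabs_triang|]; rewrite Rabs_Ropp.
assert (T := Rabs_triang (Z (t, r) - f N t r) (f N t r - f N t0 r0)).
specialize (Hh N); set (q := (1 / 2) ^ N) in *; clearbody q; clear - A1 A2 B T HN' Hh HC.
assert (L : forall a b c, a <= C * q -> b < eps / 3 -> c <= C * q -> a + b + c < eps) by (intros; nra).
eapply Rle_lt_trans; [apply Rplus_le_compat_r, T|]; apply L; auto.
Qed.

(** A single sequence of iterates serves all cones: only the constant and the exponential weight
    depend on [K], and locally uniform convergence suffices. *)
Lemma picard j Z0 G : cont Z0 -> c3 G -> (forall K, 0 <= K -> exists L, lipschitz_on G L K) ->
  exists Z, c2 Z /\ forall t r, Z t r = duhamel j Z0 G Z t r.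
Proof.
intros H0 HG HL.
set (f := fix f n := match n with O => fun _ _ => 0 | S n => duhamel j Z0 G (f n) end).
assert (Hf : forall n, c2 (f n)).
{ induction n; simpl; [unfold c2; cont_tac|apply c2_duhamel; auto]. }
assert (HL' : forall K, 0 <= K -> exists L, 0 < L /\ lipschitz_on G L K).
{ intros K HK; destruct (HL K HK) as [L H1]; exists (Rmax L 1); split.
  - assert (A := Rmax_r L 1); lra.
  - intros s x y y' Hs; eapply Rle_trans; [apply H1; auto|].
    apply Rmult_le_compat_r; [apply Rabs_pos|apply Rmax_l]. }
destruct (unif_limit f Hf) as [Z [HZ H1]].
{ intros K HK; destruct (HL' K HK) as [L [HLp HLip]].
  destruct (bounded2 (fun t r => f 1%nat t r - f 0%nat t r) K K) as [B [HB H2]]; auto.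
  { unfold c2; apply cont_minus; [apply (Hf 1%nat)|apply (Hf 0%nat)]. }
  exists (B * exp (2 * L * K)); split; [apply Rmult_le_pos; auto; left; apply exp_pos|].
  assert (A : forall n t r, Rabs t + Rabs r <= K ->
    Rabs (f (S n) t r - f n t r) <= B * (1 / 2) ^ n * exp (2 * L * Rabs t)).
  { induction n as [|n IH]; intros t r Htr.
    - assert (P1 := Rabs_pos t); assert (P2 := Rabs_pos r).
      eapply Rle_trans; [apply H2; lra|].
      rewrite pow_O, Rmult_1_r; rewrite <- (Rmult_1_r B) at 1.
      apply Rmult_le_compat_l; auto.
      assert (E := exp_ineq1_le (2 * L * Rabs t)); assert (0 <= 2 * L * Rabs t) by nra; lra.
    - replace (B * (1 / 2) ^ S n) with (B * (1 / 2) ^ n / 2) by (simpl; field).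
      change (f (S (S n))) with (duhamel j Z0 G (f (S n))).
      change (f (S n)) with (duhamel j Z0 G (f n)) at 2.
      apply (duhamel_contract j Z0 G) with (K := K); auto.
      apply Rmult_le_pos; auto; apply pow_le; lra. }
  intros n t r Htr; eapply Rle_trans; [apply A; auto|].
  rewrite Rmult_assoc, (Rmult_comm _ (exp _)), <- Rmult_assoc.
  apply Rmult_le_compat_r; [apply pow_le; lra|].
  apply Rmult_le_compat_l; auto.
  assert (P1 := Rabs_pos t); assert (P2 := Rabs_pos r).
  destruct (Rle_lt_or_eq_dec (2 * L * Rabs t) (2 * L * K)) as [Hlt|Heq];
    [nra|left; apply exp_increasing; auto|right; f_equal; auto]. }
exists Z; split; auto; intros t r.
assert (HK : 0 <= Rabs t + Rabs r) by (assert (P1 := Rabs_pos t); assert (P2 := Rabs_pos r); lra).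
destruct (H1 _ HK) as [C [HC H2]]; destruct (HL' _ HK) as [L [HLp HLip]].
assert (E : Rabs (Z t r - duhamel j Z0 G Z t r) <= 0).
{ apply half_limit with (b := C + C * exp (2 * L * Rabs t)); intros n; rewrite Rplus_0_l.
  replace (Z t r - duhamel j Z0 G Z t r)
    with ((Z t r - f (S n) t r) + - (duhamel j Z0 G Z t r - duhamel j Z0 G (f n) t r)) by (simpl; ring).
  eapply Rle_trans; [apply Rabs_triang|]; rewrite Rabs_Ropp.
  assert (P : 0 < (1 / 2) ^ n) by (apply pow_lt; lra).
  assert (A1 := H2 (S n) t r (Rle_refl _)); simpl in A1.
  assert (A2 : Rabs (duhamel j Z0 G Z t r - duhamel j Z0 G (f n) t r)
    <= C * (1 / 2) ^ n / 2 * exp (2 * L * Rabs t)).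
  { apply (duhamel_contract j Z0 G) with (K := Rabs t + Rabs r); auto; [nra| |lra].
    intros s x Hs; eapply Rle_trans; [apply H2; auto|].
    rewrite <- (Rmult_1_r (C * _)) at 1; apply Rmult_le_compat_l; [nra|].
    assert (E := exp_ineq1_le (2 * L * Rabs s)); assert (P1 := Rabs_pos s).
    assert (0 <= 2 * L * Rabs s) by nra; lra. }
  assert (0 < exp (2 * L * Rabs t)) by apply exp_pos.
  assert (0 <= C * (1 / 2) ^ n) by nra.
  assert (0 <= C * (1 / 2) ^ n * exp (2 * L * Rabs t)) by (apply Rmult_le_pos; lra).
  simpl; nra. }
assert (P := Rabs_pos (Z t r - duhamel j Z0 G Z t r)).
apply Rminus_diag_uniq; destruct (Req_dec (Z t r - duhamel j Z0 G Z t r) 0) as [|N]; auto.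
apply Rabs_no_R0 in N; lra.
Qed.

(** On the cone the data are read only at [r + t], hence in [[-K, K]]. Agreement there is enough,
    which is what permits the cutoff of the data. *)
Lemma duhamel_unique j Z0 Z0' G Z Z' L K : c3 G -> c2 Z -> c2 Z' -> 0 <= K -> lipschitz_on G L K ->
  (forall c, Rabs c <= K -> Z0 c = Z0' c) ->
  (forall t r, Rabs t + Rabs r <= K -> Z t r = duhamel j Z0 G Z t r) ->
  (forall t r, Rabs t + Rabs r <= K -> Z' t r = duhamel j Z0' G Z' t r) ->
  forall t r, Rabs t + Rabs r <= K -> Z t r = Z' t r.
Proof.
intros HG HZ HZ' HK HL H0 H1 H2 t r Htr.
destruct (bounded2 (fun t r => Z t r - Z' t r) K K) as [B [HB HB']]; auto.
{ unfold c2; cont_tac. }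
set (M := Rmax L 1).
assert (HM : 0 < M) by (assert (A := Rmax_r L 1); unfold M; lra).
assert (HLM : lipschitz_on G M K).
{ intros s x y y' Hs; eapply Rle_trans; [apply HL; auto|].
  apply Rmult_le_compat_r; [apply Rabs_pos|apply Rmax_l]. }
set (Bd := fun m => forall t r, Rabs t + Rabs r <= K -> Rabs (Z t r - Z' t r) <= m * exp (2 * M * Rabs t)).
assert (A : forall n : nat, Bd (2 * 0 + (B - 2 * 0) * (1 / 2) ^ n)).
{ apply iterate_half; auto; [lra| |].
  - intros s x Hs; assert (P1 := Rabs_pos s); assert (P2 := Rabs_pos x).
    eapply Rle_trans; [apply HB'; lra|].
    rewrite <- (Rmult_1_r B) at 1; apply Rmult_le_compat_l; auto.
    assert (E := exp_ineq1_le (2 * M * Rabs s)); assert (0 <= 2 * M * Rabs s) by nra; lra.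
  - intros m Hm Hbd s x Hs; rewrite Rplus_0_l.
    rewrite (H1 s x Hs), (H2 s x Hs).
    replace (duhamel j Z0' G Z' s x) with (duhamel j Z0 G Z' s x).
    + apply duhamel_contract with (K := K); auto.
    + unfold duhamel; rewrite (H0 (x + s)); auto.
      eapply Rle_trans; [apply Rabs_triang|]; lra. }
assert (Rabs (Z t r - Z' t r) <= 0).
{ apply half_limit with (b := B * exp (2 * M * Rabs t)); intros n.
  eapply Rle_trans; [apply (A n t r Htr)|]; right; ring. }
assert (P := Rabs_pos (Z t r - Z' t r)).
apply Rminus_diag_uniq; destruct (Req_dec (Z t r - Z' t r) 0) as [|N]; auto.
apply Rabs_no_R0 in N; lra.
Qed.

(** * Differentiability of solutions of the integral equation *)

Lemma leibniz (f df : R -> R -> R) t : c2 f -> c2 df ->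
  (forall t s, is_derive (fun t => f t s) t (df t s)) ->
  is_derive (fun t => RInt (f t) 0 t) t (RInt (df t) 0 t + f t t).
Proof.
intros Hf Hd H.
assert (E : (fun u v : R => Derive (fun z : R => f z v) u) = df).
{ extensionality u; extensionality v; apply is_derive_unique, H. }
eapply is_derive_eq.
- apply (is_derive_RInt_param_bound_comp f (fun _ => 0) (fun t => t) t 0 1).
  + apply filter_forall; intros y; apply (cont_ex_RInt (f y)), (cont_curry f y Hf).
  + exists (mkposreal 1 Rlt_0_1); apply filter_forall; intros y.
    apply (cont_ex_RInt (f y)), (cont_curry f y Hf).
  + exists (mkposreal 1 Rlt_0_1); apply filter_forall; intros y.
    apply (cont_ex_RInt (f y)), (cont_curry f y Hf).
  + apply der_const.
  + apply der_id.
  + exists (mkposreal 1 Rlt_0_1); apply filter_forall; intros y s _; exists (df y s); apply H.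
  + intros s _; rewrite E; apply c2_continuity_2d; auto.
  + rewrite E; exists (mkposreal 1 Rlt_0_1); intros; apply c2_continuity_2d; auto.
  + rewrite E; exists (mkposreal 1 Rlt_0_1); intros; apply c2_continuity_2d; auto.
  + apply continuity_pt_filterlim, (cont_curry f t Hf).
  + apply continuity_pt_filterlim, (cont_curry f t Hf).
- rewrite Rmult_0_r, Rmult_1_r, Rplus_0_r; f_equal.
  apply RI_ext; intros s _; apply is_derive_unique, H.
Qed.

Lemma taylor_slope (f df : R -> R) a h l eps : (forall x, is_derive f x (df x)) ->
  (forall x, Rabs x <= Rabs h -> Rabs (df (a + x) - l) <= eps) ->
  Rabs (f (a + h) - f a - h * l) <= eps * Rabs h.
Proof.
intros H He.
assert (A := mvt_bound (fun x => f (a + x) - x * l) (fun x => df (a + x) - l) 0 h eps).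
replace (f (a + h) - f a - h * l) with (f (a + h) - h * l - (f (a + 0) - 0 * l)).
2:{ rewrite Rplus_0_r; ring. }
rewrite Rminus_0_r in A; apply A.
- intros x; eapply is_derive_eq.
  + apply der_minus.
    * apply (der_comp f (fun x => a + x)); [apply H|apply der_plus; [apply der_const|apply der_id]].
    * apply der_mult; [apply der_id|apply der_const].
  + cbv beta; ring.
- intros x Hx; apply He; revert Hx; abs_lra.
Qed.

Lemma exp_int_affine (g : R -> R) a C lam t : cont g -> 0 <= a -> 0 <= C -> 0 < lam ->
  (forall s, Rmin 0 t <= s <= Rmax 0 t -> Rabs (g s) <= a + C * exp (lam * Rabs s)) ->
  Rabs (RInt g 0 t) <= a * Rabs t + C / lam * exp (lam * Rabs t).
Proof.
intros Hg Ha HC Hl H.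
assert (E : Rabs (RInt g 0 t) <= Rabs (RInt (fun s => a + C * exp (lam * Rabs s)) 0 t)).
{ destruct (Rle_dec 0 t) as [Ht|Ht].
  - rewrite Rmin_left, Rmax_right in H by auto.
    eapply Rle_trans; [apply RI_abs_le; [auto|cont_tac| |exact H]; cont_tac|apply Rle_abs].
  - rewrite Rmin_right, Rmax_left in H by lra.
    rewrite (RI_swap g t 0), (RI_swap (fun s => a + C * exp (lam * Rabs s)) t 0) by cont_tac.
    rewrite !Rabs_Ropp.
    eapply Rle_trans; [apply RI_abs_le; [lra|cont_tac| |exact H]; cont_tac|apply Rle_abs]. }
eapply Rle_trans; [exact E|].
rewrite RI_plus, RI_const by cont_tac.
eapply Rle_trans; [apply Rabs_triang|].
apply Rplus_le_compat.
- rewrite Rminus_0_r, Rabs_mult, (Rabs_pos_eq a), Rmult_comm by auto; lra.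
- apply exp_int; [cont_tac|auto|auto|].
  intros s _; rewrite Rabs_pos_eq; [lra|]. apply Rmult_le_pos; [auto|left; apply exp_pos].
Qed.

Section Differentiability.

Variables (j : nat) (Z0 dZ0 : R -> R) (G Gx Gy : R -> R -> R -> R) (Z : R -> R -> R).
Hypotheses (HZ0 : forall x, is_derive Z0 x (dZ0 x)) (HdZ0 : cont dZ0)
  (HG : c3 G) (HGx : c3 Gx) (HGy : c3 Gy)
  (HdGx : forall s x y, is_derive (fun x => G s x y) x (Gx s x y))
  (HdGy : forall s x y, is_derive (G s x) y (Gy s x y))
  (HZ : c2 Z) (HZE : forall t r, Z t r = duhamel j Z0 G Z t r).

Let A := avg j Z.

Lemma c2_A : c2 A.
Proof. apply c2_avg; auto. Qed.

Lemma duhamel_diff t r h : Z t (r + h) - Z t r = (Z0 (r + t + h) - Z0 (r + t))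
  + RInt (fun s => G s (r + t - s + h) (A s (r + t - s + h)) - G s (r + t - s) (A s (r + t - s))) 0 t.
Proof.
assert (H := c2_A).
rewrite !HZE; unfold duhamel; fold A; rewrite RI_minus by cont_tac.
replace (r + h + t) with (r + t + h) by ring.
replace (RInt (fun s : R => G s (r + t + h - s) (A s (r + t + h - s))) 0 t)
  with (RInt (fun s : R => G s (r + t - s + h) (A s (r + t - s + h))) 0 t).
- real_eq; ring.
- apply RI_ext; intros s _; replace (r + t + h - s) with (r + t - s + h) by ring; auto.
Qed.

Lemma shift_le u v K : Rabs u + Rabs v <= K -> Rabs (u + v) <= K.
Proof. intros H; eapply Rle_trans; [apply Rabs_triang|auto]. Qed.

Lemma scal_le b x : -1 <= b <= 1 -> Rabs (b * x) <= Rabs x.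
Proof.
intros Hb; rewrite Rabs_mult; assert (Rabs b <= 1) by (apply Rabs_le; lra).
assert (0 <= Rabs x) by apply Rabs_pos; nra.
Qed.

(** The source obtained by differentiating formally in [r]: the argument [y] stands for the
    derivative of [avg j Z], which is [avg (S j)] of the derivative of [Z]. *)
Let G' s x y := Gx s x (A s x) + Gy s x (A s x) * y.

Lemma c3_G' : c3 G'.
Proof. assert (H := c2_A); unfold G'; cont_tac. Qed.

Lemma lipschitz_G' K : 0 <= K -> exists L, lipschitz_on G' L K.
Proof.
intros HK; assert (H := c2_A).
destruct (bounded2 (fun s x => Gy s x (A s x)) K K) as [L [HL HL1]]; [cont_tac|auto|auto|].
exists L; intros s x y y' Hs; unfold G'.
assert (P1 := Rabs_pos s); assert (P2 := Rabs_pos x).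
replace (Gx s x (A s x) + Gy s x (A s x) * y - (Gx s x (A s x) + Gy s x (A s x) * y'))
  with (Gy s x (A s x) * (y - y')) by ring.
rewrite Rabs_mult; apply Rmult_le_compat_r; [apply Rabs_pos|apply HL1; lra].
Qed.

Variable Y : R -> R -> R.
Hypotheses (HY : c2 Y) (HYE : forall t r, Y t r = duhamel (S j) dZ0 G' Y t r).

Lemma avg_shift_deriv_bound s x k M :
  (forall b, -1 <= b <= 1 -> Rabs (Z s (b * x + b * k) - Z s (b * x) - b * k * Y s (b * x)) <= M) ->
  Rabs (A s (x + k) - A s x - k * avg (S j) Y s x) <= M.
Proof.
intros H.
assert (E : A s (x + k) - A s x - k * avg (S j) Y s x
  = avg j (fun t y => Z t (y * (x + k)) - Z t (y * x) - y * k * Y t (y * x)) s 1).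
{ unfold A, avg.
  replace (k * (/ 2 * RInt (fun b => b ^ S j * Y s (b * x)) (-1) 1))
    with (/ 2 * (RInt (fun b => k * (b ^ S j * Y s (b * x))) (-1) 1)) by (rewrite RI_scal by cont_tac; ring).
  rewrite <- !Rmult_minus_distr_l, <- !RI_minus by cont_tac; f_equal.
  apply RI_ext; intros; rewrite Rmult_1_r; simpl; real_eq; ring. }
rewrite E; apply avg_bound; [unfold c2; cont_tac|].
intros b Hb; rewrite Rmult_1_r, Rmult_plus_distr_l; auto.
Qed.

(* The remainders [Z t (r + k) - Z t r - k * Y t r] satisfy a Gronwall inequality whose source is
   [o(h)]; it has to be closed for all [|k| <= |h|] at once because the average rescales the increment. *)
Lemma Z_differentiable K eta : 0 <= K -> 0 < eta -> exists d, 0 < d /\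
  forall t r h, Rabs t + Rabs r + Rabs h <= K -> Rabs h <= d ->
    Rabs (Z t (r + h) - Z t r - h * Y t r) <= eta * Rabs h.
Proof.
intros HK Heta.
assert (HAc := c2_A). assert (HAY := c2_avg (S j) Y HY).
destruct (bounded2 A K K c2_A HK HK) as [M [HM HAM]].
destruct (bounded3 Gy K K M HGy HK HK HM) as [L2 [HL2 HGy1]].
destruct (bounded2 Z K K HZ HK HK) as [B0 [HB0 HB0']].
destruct (bounded2 Y K K HY HK HK) as [B [HB HB1]].
(* [L2] is the Lipschitz constant of the linearized source; the additional 1 absorbs the remainder
   [e1 * Rabs q], whose part proportional to [m] has a coefficient at most 1 because [e1 <= 1]. *)
set (L := L2 + 1); assert (HL : 0 < L) by (unfold L; lra).
(* The iteration ends with [2 * e1 * (1 + K * (1 + B))] times the weight: the term 1 comes from the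
   data and [K * (1 + B)] from the source integrated over a time at most [K]. The second argument of
   [Rmin] makes the product at most [eta]. *)
set (e1 := Rmin 1 (eta / (2 * (1 + K * (1 + B)) * exp (2 * L * K)))).
assert (HX := exp_pos (2 * L * K)).
assert (HD : 0 < 1 + K * (1 + B)) by nra.
assert (He1 : 0 < e1) by (apply Rmin_glb_lt; [lra|apply Rdiv_lt_0_compat; nra]).
assert (He1' : e1 <= 1) by apply Rmin_l.
destruct (unif_cont1 dZ0 K e1 HdZ0 HK He1) as [d0 [Hd0 HU0]].
destruct (unif_cont3 Gx K K M e1 HGx HK HK HM He1) as [d1 [Hd1 HU1]].
destruct (unif_cont3 Gy K K M e1 HGy HK HK HM He1) as [d2 [Hd2 HU2]].
set (d3 := Rmin d0 (Rmin d1 d2)).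
assert (Hd3 : 0 < d3 /\ d3 <= d0 /\ d3 <= d1 /\ d3 <= d2).
{ unfold d3; repeat split.
  - repeat apply Rmin_glb_lt; auto.
  - apply Rmin_l.
  - eapply Rle_trans; [apply Rmin_r|apply Rmin_l].
  - eapply Rle_trans; [apply Rmin_r|apply Rmin_r]. }
(* The increment [q] of [A] must itself lie in the range [d3] in which the derivatives of [G] are
   nearly constant. *)
destruct (unif_cont3 (fun s x _ => A s x) K K 0 d3 ltac:(cont_tac) HK HK (Rle_refl 0) (proj1 Hd3)) as [d4 [Hd4 HU4]].
exists (Rmin d3 d4); split; [apply Rmin_glb_lt; lra|]. intros t r h Hh Hhd.
assert (Hh3 : Rabs h <= d3) by (eapply Rle_trans; [exact Hhd|apply Rmin_l]).
assert (Hh4 : Rabs h <= d4) by (eapply Rle_trans; [exact Hhd|apply Rmin_r]).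
set (Bd := fun m => forall t r k, Rabs t + Rabs r + Rabs k <= K -> Rabs k <= Rabs h ->
  Rabs (Z t (r + k) - Z t r - k * Y t r) <= m * exp (2 * L * Rabs t)).
assert (Hexp : forall s, 1 <= exp (2 * L * Rabs s)).
{ intros s; assert (E := exp_ineq1_le (2 * L * Rabs s)); assert (P := Rabs_pos s); nra. }
set (D := e1 * (1 + K * (1 + B))).
assert (HDD : 0 <= D) by (unfold D; nra).
assert (Hhp := Rabs_pos h).
assert (It : forall n : nat, Bd (2 * (D * Rabs h) + ((2 * B0 + K * B) - 2 * (D * Rabs h)) * (1 / 2) ^ n)).
{ apply iterate_half; [nra|nra| |].
  - intros s x k Hk _.
    assert (P1 := Rabs_pos s); assert (P2 := Rabs_pos x); assert (P3 := Rabs_pos k).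
    assert (B1 : Rabs (Z s (x + k)) <= B0) by (apply HB0'; [lra|apply shift_le; lra]).
    assert (B2 : Rabs (Z s x) <= B0) by (apply HB0'; lra).
    assert (B3 : Rabs (Y s x) <= B) by (apply HB1; lra).
    assert (P4 := Rabs_pos (Y s x)); specialize (Hexp s).
    assert (0 <= K * B) by nra. apply Rle_trans with (2 * B0 + K * B); [|nra].
    unfold Rminus; eapply Rle_trans; [apply Rabs_triang|].
    eapply Rle_trans; [apply Rplus_le_compat_r, Rabs_triang|].
    rewrite !Rabs_Ropp, Rabs_mult; nra.
  - intros m Hm Hbd s x k Hk Hkh.
    assert (P1 := Rabs_pos s); assert (P2 := Rabs_pos x); assert (P3 := Rabs_pos k).
    assert (T1 : Rabs (Z0 (x + s + k) - Z0 (x + s) - k * dZ0 (x + s)) <= e1 * Rabs k).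
    { apply (taylor_slope Z0 dZ0); auto; intros y Hy; apply HU0; [apply shift_le; lra|lra]. }
    assert (T2 : Rabs (RInt (fun u => G u (x + s - u + k) (A u (x + s - u + k))
       - G u (x + s - u) (A u (x + s - u))
       - k * G' u (x + s - u) (avg (S j) Y u (x + s - u))) 0 s)
       <= e1 * (1 + B) * Rabs h * Rabs s + L * m / (2 * L) * exp (2 * L * Rabs s)).
    { apply exp_int_affine; [assert (Q := c3_G'); cont_tac|apply Rmult_le_pos; nra|nra|lra|].
      intros u Hu; assert (Hc := cone_path s x u Hu).
      set (y := x + s - u) in *.
      assert (P4 := Rabs_pos u); assert (P5 := Rabs_pos y).
      assert (Q2 : Rabs (A u y) <= M) by (apply HAM; lra).
      set (q := A u (y + k) - A u y).
      assert (Q3 : Rabs q <= d3).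
      { assert (W := HU4 u y 0 k 0); apply W; rewrite ?Rabs_R0; lra. }
      assert (Q4 : Rabs (q - k * avg (S j) Y u y) <= m * exp (2 * L * Rabs u)).
      { apply avg_shift_deriv_bound; intros b Hb.
        assert (R1 := scal_le b y Hb); assert (R2 := scal_le b k Hb). apply Hbd; lra. }
      assert (QY : Rabs (avg (S j) Y u y) <= B).
      { apply avg_bound; [exact HY|]. intros b Hb; assert (R1 := scal_le b y Hb); apply HB1; lra. }
      assert (Qq : Rabs q <= B * Rabs h + m * exp (2 * L * Rabs u)).
      { replace q with (k * avg (S j) Y u y + (q - k * avg (S j) Y u y)) by ring.
        eapply Rle_trans; [apply Rabs_triang|]; rewrite Rabs_mult.
        assert (P6 := Rabs_pos (avg (S j) Y u y)); nra. }
      assert (Q5 : Rabs (G u (y + k) (A u y + q) - G u y (A u y + q) - k * Gx u y (A u y))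
         <= e1 * Rabs k).
      { apply (taylor_slope (fun y' => G u y' (A u y + q)) (fun y' => Gx u y' (A u y + q)));
          [intros; apply HdGx|].
        intros z Hz; apply HU1; lra. }
      assert (Q6 : Rabs (G u y (A u y + q) - G u y (A u y) - q * Gy u y (A u y)) <= e1 * Rabs q).
      { apply (taylor_slope (G u y) (Gy u y)); [intros; apply HdGy|].
        intros z Hz; assert (W := HU2 u y (A u y) 0 z).
        rewrite Rplus_0_r in W; apply W; try lra. rewrite Rabs_R0; lra. }
      assert (Q7 : Rabs (Gy u y (A u y)) <= L2) by (apply HGy1; lra).
      unfold G'.
      (* The increment of [G] splits into the change of the position, the change of the value, and
         the error made in replacing [q] by [k * avg (S j) Y u y]. *)
      replace (A u (y + k)) with (A u y + q) by (unfold q; ring).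
      replace (G u (y + k) (A u y + q) - G u y (A u y)
         - k * (Gx u y (A u y) + Gy u y (A u y) * avg (S j) Y u y))
        with ((G u (y + k) (A u y + q) - G u y (A u y + q) - k * Gx u y (A u y))
          + (G u y (A u y + q) - G u y (A u y) - q * Gy u y (A u y))
          + Gy u y (A u y) * (q - k * avg (S j) Y u y)) by ring.
      eapply Rle_trans; [apply Rabs_triang|].
      eapply Rle_trans; [apply Rplus_le_compat_r, Rabs_triang|].
      rewrite (Rabs_mult (Gy u y (A u y))).
      set (w := m * exp (2 * L * Rabs u)) in *.
      assert (w0 : 0 <= w) by (unfold w; specialize (Hexp u); nra).
      assert (Rabs (Gy u y (A u y)) * Rabs (q - k * avg (S j) Y u y) <= L2 * w).
      { apply Rmult_le_compat; auto; apply Rabs_pos. }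
      assert (e1 * Rabs q <= e1 * (B * Rabs h) + 1 * w) by nra.
      assert (e1 * Rabs k <= e1 * Rabs h) by (apply Rmult_le_compat_l; lra).
      rewrite (Rmult_assoc L); fold w; unfold L; nra. }
    replace (Z s (x + k) - Z s x - k * Y s x) with
     ((Z0 (x + s + k) - Z0 (x + s) - k * dZ0 (x + s)) +
      RInt (fun u => G u (x + s - u + k) (A u (x + s - u + k))
       - G u (x + s - u) (A u (x + s - u))
       - k * G' u (x + s - u) (avg (S j) Y u (x + s - u))) 0 s).
    2:{ assert (Q := c3_G'); rewrite duhamel_diff, HYE; unfold duhamel.
        rewrite RI_minus, RI_scal by cont_tac; ring. }
    eapply Rle_trans; [apply Rabs_triang|].
    specialize (Hexp s).
    replace (L * m / (2 * L)) with (m / 2) in T2 by (field; lra).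
    assert (0 <= e1 * (1 + B) * Rabs h) by (apply Rmult_le_pos; nra).
    assert (e1 * (1 + B) * Rabs h * Rabs s <= e1 * (1 + B) * Rabs h * K) by (apply Rmult_le_compat_l; lra).
    assert (D * Rabs h <= D * Rabs h * exp (2 * L * Rabs s)).
    { rewrite <- (Rmult_1_r (D * Rabs h)) at 1; apply Rmult_le_compat_l; nra. }
    unfold D in *; nra. }
apply half_limit with (b := ((2 * B0 + K * B) - 2 * (D * Rabs h)) * exp (2 * L * Rabs t)).
intros n; eapply Rle_trans; [apply (It n t r h Hh (Rle_refl _))|].
assert (E : exp (2 * L * Rabs t) <= exp (2 * L * K)).
{ assert (P1 := Rabs_pos r).
  destruct (Rle_lt_or_eq_dec (2 * L * Rabs t) (2 * L * K)) as [Hlt|Heq];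
    [nra|left; apply exp_increasing; auto|right; f_equal; auto]. }
assert (E2 : 2 * D * exp (2 * L * K) <= eta).
{ assert (X : e1 <= eta / (2 * (1 + K * (1 + B)) * exp (2 * L * K))) by apply Rmin_r.
  set (W := 2 * (1 + K * (1 + B)) * exp (2 * L * K)) in *.
  assert (HW : 0 < W) by (unfold W; nra).
  apply Rmult_le_compat_r with (r := W) in X; [|lra].
  replace (eta / W * W) with eta in X by (field; lra). unfold D; unfold W in X; lra. }
assert (2 * D * Rabs h * exp (2 * L * Rabs t) <= 2 * D * Rabs h * exp (2 * L * K)).
{ apply Rmult_le_compat_l; [nra|auto]. }
nra.
Qed.

Lemma Z_der_r t r : is_derive (Z t) r (Y t r).
Proof.
apply is_derive_Reals; intros eps He.
set (K := Rabs t + Rabs r + 1).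
assert (HK : 0 <= K) by (assert (P1 := Rabs_pos t); assert (P2 := Rabs_pos r); unfold K; lra).
destruct (Z_differentiable K (eps / 2) HK) as [d [Hd H]]; [lra|].
assert (Hd1 : 0 < Rmin d 1) by (apply Rmin_glb_lt; lra).
exists (mkposreal _ Hd1); intros h Hh Hhd; simpl in Hhd.
assert (A1 := Rmin_l d 1); assert (A2 := Rmin_r d 1).
assert (E := H t r h ltac:(unfold K; lra) ltac:(lra)).
replace ((Z t (r + h) - Z t r) / h - Y t r) with ((Z t (r + h) - Z t r - h * Y t r) / h) by (field; auto).
unfold Rdiv; rewrite Rabs_mult, Rabs_inv.
assert (P := Rabs_pos_lt h Hh).
apply Rmult_lt_reg_r with (Rabs h); auto.
rewrite Rmult_assoc, Rinv_l, Rmult_1_r by lra. nra.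
Qed.

Lemma Z_der_t t r : is_derive (fun t => Z t r) t (Y t r + G t r (A t r)).
Proof.
assert (HAc := c2_A). assert (Q := c3_G'). assert (HAY := c2_avg (S j) Y HY).
apply is_derive_ext with (fun t => duhamel j Z0 G Z t r); [intros; symmetry; apply HZE|].
eapply is_derive_eq.
- unfold duhamel; apply der_plus.
  + apply (der_comp Z0 (fun t => r + t)); [apply HZ0|apply der_plus; [apply der_const|apply der_id]].
  + apply (leibniz (fun t s => G s (r + t - s) (A s (r + t - s)))
      (fun t s => G' s (r + t - s) (avg (S j) Y s (r + t - s)))); [cont_tac|cont_tac|].
    intros t' s; eapply is_derive_eq.
    * apply (der_comp (fun x => G s x (A s x)) (fun t => r + t - s) t'
        (G' s (r + t' - s) (avg (S j) Y s (r + t' - s)))).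
      -- eapply is_derive_eq.
         ++ apply (der_comp2 (G s) (Gx s) (Gy s) (fun x => x) (A s)).
            ** cont_tac.
            ** intros; apply HdGx.
            ** intros; apply HdGy.
            ** apply der_id.
            ** apply avg_der_r; [exact HZ|exact HY|exact Z_der_r].
         ++ unfold G'; ring.
      -- apply der_minus; [apply der_plus; [apply der_const|apply der_id]|apply der_const].
    * ring.
- rewrite HYE; unfold duhamel; replace (r + t - t) with r by ring; real_eq; ring.
Qed.

End Differentiability.

(** The derivative is constructed before it is known to be one: the formally differentiated equation
    is linear in [Y], hence solvable, and the difference quotients of [Z] are then shown to converge
    to [Y]. The derivative in [t] follows from [Z_t - Z_r = G]. *)
Lemma duhamel_C1 j Z0 dZ0 G Gx Gy Z :
  (forall x, is_derive Z0 x (dZ0 x)) -> cont dZ0 -> c3 G -> c3 Gx -> c3 Gy ->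
  (forall s x y, is_derive (fun x => G s x y) x (Gx s x y)) ->
  (forall s x y, is_derive (G s x) y (Gy s x y)) ->
  c2 Z -> (forall t r, Z t r = duhamel j Z0 G Z t r) ->
  exists Y, c2 Y /\ (forall t r, is_derive (Z t) r (Y t r)) /\
    (forall t r, is_derive (fun t => Z t r) t (Y t r + G t r (avg j Z t r))) /\
    forall t r, Y t r = duhamel (S j) dZ0
      (fun s x y => Gx s x (avg j Z s x) + Gy s x (avg j Z s x) * y) Y t r.
Proof.
intros H0 Hd0 HG HGx HGy Hx Hy HZ HZE.
destruct (picard (S j) dZ0 (fun s x y => Gx s x (avg j Z s x) + Gy s x (avg j Z s x) * y)) as [Y [HY HYE]].
- auto.
- apply (c3_G' j Gx Gy Z); auto.
- intros K HK; apply (lipschitz_G' j Gx Gy Z); auto.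
- exists Y; split; [auto|split; [|split; auto]]; intros t r.
  + eapply (Z_der_r j Z0 dZ0 G Gx Gy Z); eauto.
  + eapply (Z_der_t j Z0 dZ0 G Gx Gy Z); eauto.
Qed.

(** * Inequalities on the line *)

Lemma cont_IVT (f : R -> R) a b y : cont f -> a <= b -> f a <= y <= f b ->
  exists x, a <= x <= b /\ f x = y.
Proof.
intros Hf Hab Hy.
destruct (IVT_gen f a b y) as [x [Hx E]].
- intros x; apply continuity_pt_filterlim, Hf.
- rewrite Rmin_left, Rmax_right by lra; auto.
- rewrite Rmin_left, Rmax_right in Hx by lra; exists x; auto.
Qed.

(** The running maximum of [m] is continuous and starts below [D / 2]. To exceed [D / 2] it would
    have to take a value in [(D / 2, D]], which the improvement hypothesis excludes. *)
Lemma bootstrap (m : R -> R) a b D : cont m -> a <= b -> 0 < D -> m a <= D / 2 ->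
  (forall t, a <= t <= b -> (forall s, a <= s <= t -> Rabs (m s) <= D) ->
     forall s, a <= s <= t -> Rabs (m s) <= D / 2) ->
  (forall s, 0 <= m s) -> forall t, a <= t <= b -> m t <= D / 2.
Proof.
intros Hm Hab HD Ha H Hp t Ht.
destruct (sup_segment (fun t x => m (a + x * (t - a))) 0 1) as [M [HM [M1 M2]]]; [lra|cont_tac|].
assert (Hsup : forall u s, a <= u -> a <= s <= u -> Rabs (m s) <= M u).
{ intros u s Hu Hs; destruct (Req_dec u a) as [->|N].
  - replace s with (a + 0 * (a - a)) by lra; apply M1; lra.
  - replace s with (a + (s - a) / (u - a) * (u - a)) by (field; lra); apply M1.
    split; [apply Rdiv_le_0_compat; lra|].
    apply Rmult_le_reg_r with (u - a); [lra|]. unfold Rdiv; rewrite Rmult_assoc, Rinv_l; lra. }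
destruct (Rle_dec (m t) (D / 2)) as [|N]; auto; exfalso.
assert (A1 := Hsup t t ltac:(lra) ltac:(lra)); rewrite Rabs_pos_eq in A1 by auto.
assert (A2 : M a <= D / 2).
{ apply M2; intros x _; replace (a + x * (a - a)) with a by ring; rewrite Rabs_pos_eq; auto. }
(* The minimum with [D] selects a time at which the hypothesis applies while the running maximum
   still exceeds [D / 2]. *)
destruct (cont_IVT M a t (Rmin (M t) D)) as [t' [Ht' E]]; [auto|lra| |].
{ split; [apply Rmin_glb; lra|apply Rmin_l]. }
assert (A3 : M t' <= D / 2).
{ apply M2; intros x Hx; apply (H t').
  - lra.
  - intros s Hs; eapply Rle_trans; [apply (Hsup t' s); lra|]. rewrite E; apply Rmin_r.
  - nra. }
rewrite E in A3; revert A3; unfold Rmin; destruct Rle_dec; lra.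
Qed.

Lemma RI_zero (f : R -> R) a b : a <= b -> (forall x, a <= x <= b -> f x = 0) -> RInt f a b = 0 :> R.
Proof.
intros Hab H; rewrite (RI_ext f (fun _ => 0)); [rewrite RI_const; ring|].
rewrite Rmin_left, Rmax_right by auto; auto.
Qed.

Lemma RI_sub (f : R -> R) a a' b' b : cont f -> (forall x, 0 <= f x) -> a <= a' -> a' <= b' -> b' <= b ->
  RInt f a' b' <= RInt f a b.
Proof.
intros Hf Hp H1 H2 H3.
rewrite <- (RI_chasles f a a' b), <- (RI_chasles f a' b' b) by auto.
assert (0 <= RInt f a a') by (apply RI_ge_0; auto).
assert (0 <= RInt f b' b) by (apply RI_ge_0; auto). lra.
Qed.

Lemma RI_null (f : R -> R) a b : (forall x, f x = 0) -> RInt f a b = 0 :> R.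
Proof. intros H; rewrite (RI_ext f (fun _ => 0)) by auto; rewrite RI_const; ring. Qed.

Lemma RI_support (f : R -> R) b a1 a2 : cont f -> (forall x, b <= Rabs x -> f x = 0) -> 0 <= b ->
  a1 <= - b -> b <= a2 -> RInt f a1 a2 = RInt f (- b) b :> R.
Proof.
intros Hf H Hb H1 H2.
rewrite <- (RI_chasles f a1 (- b) a2), <- (RI_chasles f (- b) b a2) by auto.
rewrite (RI_zero f a1 (- b)), (RI_zero f b a2); auto.
- ring.
- intros x Hx; apply H; rewrite Rabs_pos_eq; lra.
- intros x Hx; apply H; rewrite Rabs_left1; lra.
Qed.

Lemma RI_sym_split (f : R -> R) b : cont f ->
  RInt f (- b) b = RInt (fun x => f x + f (- x)) 0 b :> R.
Proof.
intros Hf; rewrite RI_plus by cont_tac.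
rewrite <- (RI_chasles f (- b) 0 b) by auto.
assert (E := RI_lin f (-1) 0 0 b Hf).
replace (-1 * 0 + 0) with 0 in E by ring; replace (-1 * b + 0) with (- b) in E by ring.
rewrite (RI_swap f 0 (- b)), <- E by auto.
replace (RInt (fun y : R => f (-1 * y + 0)) 0 b) with (RInt (fun x : R => f (- x)) 0 b); [ring|].
apply RI_ext; intros; f_equal; ring.
Qed.

(** [h x] is the mean of [S] between [c - 2 * x] and [c], so [(x h)' = g] with
    [g x = S (c - 2 * x)], and [(x h^2)' = 2 h g - h^2]. Because [a <= 0 <= b], the boundary terms
    have the favourable sign; then [2 h g <= h^2 / 2 + 2 g^2] gives the constant 4. *)
Lemma hardy (S : R -> R) c a b : cont S -> a <= 0 -> 0 <= b ->
  let h x := / 2 * RInt (fun y => S (x * y + (c - x))) (-1) 1 in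
  RInt (fun x => h x ^ 2) a b <= 4 * RInt (fun x => S (c - 2 * x) ^ 2) a b.
Proof.
intros HS Ha Hb h.
assert (Hh : cont h) by (unfold h; cont_tac).
assert (E : forall x, x * h x = - / 2 * RInt S c (c - 2 * x)).
{ intros x; unfold h.
  assert (L := RI_lin S x (c - x) (-1) 1 HS).
  replace (x * -1 + (c - x)) with (c - 2 * x) in L by ring.
  replace (x * 1 + (c - x)) with c in L by ring.
  rewrite (RI_swap S c (c - 2 * x)) in L by auto.
  replace (- / 2 * RInt S c (c - 2 * x)) with (/ 2 * (- RInt S c (c - 2 * x))) by ring.
  rewrite <- L; ring. }
set (g := fun x => S (c - 2 * x)).
assert (Hg : cont g) by (unfold g; cont_tac).
assert (D1 : forall x, is_derive (fun x => x * h x) x (g x)).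
{ intros x; apply is_derive_ext with (fun x => - / 2 * RInt S c (c - 2 * x)); [intros; symmetry; apply E|].
  eapply is_derive_eq.
  - apply der_scal. apply (der_comp (fun y => RInt S c y) (fun x => c - 2 * x)).
    + apply RI_FTC; auto.
    + apply der_minus; [apply der_const|apply der_scal, der_id].
  - unfold g; real_eq; field. }
(* Away from 0 the function is [(x h)^2 / x]. At 0 its difference quotient is [h^2] itself, and
   [g 0 = h 0] makes the formula agree. *)
assert (D : forall x, is_derive (fun x => x * h x ^ 2) x (2 * (h x * g x) - h x ^ 2)).
{ intros x; destruct (Req_dec x 0) as [->|N].
  - assert (G0 : g 0 = h 0).
    { unfold g, h; rewrite (RI_ext _ (fun _ => S c)).
      - rewrite RI_const; replace (c - 2 * 0) with c by ring; real_eq; field.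
      - intros; f_equal; ring. }
    rewrite G0; replace (2 * (h 0 * h 0) - h 0 ^ 2) with (h 0 ^ 2) by ring.
    apply is_derive_Reals; intros eps He.
    assert (Hh2 : cont (fun x => h x ^ 2)) by cont_tac.
    destruct (Hh2 0 (ball (h 0 ^ 2) (mkposreal _ He)) (locally_ball _ _)) as [d Hd].
    exists d; intros k Hk Hkd; rewrite Rplus_0_l.
    replace ((k * h k ^ 2 - 0 * h 0 ^ 2) / k) with (h k ^ 2) by (field; auto).
    apply (Hd k). change (Rabs (k - 0) < d); rewrite Rminus_0_r; auto.
  - assert (L : locally x (fun y => (y * h y) ^ 2 / y = y * h y ^ 2)).
    { exists (mkposreal _ (Rabs_pos_lt x N)); intros y Hy.
      change (Rabs (y - x) < Rabs x) in Hy.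
      assert (y <> 0). { intros ->; rewrite Rminus_0_l, Rabs_Ropp in Hy; lra. }
      field; auto. }
    apply (is_derive_ext_loc _ _ _ _ L).
    eapply is_derive_eq.
    + apply (der_mult (fun y => (y * h y) ^ 2) Rinv); [apply der_pow2, D1|].
      apply (is_derive_inv (fun y => y) x 1); [apply der_id|auto].
    + cbv beta; field; auto. }
assert (B : RInt (fun x => 2 * (h x * g x) - h x ^ 2) a b = b * h b ^ 2 - a * h a ^ 2).
{ apply (RI_derive (fun x => x * h x ^ 2)); auto. cont_tac. }
rewrite RI_minus, RI_scal in B by cont_tac.
assert (C : RInt (fun x => h x * g x) a b <= RInt (fun x => / 4 * h x ^ 2 + g x ^ 2) a b).
{ apply RI_le; [lra|cont_tac|cont_tac|]. intros x _.
  sq (/ 2 * h x - g x). lra. }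
rewrite RI_plus, RI_scal in C by cont_tac.
assert (0 <= b * h b ^ 2) by (apply Rmult_le_pos; [auto|apply pow2_ge_0]).
assert (0 <= - a * h a ^ 2) by (apply Rmult_le_pos; [lra|apply pow2_ge_0]).
change (RInt (fun x => h x ^ 2) a b <= 4 * RInt (fun x => g x ^ 2) a b).
lra.
Qed.

(** Hardy's inequality in the variable [x = c - s]; the constant 4 becomes 2 through the
    substitution [c - 2 * x]. The support of [S] removes the dependence of the domain on [c]. *)
Lemma hardy_line (S w : R -> R) B c t0 t1 : cont S -> cont w -> 0 <= t0 <= t1 -> t1 <= B ->
  (forall x, B <= Rabs x -> S x = 0) ->
  (forall s, t0 <= s <= t1 ->
     Rabs (w s) <= / 2 * RInt (fun y => S ((c - s) * y + (c - (c - s)))) (-1) 1) ->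
  RInt (fun s => w s ^ 2) t0 t1 <= 2 * RInt (fun x => S x ^ 2) (- B) B.
Proof.
intros HS Hw Ht0 Ht1 Hz Hb.
set (h := fun x => / 2 * RInt (fun y => S (x * y + (c - x))) (-1) 1).
assert (Hh : cont h) by (unfold h; cont_tac).
set (M := Rabs c + B).
assert (HM : - M <= c - t1 /\ c - t0 <= M /\ 0 <= M).
{ unfold M; abs_lra. }
apply Rle_trans with (RInt (fun s => h (-1 * s + c) ^ 2) t0 t1).
{ apply RI_le; [lra|cont_tac|cont_tac|]. intros s Hs; rewrite <- (pow2_abs (w s)).
  apply pow_incr; split; [apply Rabs_pos|].
  replace (-1 * s + c) with (c - s) by ring; apply Hb; auto. }
assert (E1 := RI_lin (fun x => h x ^ 2) (-1) c t0 t1 ltac:(cont_tac)).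
rewrite (RI_swap _ (-1 * t1 + c) (-1 * t0 + c)) in E1 by cont_tac.
assert (E2 : RInt (fun x => h x ^ 2) (-1 * t1 + c) (-1 * t0 + c) <= RInt (fun x => h x ^ 2) (- M) M).
{ apply RI_sub; try lra; [cont_tac|intros; apply pow2_ge_0]. }
assert (E3 := hardy S c (- M) M HS ltac:(lra) ltac:(lra)).
change (RInt (fun x => h x ^ 2) (- M) M <= 4 * RInt (fun x => S (c - 2 * x) ^ 2) (- M) M) in E3.
assert (E4 := RI_lin (fun x => S x ^ 2) (-2) c (- M) M ltac:(cont_tac)).
rewrite (RI_swap _ (-2 * M + c) (-2 * - M + c)) in E4 by cont_tac.
rewrite (RI_support (fun x => S x ^ 2) B (-2 * M + c)) in E4.
- assert (E5 : RInt (fun x => S (c - 2 * x) ^ 2) (- M) M = RInt (fun y => S (-2 * y + c) ^ 2) (- M) M).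
  { apply RI_ext; intros y _; replace (-2 * y + c) with (c - 2 * y) by ring; reflexivity. }
  rewrite E5 in E3; lra.
- cont_tac.
- intros x Hx; rewrite Hz by auto; ring.
- lra.
- unfold M; abs_lra.
- unfold M; abs_lra.
Qed.

Lemma RI_shift_support (f : R -> R) b b2 s : cont f -> (forall x, b <= Rabs x -> f x = 0) -> 0 <= b ->
  Rabs s + b <= b2 -> RInt (fun c => f (c - s)) (- b2) b2 = RInt f (- b) b :> R.
Proof.
intros Hf Hz Hb Hs.
assert (L := RI_lin f 1 (- s) (- b2) b2 Hf); rewrite Rmult_1_l in L.
transitivity (RInt (fun y => f (1 * y + - s)) (- b2) b2).
- apply RI_ext; intros y _; replace (1 * y + - s) with (y - s) by ring; reflexivity.
- rewrite L; apply RI_support; auto; revert Hs; abs_lra.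
Qed.

Lemma cauchy_schwarz_abs (f g : R -> R) a b : a <= b -> cont f -> cont g ->
  (RInt (fun x => Rabs (f x * g x)) a b) ^ 2 <= RInt (fun x => f x ^ 2) a b * RInt (fun x => g x ^ 2) a b.
Proof.
intros Hab Hf Hg.
assert (CS := cauchy_schwarz (fun x => Rabs (f x)) (fun x => Rabs (g x)) a b Hab ltac:(cont_tac) ltac:(cont_tac)).
rewrite (RI_ext (fun x => Rabs (f x) * Rabs (g x)) (fun x => Rabs (f x * g x))) in CS
  by (intros; rewrite Rabs_mult; auto).
rewrite (RI_ext (fun x => Rabs (f x) ^ 2) (fun x => f x ^ 2)) in CS by (intros; apply pow2_abs).
rewrite (RI_ext (fun x => Rabs (g x) ^ 2) (fun x => g x ^ 2)) in CS by (intros; apply pow2_abs).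
exact CS.
Qed.

(** Cauchy-Schwarz gives [sqrt (8 * B) * X]; the cruder factor [8 * B + 1] avoids the square
    root. *)
Lemma L1_le_L2 (S : R -> R) B X a1 a2 : cont S -> (forall x, 0 <= S x) -> 0 <= B -> 0 <= X -> a1 <= a2 ->
  (forall x, B <= Rabs x -> S x = 0) -> RInt (fun x => S x ^ 2) (- B) B <= 4 * X ^ 2 ->
  RInt S a1 a2 <= (8 * B + 1) * X.
Proof.
intros HS Hp HB HX Ha Hz HN.
set (M := Rabs a1 + Rabs a2 + B).
assert (HM : - M <= a1 /\ a2 <= M /\ B <= M).
{ unfold M; abs_lra. }
apply Rle_trans with (RInt S (- M) M); [apply RI_sub; auto; lra|].
rewrite (RI_support S B) by (auto; lra).
assert (CS := cauchy_schwarz (fun _ => 1) S (- B) B ltac:(lra) (cont_const 1) HS).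
rewrite (RI_ext (fun x => 1 * S x) S) in CS by (intros; ring).
rewrite (RI_ext (fun x => 1 ^ 2) (fun _ => 1)), RI_const in CS by (intros; real_eq; ring).
assert (S0 : 0 <= RInt S (- B) B) by (apply RI_ge_0; auto; lra).
apply Rsqr_incr_0_var; [|apply Rmult_le_pos; lra].
rewrite !Rsqr_pow2. nra.
Qed.

(** The shift by 2 matches the bound [al * (INR k + 2)] on the logarithm at the level [Dk (S k)]
    reached in slab [k]. *)
Fixpoint hsum (k : nat) : R := match k with O => 0 | S k => hsum k + / (INR k + 2) end.

Lemma hsum_unbounded B : exists k, B <= hsum k.
Proof.
assert (H : forall k, ln (INR k + 2) - ln 2 <= hsum k).
{ induction k as [|k IH]; simpl hsum.
  - simpl; rewrite Rplus_0_l; lra.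
  - assert (P := pos_INR k). rewrite S_INR.
    assert (E : ln (INR k + 1 + 2) <= ln (INR k + 2) + / (INR k + 2)).
    { replace (INR k + 1 + 2) with ((INR k + 2) * (1 + / (INR k + 2))) by (field; lra).
      assert (0 < / (INR k + 2)) by (apply Rinv_0_lt_compat; lra).
      rewrite ln_mult by lra. apply Rplus_le_compat_l.
      rewrite <- (ln_exp (/ (INR k + 2))) at 2.
      apply ln_le; [lra|apply exp_ineq1_le]. }
    lra. }
destruct (INR_unbounded (exp (B + ln 2))) as [k Hk].
exists k; eapply Rle_trans; [|apply H].
assert (B + ln 2 <= ln (INR k + 2)); [|lra].
rewrite <- (ln_exp (B + ln 2)); apply ln_le; [apply exp_pos|lra].
Qed.

(** * A priori bounds *)

Lemma exp_ge_1 x : 0 <= x -> 1 <= exp x.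
Proof. intros Hx; assert (E := exp_ineq1_le x); lra. Qed.

Lemma zero_of_half_bounds x B e : (forall n : nat, Rabs x <= (2 * 0 + (B - 2 * 0) * (1 / 2) ^ n) * e) -> x = 0.
Proof.
intros H.
assert (E : Rabs x <= 0).
{ apply half_limit with (b := B * e); intros n; eapply Rle_trans; [apply (H n)|]; right; ring. }
destruct (Req_dec x 0) as [|N]; auto; apply Rabs_pos_lt in N; lra.
Qed.

Section Apriori.

(* With [v = r u] odd in [r] and [v_tt - v_rr = - r h(u)], the unknown is [P = v_t + v_r]; then [U = u],
   [V = 2 v] and [p = P_t]. *)
Variables (h g : R -> R) (P0 dP0 : R -> R) (A : R) (P Y : R -> R -> R).
Let U := avg 0 P.
Let H y := RInt h 0 y.
Let q y := y * h y - 2 * H y.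
Let p t r := Y t r - r * h (U t r).
Let V t r := RInt (P t) (- r) r.

Hypotheses (Hh : forall y, is_derive h y (g y)) (Hg : cont g) (Hh0 : h 0 = 0)
  (HHpos : forall y, 0 <= H y) (Hqpos : forall y, 0 <= q y)
  (Hgq : forall D y, Rabs y <= D -> g y ^ 2 <= 200 * ln (2 + D ^ 2) * y ^ 2 * q y)
  (HP0c : cont P0) (HdP0 : cont dP0)
  (HApos : 0 < A) (HP0s : forall c, A <= Rabs c -> P0 c = 0) (HP0m : RInt P0 (- A) A = 0)
  (HP : c2 P) (HPE : forall t r, P t r = duhamel 0 P0 (fun _ x y => - x * h y) P t r)
  (HY : c2 Y) (HPr : forall t r, is_derive (P t) r (Y t r))
  (HPt : forall t r, is_derive (fun t => P t r) t (p t r))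
  (HYE : forall t r, Y t r = duhamel 1 dP0 (fun s x y => - h (U s x) + - x * g (U s x) * y) Y t r).

Lemma cont_h : cont h. Proof. apply (cont_derive h g Hh). Qed.
Lemma c2_U : c2 U. Proof. apply c2_avg, HP. Qed.
Lemma c2_p : c2 p. Proof. assert (Q1 := c2_U); assert (Q2 := cont_h); unfold p; cont_tac. Qed.
Lemma c2_V : c2 V. Proof. unfold V; cont_tac. Qed.
Lemma cont_H : cont H. Proof. assert (Q2 := cont_h); unfold H; cont_tac. Qed.
Lemma cont_q : cont q. Proof. assert (Q2 := cont_h); assert (Q3 := cont_H); unfold q; cont_tac. Qed.

Lemma P_initial r : P 0 r = P0 r.
Proof. rewrite HPE; unfold duhamel; rewrite RI_point, !Rplus_0_r; auto. Qed.

Lemma avg_P_even t r : U t (- r) = U t r.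
Proof. apply avg0_even, HP. Qed.

Lemma r_mul_U t r : r * U t r = / 2 * V t r.
Proof. apply avg0_mult, HP. Qed.

Lemma V_der_r t r : is_derive (V t) r (P t r + P t (- r)).
Proof.
assert (Hc := cont_curry P t HP).
apply is_derive_ext with (fun r => RInt (fun x => P t x + P t (- x)) 0 r).
- intros y; symmetry; apply RI_sym_split; auto.
- apply (RI_FTC (fun x => P t x + P t (- x)) 0 r). cont_tac.
Qed.

(** The source [r h(U)] is odd in [r] because [U] is even, so its integral over [[-r, r]] vanishes
    and only the integral of [P_r] remains. *)
Lemma V_der_t t r : is_derive (fun t => V t r) t (P t r - P t (- r)).
Proof.
assert (Q1 := c2_U); assert (Q2 := cont_h); assert (Q3 := c2_p).
eapply is_derive_eq.
- apply (derive_RInt_param P p (- r) r t); auto.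
  intros s; apply (cont_curry P s HP).
- unfold p; rewrite RI_minus by cont_tac.
  rewrite (RI_derive (P t) (Y t)); [|auto|apply (cont_curry Y t HY)].
  rewrite RI_sym_split by cont_tac.
  rewrite RI_null; [real_eq; ring|intros x; rewrite avg_P_even; ring].
Qed.

Lemma V_transport r0 t : is_derive (fun s => V s (r0 + s)) t (2 * P t (r0 + t)).
Proof.
assert (Hp := c2_p).
eapply is_derive_eq.
- apply (der_comp2 V (fun t r => P t r - P t (- r)) (fun t r => P t r + P t (- r)) (fun s => s) (fun s => r0 + s)).
  + cont_tac.
  + apply V_der_t.
  + apply V_der_r.
  + apply der_id.
  + apply der_plus; [apply der_const|apply der_id].
- ring.
Qed.

(** In the exterior region the source of [P] is bounded by [r U = V / 2] along incoming lines, and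
    [V] is an integral of [P] along outgoing lines: only the pair closes. Initially [V] vanishes
    beyond [A] because [P0] has integral zero. *)
Lemma finite_speed t r : 0 <= t -> A + t <= Rabs r -> P t r = 0 /\ V t r = 0.
Proof.
intros Ht Hr.
assert (Q1 := c2_U); assert (Q2 := cont_h); assert (Q3 := c2_V).
set (K := Rabs t + Rabs r).
assert (P1 := Rabs_pos t); assert (P2 := Rabs_pos r).
assert (HK : 0 <= K) by (unfold K; lra).
destruct (bounded2 P K K HP HK HK) as [B1 [HB1 B1']].
destruct (bounded2 V K K Q3 HK HK) as [B2 [HB2 B2']].
destruct (bounded2 U K K Q1 HK HK) as [M [HM M']].
destruct (bounded1 g M Hg HM) as [L [HL L']].
(* Makes both [L / (2 * lam)], for [P], and [2 / lam], for [V], at most one half. *)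
set (lam := L + 4).
set (Bd := fun m => forall s x, 0 <= s -> Rabs s + Rabs x <= K -> A + s <= Rabs x ->
  Rabs (P s x) <= m * exp (lam * Rabs s) /\ Rabs (V s x) <= m * exp (lam * Rabs s)).
assert (Hexp : forall s, 1 <= exp (lam * Rabs s)).
{ intros s; apply exp_ge_1; assert (X := Rabs_pos s); unfold lam; nra. }
assert (It : forall n : nat, Bd (2 * 0 + ((B1 + B2) - 2 * 0) * (1 / 2) ^ n)).
{ apply iterate_half; [lra|lra| |].
  - intros s x Hs Hsx _; assert (X1 := Rabs_pos s); assert (X2 := Rabs_pos x).
    specialize (Hexp s); assert (B1 + B2 <= (B1 + B2) * exp (lam * Rabs s)) by nra.
    split; (eapply Rle_trans; [first [apply B1'|apply B2']; lra|lra]).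
  - intros m Hm Hbd s x Hs Hsx Hx; rewrite Rplus_0_l.
    assert (X1 := Rabs_pos s); assert (X2 := Rabs_pos x).
    split.
    + rewrite HPE; unfold duhamel; fold U.
      rewrite HP0s, Rplus_0_l by (revert Hx; abs_lra).
      apply Rle_trans with (L / 2 * m / lam * exp (lam * Rabs s)).
      * apply exp_int; [cont_tac|nra|unfold lam; lra|].
        intros u Hu; assert (Hc := cone_path s x u Hu).
        rewrite Rmin_left, Rmax_right in Hu by auto.
        set (y := x + s - u) in *.
        assert (X3 := Rabs_pos u); assert (X4 := Rabs_pos y).
        assert (Hy : A + u <= Rabs y) by (unfold y; revert Hx; abs_lra).
        destruct (Hbd u y) as [_ HV]; [lra|lra|auto|].
        assert (HU : Rabs (h (U u y)) <= L * Rabs (U u y)).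
        { assert (W := mvt_bound h g 0 (U u y) L Hh); rewrite Hh0, !Rminus_0_r in W; apply W.
          assert (W2 := M' u y ltac:(lra) ltac:(lra)).
          intros z Hz; apply L'; revert W2 Hz; clear; abs_lra. }
        rewrite Rabs_mult, Rabs_Ropp.
        assert (E : Rabs y * Rabs (U u y) = / 2 * Rabs (V u y)).
        { rewrite <- Rabs_mult, r_mul_U, Rabs_mult, (Rabs_pos_eq (/ 2)); lra. }
        nra.
      * apply Rmult_le_compat_r; [specialize (Hexp s); lra|].
        apply Rmult_le_reg_r with lam; [unfold lam; lra|].
        unfold Rdiv; rewrite (Rmult_assoc _ (/ lam)), Rinv_l by (unfold lam; lra).
        unfold lam; nra.
    (* For [x >= 0] the outgoing line through [(s, x)] stays in the exterior region back to time 0;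
       negative [x] follow from the oddness of [V]. *)
    + assert (HV : forall x, 0 <= x -> Rabs s + Rabs x <= K -> A + s <= Rabs x ->
         Rabs (V s x) <= m / 2 * exp (lam * Rabs s)).
      { clear x Hsx Hx X2; intros x Hx0 Hsx Hx; rewrite Rabs_pos_eq in Hx by auto.
        assert (E := RI_derive (fun u => V u ((x - s) + u)) (fun u => 2 * P u (x - s + u)) 0 s
          (fun u => V_transport (x - s) u)).
        cbv beta in E; replace (x - s + s) with x in E by ring.
        rewrite Rplus_0_r in E.
        replace (V 0 (x - s)) with 0 in E.
        2:{ unfold V; rewrite (RI_ext (P 0) P0) by (intros; apply P_initial).
            rewrite (RI_support P0 A), HP0m; auto; lra. }
        rewrite Rminus_0_r in E; rewrite <- E by cont_tac.
        apply Rle_trans with (2 * m / lam * exp (lam * Rabs s)).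
        - apply exp_int; [cont_tac|lra|unfold lam; lra|].
          rewrite Rmin_left, Rmax_right by auto; intros u Hu.
          destruct (Hbd u (x - s + u)) as [HPu _].
          + lra.
          + revert Hsx; rewrite !Rabs_pos_eq by lra; lra.
          + rewrite Rabs_pos_eq; lra.
          + rewrite Rabs_mult, (Rabs_pos_eq 2) by lra; lra.
        - apply Rmult_le_compat_r; [specialize (Hexp s); lra|].
          apply Rmult_le_reg_r with lam; [unfold lam; lra|].
          unfold Rdiv; rewrite (Rmult_assoc _ (/ lam)), Rinv_l by (unfold lam; lra).
          unfold lam; nra. }
      destruct (Rle_dec 0 x) as [Hx0|Hx0]; [apply HV; auto|].
      replace (V s x) with (- V s (- x)).
      * rewrite Rabs_Ropp; apply HV; rewrite ?Rabs_Ropp; auto; lra.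
      * unfold V; rewrite Ropp_involutive; symmetry; apply RI_swap, (cont_curry P s HP). }
split; eapply zero_of_half_bounds; intros n; apply (It n t r); unfold K; auto; lra.
Qed.

Lemma P_outside t r : 0 <= t -> A + t <= Rabs r -> P t r = 0.
Proof. intros; apply finite_speed; auto. Qed.

Lemma U_outside t r : 0 <= t -> A + t <= Rabs r -> U t r = 0.
Proof.
intros Ht Hr; destruct (finite_speed t r Ht Hr) as [_ HV].
assert (E := r_mul_U t r); rewrite HV, Rmult_0_r in E.
apply Rmult_integral in E; destruct E as [->|]; auto; rewrite Rabs_R0 in Hr; lra.
Qed.

Lemma g_zero : g 0 = 0.
Proof.
assert (E := Hgq 0 0 ltac:(rewrite Rabs_R0; lra)).
sq (g 0). nra.
Qed.

Lemma p_outside t r : 0 <= t -> A + t < Rabs r -> p t r = 0.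
Proof.
intros Ht Hr; unfold p; rewrite U_outside, Hh0 by lra.
assert (E : is_derive (P t) r 0).
{ apply is_derive_ext_loc with (fun _ => 0); [|apply der_const].
  assert (Hd : 0 < Rabs r - (A + t)) by lra.
  exists (mkposreal _ Hd); intros y Hy; change (Rabs (y - r) < Rabs r - (A + t)) in Hy.
  symmetry; apply P_outside; auto.
  revert Hy; abs_lra. }
assert (E1 := is_derive_unique _ _ _ E); assert (E2 := is_derive_unique _ _ _ (HPr t r)).
rewrite E2 in E1; rewrite E1; ring.
Qed.

(** * Energy and Morawetz identities up to time [T] *)

Variables (T b : R).
Hypotheses (HT : 0 <= T) (Hb : A + T < b).

Lemma U_der_t t r : is_derive (fun t => U t r) t (avg 0 p t r).
Proof. apply avg_der_t; auto. apply c2_p. Qed.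

Lemma U_der_r t r : is_derive (U t) r (avg 1 Y t r).
Proof. apply avg_der_r; auto. Qed.

(** The odd part of [P] is [v_t]; likewise its even part is [v_r], in the next lemma. *)
Lemma r_mul_U_der_t t r : r * avg 0 p t r = (P t r - P t (- r)) / 2.
Proof.
assert (E1 : is_derive (fun t => r * U t r) t (r * avg 0 p t r)) by apply der_scal, U_der_t.
assert (E2 : is_derive (fun t => r * U t r) t ((P t r - P t (- r)) / 2)).
{ apply is_derive_ext with (fun t => / 2 * V t r); [intros; symmetry; apply r_mul_U|].
  eapply is_derive_eq; [apply der_scal, V_der_t|]. field. }
rewrite <- (is_derive_unique _ _ _ E1); apply (is_derive_unique _ _ _ E2).
Qed.

Lemma r_mul_U_der_r t r : r * avg 1 Y t r + U t r = (P t r + P t (- r)) / 2.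
Proof.
assert (E1 : is_derive (fun r => r * U t r) r (1 * U t r + r * avg 1 Y t r)).
{ apply der_mult; [apply der_id|apply U_der_r]. }
assert (E2 : is_derive (fun r => r * U t r) r ((P t r + P t (- r)) / 2)).
{ apply is_derive_ext with (fun r => / 2 * V t r); [intros; symmetry; apply r_mul_U|].
  eapply is_derive_eq; [apply der_scal, V_der_r|]. field. }
assert (E3 := is_derive_unique _ _ _ E1); rewrite (is_derive_unique _ _ _ E2) in E3.
rewrite E3; ring.
Qed.

Lemma H_der y : is_derive H y (h y).
Proof. apply RI_FTC, cont_h. Qed.

(* The first two terms add up to [(v_t ^ 2 + v_r ^ 2) / 2]. *)
Definition energy t := RInt (fun r => / 4 * P t r ^ 2 + / 4 * P t (- r) ^ 2 + r ^ 2 * H (U t r)) 0 b.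
(* The sum of the energy and of the momentum [v_t v_r], that is, the Morawetz functional: its derivative
   contains [- morawetz]. *)
Definition incoming_energy t := RInt (fun r => / 2 * P t r ^ 2 + r ^ 2 * H (U t r)) 0 b.
Definition morawetz t := RInt (fun r => r * q (U t r)) 0 b.
Definition mu t := RInt morawetz 0 t.

Lemma b_pos : 0 < b. Proof. lra. Qed.

Lemma edge_zero t : 0 <= t <= T -> P t b = 0 /\ P t (- b) = 0 /\ U t b = 0.
Proof.
intros Ht; repeat split; [apply P_outside|apply P_outside|apply U_outside];
  rewrite ?Rabs_Ropp, ?Rabs_pos_eq; lra.
Qed.

(** The source in [P_t] contributes [- r h(U) v_t], which cancels the derivative of the potential
    term since [v_t = r U_t]. What is left is an exact derivative in [r]. *)
Lemma energy_der t : is_derive energy t (/ 4 * P t b ^ 2 - / 4 * P t (- b) ^ 2).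
Proof.
assert (Q1 := c2_U); assert (Q2 := cont_h); assert (Q3 := c2_p); assert (Q4 := cont_H).
set (de := fun t r => / 2 * (P t r * p t r) + / 2 * (P t (- r) * p t (- r)) + r ^ 2 * (avg 0 p t r * h (U t r))).
assert (Q5 := c2_avg 0 p Q3).
eapply is_derive_eq.
- apply (derive_RInt_param (fun t r => / 4 * P t r ^ 2 + / 4 * P t (- r) ^ 2 + r ^ 2 * H (U t r)) de 0 b t).
  + intros s; cont_tac.
  + unfold de; cont_tac.
  + intros s y; eapply is_derive_eq.
    * apply der_plus; [apply der_plus|].
      -- apply der_scal, der_pow2, HPt.
      -- apply der_scal, der_pow2, HPt.
      -- apply der_scal, (der_comp H (fun s => U s y)); [apply H_der|apply U_der_t].
    * unfold de; cbv beta; field.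
- transitivity (RInt (fun r => / 2 * (P t r * Y t r) + / 2 * (P t (- r) * Y t (- r))) 0 b).
  + apply RI_ext; intros r _; unfold de.
    replace (r ^ 2 * (avg 0 p t r * h (U t r))) with (r * (r * avg 0 p t r) * h (U t r)) by ring.
    rewrite r_mul_U_der_t; unfold p; rewrite avg_P_even; real_eq; field.
  + rewrite (RI_derive (fun r => / 4 * P t r ^ 2 - / 4 * P t (- r) ^ 2)).
    * rewrite Ropp_0; real_eq; ring.
    * intros x; eapply is_derive_eq.
      -- apply der_minus; apply der_scal, der_pow2; [apply HPr|].
         apply (der_comp (P t) Ropp); [apply HPr|apply (der_opp (fun x => x)), der_id].
      -- cbv beta; real_eq; field.
    * cont_tac.
Qed.

Lemma energy_const t : 0 <= t <= T -> energy t = energy 0.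
Proof.
intros Ht.
assert (E := RI_derive energy _ 0 t energy_der).
rewrite RI_zero in E.
- cut (0 = energy t - energy 0); [lra|apply E; cont_tac].
- lra.
- intros x Hx; destruct (edge_zero x) as [-> [-> _]]; [lra|ring].
Qed.

Lemma cont_morawetz : cont morawetz.
Proof. assert (Q1 := c2_U); assert (Q2 := cont_q); unfold morawetz; cont_tac. Qed.

Lemma morawetz_pos t : 0 <= morawetz t.
Proof.
assert (Q1 := c2_U); assert (Q2 := cont_q).
apply RI_ge_0; [left; apply b_pos|cont_tac|].
intros x Hx; apply Rmult_le_pos; [lra|apply Hqpos].
Qed.

(** After cancellation of [v_t] the source leaves [- r h(U) v_r] with [v_r = r U_r + U]. This is
    [- (r^2 H(U))_r - r (U h(U) - 2 H(U))], and the last term is the Morawetz density. *)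
Lemma incoming_der t : is_derive incoming_energy t
  (/ 2 * P t b ^ 2 - b ^ 2 * H (U t b) - / 2 * P t 0 ^ 2 - morawetz t).
Proof.
assert (Q1 := c2_U); assert (Q2 := cont_h); assert (Q3 := c2_p); assert (Q4 := cont_H).
set (de := fun t r => P t r * p t r + r ^ 2 * (avg 0 p t r * h (U t r))).
assert (Q5 := c2_avg 0 p Q3). assert (Q6 := c2_avg 1 Y HY). assert (Q7 := cont_q).
eapply is_derive_eq.
- apply (derive_RInt_param (fun t r => / 2 * P t r ^ 2 + r ^ 2 * H (U t r)) de 0 b t).
  + intros s; cont_tac.
  + unfold de; cont_tac.
  + intros s y; eapply is_derive_eq.
    * apply der_plus.
      -- apply der_scal, der_pow2, HPt.
      -- apply der_scal, (der_comp H (fun s => U s y)); [apply H_der|apply U_der_t].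
    * unfold de; cbv beta; field.
- transitivity (RInt (fun r => (P t r * Y t r - (2 * r * H (U t r) + r ^ 2 * (avg 1 Y t r * h (U t r))))
     - r * q (U t r)) 0 b).
  + apply RI_ext; intros r _; unfold de.
    replace (r ^ 2 * (avg 0 p t r * h (U t r))) with (r * (r * avg 0 p t r) * h (U t r)) by ring.
    replace (r ^ 2 * (avg 1 Y t r * h (U t r)))
      with (r * (r * avg 1 Y t r + U t r) * h (U t r) - r * U t r * h (U t r)) by ring.
    rewrite r_mul_U_der_t, r_mul_U_der_r; unfold p, q; real_eq; field.
  + rewrite RI_minus by cont_tac; unfold morawetz.
    rewrite (RI_derive (fun r => / 2 * P t r ^ 2 - r ^ 2 * H (U t r))).
    * real_eq; ring.
    * intros x; eapply is_derive_eq.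
      -- apply der_minus; [apply der_scal, der_pow2, HPr|].
         apply der_mult; [apply der_pow2, der_id|].
         apply (der_comp H (U t)); [apply H_der|apply U_der_r].
      -- cbv beta; real_eq; field.
    * cont_tac.
Qed.

Lemma mu_der t : is_derive mu t (morawetz t).
Proof. apply RI_FTC, cont_morawetz. Qed.

Lemma mu_mono s t : s <= t -> mu s <= mu t.
Proof. intros Hst; apply (derive_le_mono mu morawetz); auto using mu_der, morawetz_pos. Qed.

(** The terms at [r = b] vanish or have a favourable sign, and the term at [r = 0] is
    [- P(t, 0)^2 / 2], so the functional decreases at least as fast as the Morawetz integral
    grows. *)
Lemma mu_bound t : 0 <= t <= T -> mu t <= incoming_energy 0.
Proof.
intros Ht; assert (Q1 := c2_U); assert (Q4 := cont_H).
assert (A1 : incoming_energy t + mu t <= incoming_energy 0 + mu 0).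
{ apply Ropp_le_cancel.
  apply (derive_le_mono (fun t => - (incoming_energy t + mu t))
    (fun t => - ((/ 2 * P t b ^ 2 - b ^ 2 * H (U t b) - / 2 * P t 0 ^ 2 - morawetz t) + morawetz t))).
  - lra.
  - intros x; apply der_opp, der_plus; [apply incoming_der|apply mu_der].
  - intros x Hx; destruct (edge_zero x) as [-> [_ ->]]; [lra|].
    sq (P x 0).
    assert (0 <= b ^ 2 * H 0) by (apply Rmult_le_pos; [apply pow2_ge_0|apply HHpos]). lra. }
assert (A2 : 0 <= incoming_energy t).
{ assert (X := b_pos); apply RI_ge_0; [lra|cont_tac|]. intros x _.
  sq (P t x).
  assert (0 <= x ^ 2 * H (U t x)) by (apply Rmult_le_pos; [apply pow2_ge_0|apply HHpos]). lra. }
unfold mu at 2 in A1; rewrite RI_point in A1; lra.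
Qed.

(** Cauchy-Schwarz in [r U = / 2 * RInt (P t) (- r) r] gives [r^2 U^2 <= (r / 2)] times the integral
    of [P^2], which is at most [4 E]. *)
Lemma radial_bound t r : 0 <= t <= T -> 0 <= r <= b -> r * U t r ^ 2 <= 2 * energy 0.
Proof.
intros Ht Hr; assert (Q1 := c2_U); assert (Q4 := cont_H); assert (X := b_pos).
assert (CS := cauchy_schwarz (fun _ => 1) (P t) (- r) r ltac:(lra) (cont_const 1) (cont_curry P t HP)).
rewrite (RI_ext (fun x => 1 * P t x) (P t)) in CS by (intros; ring).
rewrite (RI_ext (fun x => 1 ^ 2) (fun _ => 1)), RI_const in CS by (intros; real_eq; ring).
assert (E : RInt (fun x => P t x ^ 2) (- r) r <= 4 * energy 0).
{ rewrite <- (energy_const t Ht); unfold energy; rewrite <- RI_scal by cont_tac.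
  rewrite RI_sym_split by cont_tac.
  assert (E1 := RI_chasles (fun x => P t x ^ 2 + P t (- x) ^ 2) 0 r b ltac:(cont_tac)).
  assert (0 <= RInt (fun x => P t x ^ 2 + P t (- x) ^ 2) r b).
  { apply RI_ge_0; [lra|cont_tac|]. intros x _.
    sq (P t x). sq (P t (- x)). lra. }
  apply Rle_trans with (RInt (fun x => P t x ^ 2 + P t (- x) ^ 2) 0 b); [lra|].
  apply RI_le; [lra|cont_tac|cont_tac|]. intros x _.
  assert (0 <= x ^ 2 * H (U t x)) by (apply Rmult_le_pos; [apply pow2_ge_0|apply HHpos]). lra. }
assert (F := r_mul_U t r).
change (RInt (P t) (- r) r) with (V t r) in CS.
assert (G : r ^ 2 * U t r ^ 2 = / 4 * V t r ^ 2).
{ replace (r ^ 2 * U t r ^ 2) with ((r * U t r) ^ 2) by ring. rewrite F; field. }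
destruct (Req_dec r 0) as [->|N].
- rewrite Rmult_0_l. rewrite Ropp_0, RI_point in E; lra.
- apply Rmult_le_reg_l with r; [lra|]. nra.
Qed.

(** * The time derivative of [P] along characteristics *)

Let w := avg 0 p.
(** Every line [r + t = c] meeting the support of the solution at a time in [[0, T]] has
    [Rabs c < b2]. *)
Let b2 := b + T.

Lemma c2_w : c2 w. Proof. apply c2_avg, c2_p. Qed.

(** The terms with [U_r] in the equation for [Y] and in the derivative of [r h(U)] cancel. Only
    [w = U_t] survives, so [p] satisfies a closed linear equation. *)
Lemma p_line c s : is_derive (fun s => p s (c - s)) s (- ((c - s) * g (U s (c - s)) * w s (c - s))).
Proof.
assert (Q1 := c2_U); assert (Q2 := cont_h); assert (Q3 := c2_p). assert (Q6 := c2_avg 1 Y HY).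
set (F := fun s => - h (U s (c - s)) + - (c - s) * g (U s (c - s)) * avg 1 Y s (c - s)).
apply is_derive_ext with (fun s => dP0 c + RInt F 0 s - (c - s) * h (U s (c - s))).
{ intros y; unfold p; f_equal; rewrite HYE; unfold duhamel.
  replace (c - y + y) with c by ring; auto. }
eapply is_derive_eq.
- apply der_minus; [apply der_plus; [apply der_const|apply RI_FTC]|].
  + unfold F; cont_tac.
  + apply der_mult; [apply der_minus; [apply der_const|apply der_id]|].
    apply (der_comp h (fun s => U s (c - s))); [apply Hh|].
    apply (der_comp2 U w (avg 1 Y) (fun s => s) (fun s => c - s)).
    * apply c2_w.
    * apply U_der_t.
    * apply U_der_r.
    * apply der_id.
    * apply der_minus; [apply der_const|apply der_id].
- unfold F; cbv beta; real_eq; ring.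
Qed.

Definition pnorm t := RInt (fun r => p t r ^ 2) (- b2) b2.

Lemma b2_pos : 0 < b2 /\ b <= b2. Proof. unfold b2; lra. Qed.

Lemma pnorm_line t : 0 <= t <= T -> pnorm t = RInt (fun c => p t (c - t) ^ 2) (- b2) b2.
Proof.
intros Ht; assert (Q3 := c2_p); unfold pnorm.
assert (Hc : cont (fun r => p t r ^ 2)) by cont_tac.
assert (Hz : forall x, b <= Rabs x -> p t x ^ 2 = 0).
{ intros x Hx; rewrite p_outside; [ring|lra|lra]. }
rewrite (RI_shift_support (fun r => p t r ^ 2) b b2 t); auto.
- apply RI_support; auto; unfold b2; lra.
- lra.
- rewrite Rabs_pos_eq; unfold b2; lra.
Qed.

Section Slab.

Variables t0 t1 X0 D : R.
Hypotheses (Ht0 : 0 <= t0 <= t1) (Ht1 : t1 <= T) (HX0 : 0 <= X0)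
  (HM0 : forall r, Rabs (P t0 r) <= X0) (HQ0 : pnorm t0 <= X0 ^ 2)
  (HD : forall t r, t0 <= t <= t1 -> Rabs (P t r) <= D)
  (Hmu : 6400 * energy 0 * ln (2 + D ^ 2) * (mu t1 - mu t0) <= 1).

(* [S c] dominates [p] on the part of the characteristic [r = c - s] lying in the slab. *)
Let f c s := (c - s) * g (U s (c - s)) * w s (c - s).
Let S c := Rabs (p t0 (c - t0)) + RInt (fun s => Rabs (f c s)) t0 t1.
Let k s r := (r * g (U s r)) ^ 2.
Let a c := RInt (fun s => k s (c - s)) t0 t1.
Let N := RInt (fun c => S c ^ 2) (- b2) b2.

Lemma c2_f : c2 f.
Proof. assert (Q1 := c2_U); assert (Q2 := c2_w); unfold f; cont_tac. Qed.

Lemma cont_S : cont S.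
Proof. assert (Q1 := c2_f); assert (Q2 := c2_p); unfold S; cont_tac. Qed.

Lemma c2_k : c2 k.
Proof. assert (Q1 := c2_U); unfold k; cont_tac. Qed.

Lemma cont_a : cont a.
Proof. assert (Q1 := c2_k); unfold a; cont_tac. Qed.

Lemma S_pos c : 0 <= S c.
Proof.
assert (Q1 := c2_f); unfold S; apply Rplus_le_le_0_compat; [apply Rabs_pos|].
apply RI_ge_0; [lra|cont_tac|]. intros; apply Rabs_pos.
Qed.

Lemma p_le_S c s : t0 <= s <= t1 -> Rabs (p s (c - s)) <= S c.
Proof.
intros Hs; assert (Q1 := c2_f).
assert (E := RI_derive (fun s => p s (c - s)) (fun s => - f c s) t0 s (p_line c) ltac:(cont_tac)).
cbv beta in E; unfold S.
replace (p s (c - s)) with (p t0 (c - t0) + RInt (fun s => - f c s) t0 s) by (rewrite E; real_eq; ring).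
eapply Rle_trans; [apply Rabs_triang|]; apply Rplus_le_compat_l.
eapply Rle_trans; [apply (RI_abs_le _ (fun s => Rabs (f c s))); try cont_tac; [lra|]|].
- intros x _; rewrite Rabs_Ropp; lra.
- rewrite <- (RI_chasles (fun s => Rabs (f c s)) t0 s t1) by cont_tac.
  assert (0 <= RInt (fun s => Rabs (f c s)) s t1); [|lra].
  apply RI_ge_0; [lra|cont_tac|]. intros; apply Rabs_pos.
Qed.

Lemma S_support c : b2 <= Rabs c -> S c = 0.
Proof.
intros Hc; unfold S.
assert (Hz : forall s, t0 <= s <= t1 -> A + s < Rabs (c - s)).
{ intros s Hs; unfold b2 in Hc; revert Hc; abs_lra. }
rewrite p_outside by (try apply Hz; lra).
rewrite Rabs_R0, RI_zero; [ring|lra|].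
intros s Hs; unfold f; rewrite U_outside, g_zero, Rmult_0_r, Rmult_0_l, Rabs_R0; auto; [lra|].
specialize (Hz s Hs); lra.
Qed.

(** The point [(s, y * (c - s))] over which [w] averages lies on the characteristic with label
    [y * (c - s) + s]. The bound is thus a mean of [S] in the form required by [hardy_line]. *)
Lemma w_le_S c s : t0 <= s <= t1 ->
  Rabs (w s (c - s)) <= / 2 * RInt (fun y => S ((c - s) * y + (c - (c - s)))) (-1) 1.
Proof.
intros Hs; assert (Q1 := cont_S); assert (Q2 := c2_p).
unfold w, avg; rewrite Rabs_mult, (Rabs_pos_eq (/ 2)) by lra.
apply Rmult_le_compat_l; [lra|].
apply RI_abs_le; [lra|cont_tac|cont_tac|].
intros y _; rewrite pow_O, Rmult_1_l.
replace (y * (c - s)) with (((c - s) * y + (c - (c - s))) - s) by ring.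
apply p_le_S; auto.
Qed.

Lemma w_line_L2 c : RInt (fun s => w s (c - s) ^ 2) t0 t1 <= 2 * N.
Proof.
assert (Q2 := c2_w).
apply (hardy_line S (fun s => w s (c - s)) b2 c t0 t1).
- apply cont_S.
- cont_tac.
- lra.
- unfold b2; lra.
- apply S_support.
- intros s Hs; apply w_le_S; auto.
Qed.

Lemma U_le_D t r : t0 <= t <= t1 -> Rabs (U t r) <= D.
Proof. intros Ht; apply avg_bound; [apply HP|]. intros; apply HD; auto. Qed.

Lemma energy_pos t : 0 <= energy t.
Proof.
assert (Q1 := c2_U); assert (Q4 := cont_H); assert (X := b_pos).
apply RI_ge_0; [lra|cont_tac|]. intros x _.
sq (P t x). sq (P t (- x)).
assert (0 <= x ^ 2 * H (U t x)) by (apply Rmult_le_pos; [apply pow2_ge_0|apply HHpos]). lra.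
Qed.

Lemma ln_pos_D : 0 <= ln (2 + D ^ 2).
Proof.
rewrite <- ln_1; apply ln_le; [lra|]. sq D; lra.
Qed.

(** The growth hypothesis leaves a factor [r U^2], which the energy bounds by [2 E]; the rest is the
    Morawetz density times the logarithm. This is where [g^2] is exchanged for an integrable
    quantity. *)
Lemma k_bound s r : t0 <= s <= t1 -> 0 <= r <= b ->
  k s r <= 400 * energy 0 * ln (2 + D ^ 2) * (r * q (U s r)).
Proof.
intros Hs Hr; unfold k; rewrite Rpow_mult_distr.
assert (G := Hgq D (U s r) (U_le_D s r Hs)).
assert (R := radial_bound s r ltac:(lra) Hr).
assert (E := energy_pos 0); assert (Lp := ln_pos_D); assert (Q := Hqpos (U s r)).
apply Rle_trans with (r ^ 2 * (200 * ln (2 + D ^ 2) * U s r ^ 2 * q (U s r))).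
- apply Rmult_le_compat_l; [apply pow2_ge_0|auto].
- replace (r ^ 2 * (200 * ln (2 + D ^ 2) * U s r ^ 2 * q (U s r)))
    with (200 * ln (2 + D ^ 2) * (r * q (U s r)) * (r * U s r ^ 2)) by ring.
  replace (400 * energy 0 * ln (2 + D ^ 2) * (r * q (U s r)))
    with (200 * ln (2 + D ^ 2) * (r * q (U s r)) * (2 * energy 0)) by ring.
  apply Rmult_le_compat_l; auto.
  apply Rmult_le_pos; [lra|apply Rmult_le_pos; lra].
Qed.

Lemma k_slice s : t0 <= s <= t1 ->
  RInt (fun c => k s (c - s)) (- b2) b2 <= 800 * energy 0 * ln (2 + D ^ 2) * morawetz s.
Proof.
intros Hs; assert (Q1 := c2_k); assert (Q2 := c2_U); assert (Q3 := cont_q); assert (X := b_pos).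
rewrite (RI_shift_support (k s) b b2 s).
- rewrite RI_sym_split by cont_tac.
  unfold morawetz; rewrite <- RI_scal by cont_tac.
  apply RI_le; [lra|cont_tac|cont_tac|].
  intros r Hr; assert (E := k_bound s r Hs Hr).
  replace (k s (- r)) with (k s r) by (unfold k; rewrite avg_P_even; ring). lra.
- cont_tac.
- intros r Hr; unfold k; rewrite U_outside, g_zero by lra; ring.
- lra.
- rewrite Rabs_pos_eq by lra; unfold b2; lra.
Qed.

(** The factor 800 is 400 counted for both signs of [r], and 6400 is 8 times 800. The value [/ 8] is
    what [N_bound] needs to absorb [4 * N] times this integral. *)
Lemma a_integral : RInt a (- b2) b2 <= / 8.
Proof.
assert (Q1 := c2_k); assert (Q2 := cont_morawetz).
unfold a; rewrite (fubini (fun c s => k s (c - s))) by cont_tac.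
eapply Rle_trans; [apply (RI_le _ (fun s => 800 * energy 0 * ln (2 + D ^ 2) * morawetz s)); try cont_tac; [lra|]|].
- intros s Hs; apply k_slice; auto.
- rewrite RI_scal by cont_tac.
  assert (E := RI_chasles morawetz 0 t0 t1 Q2). unfold mu in Hmu.
  replace (RInt morawetz t0 t1) with (RInt morawetz 0 t1 - RInt morawetz 0 t0) by lra. lra.
Qed.

(* Cauchy-Schwarz on each characteristic; Hardy's inequality bounds the factor containing [w]. *)
Lemma S_sq_bound c : S c ^ 2 <= 2 * p t0 (c - t0) ^ 2 + 4 * N * a c.
Proof.
assert (Q1 := c2_k); assert (Q2 := c2_f); assert (Q3 := c2_U); assert (Q4 := c2_w).
assert (CS := cauchy_schwarz_abs (fun s => (c - s) * g (U s (c - s))) (fun s => w s (c - s))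
  t0 t1 ltac:(lra) ltac:(cont_tac) ltac:(cont_tac)).
change (RInt (fun s => Rabs (f c s)) t0 t1 ^ 2 <= a c * RInt (fun s => w s (c - s) ^ 2) t0 t1) in CS.
assert (W := w_line_L2 c).
assert (a0 : 0 <= a c) by (apply RI_ge_0; [lra|cont_tac|intros; apply pow2_ge_0]).
unfold S; set (I := RInt (fun s => Rabs (f c s)) t0 t1) in *.
rewrite <- (pow2_abs (p t0 (c - t0))).
set (z := Rabs (p t0 (c - t0))).
sq (z - I).
assert (a c * RInt (fun s => w s (c - s) ^ 2) t0 t1 <= a c * (2 * N)) by (apply Rmult_le_compat_l; auto).
nra.
Qed.

(** Integrating [S_sq_bound] gives [N <= 2 X0^2 + N / 2]. The absorption is legitimate because [N]
    is an integral of a continuous function over a bounded interval. *)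
Lemma N_bound : N <= 4 * X0 ^ 2.
Proof.
assert (Q1 := cont_S); assert (Q2 := c2_p); assert (Q3 := cont_a); destruct b2_pos as [X X'].
assert (N0 : 0 <= N) by (apply RI_ge_0; [lra|cont_tac|intros; apply pow2_ge_0]).
assert (E : N <= RInt (fun c => 2 * p t0 (c - t0) ^ 2 + 4 * N * a c) (- b2) b2).
{ apply RI_le; [lra|cont_tac|cont_tac|]. intros c _; apply S_sq_bound. }
rewrite RI_plus, !RI_scal, <- pnorm_line in E by (try cont_tac; lra).
assert (A8 := a_integral). nra.
Qed.

Lemma slab_p t : t0 <= t <= t1 -> pnorm t <= 4 * X0 ^ 2.
Proof.
intros Ht; assert (Q1 := cont_S); assert (Q2 := c2_p); destruct b2_pos as [X X'].
eapply Rle_trans; [|apply N_bound].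
rewrite pnorm_line by lra; apply RI_le; [lra|cont_tac|cont_tac|].
intros c _; rewrite <- (pow2_abs (p t (c - t))); apply pow_incr; split; [apply Rabs_pos|apply p_le_S; auto].
Qed.

Lemma S_integral a1 a2 : a1 <= a2 -> RInt S a1 a2 <= (8 * b2 + 1) * X0.
Proof.
intros Ha; destruct b2_pos as [X X'].
apply L1_le_L2; auto using cont_S, S_pos, S_support; [lra|apply N_bound].
Qed.

(** At fixed [r], integration of [P_t] in time crosses the characteristics [c = r + s]. The integral
    of [S] over these labels is controlled by its [L^2] norm. *)
Lemma slab_P t r : t0 <= t <= t1 -> Rabs (P t r) <= (1 + (8 * b2 + 1)) * X0.
Proof.
intros Ht; assert (Q1 := cont_S); assert (Q2 := c2_p).
assert (E := RI_derive (fun t => P t r) (fun t => p t r) t0 t (fun t => HPt t r) ltac:(cont_tac)).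
cbv beta in E.
replace (P t r) with (P t0 r + RInt (fun t => p t r) t0 t) by (rewrite E; real_eq; ring).
eapply Rle_trans; [apply Rabs_triang|].
assert (E2 : Rabs (RInt (fun t => p t r) t0 t) <= RInt (fun s => S (1 * s + r)) t0 t).
{ apply RI_abs_le; [lra|cont_tac|cont_tac|]. intros s Hs.
  replace r with ((1 * s + r) - s) at 1 by ring. apply p_le_S; lra. }
assert (L := RI_lin S 1 r t0 t Q1); rewrite Rmult_1_l in L; rewrite L in E2.
assert (E3 := S_integral (1 * t0 + r) (1 * t + r) ltac:(lra)).
specialize (HM0 r); lra.
Qed.

End Slab.

(** * Iteration over time slabs *)

Variables (X0 E1 I0 : R).
Hypotheses (HX0 : 1 <= X0) (HE1 : 0 < E1) (HE : energy 0 <= E1) (HI : incoming_energy 0 <= I0)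
  (HPX : forall r, Rabs (P0 r) <= X0) (HpX : pnorm 0 <= X0 ^ 2).

(** Twice the growth factor of [slab_P]: each slab then ends with half of the next level [Dk (S k)],
    as the continuity argument requires. *)
Let C := 2 * (1 + (8 * b2 + 1)).
Let Dk (k : nat) := C ^ k * X0.
Let al := ln (3 * X0 ^ 2) + ln (C ^ 2).

Lemma C_ge : 4 <= C.
Proof. destruct b2_pos; unfold C; lra. Qed.

Lemma Dk_pos k : 1 <= Dk k.
Proof.
assert (Q := C_ge); assert (1 <= C ^ k) by (apply pow_R1_Rle; lra). unfold Dk; nra.
Qed.

Lemma Dk_S k : Dk (S k) = C * Dk k.
Proof. unfold Dk; simpl; ring. Qed.

Lemma al_pos : 0 < al.
Proof.
assert (Q := C_ge); unfold al.
assert (0 < ln (C ^ 2)) by (rewrite <- ln_1; apply ln_increasing; nra).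
assert (0 < ln (3 * X0 ^ 2)) by (rewrite <- ln_1; apply ln_increasing; nra). lra.
Qed.

Lemma ln_Dk k : ln (2 + Dk k ^ 2) <= al * (INR k + 1).
Proof.
assert (Q := C_ge).
assert (Hp : 1 <= (C ^ 2) ^ k) by (apply pow_R1_Rle; nra).
apply Rle_trans with (ln (3 * X0 ^ 2 * (C ^ 2) ^ k)).
- apply ln_le; [sq (Dk k); lra|].
  unfold Dk; rewrite Rpow_mult_distr, <- pow_mult, Nat.mul_comm, pow_mult.
  assert (1 <= (C ^ 2) ^ k * X0 ^ 2) by nra. nra.
- rewrite ln_mult, ln_pow by nra.
  assert (P1 := pos_INR k).
  assert (0 < ln (3 * X0 ^ 2)) by (rewrite <- ln_1; apply ln_increasing; nra).
  assert (0 < ln (C ^ 2)) by (rewrite <- ln_1; apply ln_increasing; nra).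
  unfold al; nra.
Qed.

Definition controlled (K t : R) := (forall r, Rabs (P t r) <= K) /\ pnorm t <= K ^ 2.

(* The logarithm of [Dk k] grows linearly in [k], so that the slab number [k] may consume [1 / (k + 2)] of
   the Morawetz integral: finitely many slabs suffice because the harmonic series diverges. *)
Lemma slab_step k s0 s1 : 0 <= s0 <= s1 -> s1 <= T -> controlled (Dk k) s0 ->
  mu s1 - mu s0 <= / (6400 * E1) / al * / (INR k + 2) ->
  forall s, s0 <= s <= s1 -> controlled (Dk (S k)) s.
Proof.
intros H0 H1 [Hc1 Hc2] Hmu.
assert (QC := C_ge); assert (QD := Dk_pos k); assert (QD' := Dk_pos (S k)).
assert (Qal := al_pos); assert (Pk := pos_INR k).
assert (DS := Dk_S k).
assert (Lk := ln_Dk (S k)); rewrite S_INR in Lk.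
assert (Lp : 0 <= ln (2 + Dk (S k) ^ 2)).
{ rewrite <- ln_1; apply ln_le; [lra|]. assert (0 <= Dk (S k) ^ 2) by apply pow2_ge_0; lra. }
assert (E0 := energy_pos 0).
assert (Hsm : forall t, s0 <= t <= s1 -> 6400 * energy 0 * ln (2 + Dk (S k) ^ 2) * (mu t - mu s0) <= 1).
{ intros t Ht.
  assert (M1 := mu_mono t s1 ltac:(lra)); assert (M0 := mu_mono s0 t ltac:(lra)).
  apply Rle_trans with (6400 * E1 * (al * (INR k + 1 + 1)) * (/ (6400 * E1) / al * / (INR k + 2))).
  - apply Rmult_le_compat; [|lra| |lra].
    + apply Rmult_le_pos; lra.
    + apply Rmult_le_compat; lra.
  - right; field; lra. }
destruct (sup_segment P (- b) b) as [m [Hm [m1 m2]]]; [assert (X := b_pos); lra|exact HP|].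
assert (mpos : forall t, 0 <= m t).
{ intros t; eapply Rle_trans; [apply Rabs_pos|apply (m1 t 0)]; assert (X := b_pos); lra. }
assert (mP : forall t r, 0 <= t <= T -> Rabs (P t r) <= m t).
{ intros t r Ht; destruct (Rle_dec (Rabs r) b) as [Hr|Hr].
  - apply m1; apply Rabs_le_between; auto.
  - rewrite P_outside, Rabs_R0 by lra; auto. }
assert (Hboot : forall t, s0 <= t <= s1 -> (forall s, s0 <= s <= t -> Rabs (m s) <= Dk (S k)) ->
  forall s, s0 <= s <= t -> (forall r, Rabs (P s r) <= Dk (S k) / 2) /\ pnorm s <= 4 * Dk k ^ 2).
{ intros t Ht Hs s Hst.
  assert (HDb : forall u r, s0 <= u <= t -> Rabs (P u r) <= Dk (S k)).
  { intros u r Hu; eapply Rle_trans; [apply mP; lra|].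
    eapply Rle_trans; [apply Rle_abs|apply Hs; lra]. }
  split.
  - intros r.
    eapply Rle_trans; [apply (slab_P s0 t (Dk k) (Dk (S k))); auto; lra|].
    rewrite DS; unfold C; lra.
  - apply (slab_p s0 t (Dk k) (Dk (S k))); auto; lra. }
assert (Hhalf : forall s, s0 <= s <= s1 -> m s <= Dk (S k) / 2).
{ apply bootstrap; auto; [lra|lra| |].
  - apply m2; intros r _; eapply Rle_trans; [apply Hc1|]. rewrite DS; nra.
  - intros t Ht Hs s Hst; rewrite Rabs_pos_eq by auto.
    apply m2; intros r _; apply (Hboot t Ht Hs s Hst). }
intros s Hs.
assert (Hle : forall u, s0 <= u <= s1 -> Rabs (m u) <= Dk (S k)).
{ intros u Hu; rewrite Rabs_pos_eq by auto; specialize (Hhalf u Hu); lra. }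
destruct (Hboot s1 ltac:(lra) Hle s Hs) as [B1 B2].
split.
- intros r; specialize (B1 r); lra.
- rewrite DS; assert ((2 * Dk k) ^ 2 <= (C * Dk k) ^ 2) by (apply pow_incr; nra). lra.
Qed.

(** Slab [k] ends at [T], or where [mu] equals the prescribed multiple of [hsum (S k)], a time found
    by the intermediate value theorem. Recording equality for [mu s] lets the bound on [mu] rule out
    the second case once [hsum k] is large. *)
Lemma iteration k : exists s, 0 <= s <= T /\ (s = T \/ mu s = / (6400 * E1) / al * hsum k) /\
  forall u, 0 <= u <= s -> controlled (Dk k) u.
Proof.
assert (QC := C_ge); assert (Qal := al_pos).
assert (Qe : 0 < / (6400 * E1) / al).
{ apply Rdiv_lt_0_compat; auto; apply Rinv_0_lt_compat; lra. }
induction k as [|k [s [Hs [Hor Hc]]]].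
- exists 0; split; [lra|split].
  + right; simpl; unfold mu; rewrite RI_point; real_eq; ring.
  + intros u Hu; replace u with 0 by lra; unfold Dk; rewrite pow_O, Rmult_1_l; split; auto.
    intros r; rewrite P_initial; auto.
- assert (Hup : forall u, 0 <= u <= s -> controlled (Dk (S k)) u).
  { intros u Hu; destruct (Hc u Hu) as [C1 C2]; assert (QD := Dk_pos k); rewrite Dk_S; split.
    - intros r; specialize (C1 r); nra.
    - assert (Dk k ^ 2 <= (C * Dk k) ^ 2) by (apply pow_incr; nra). lra. }
  destruct Hor as [->|Hmu]; [exists T; split; [lra|split; auto]|].
  assert (Pk := pos_INR k).
  assert (Qi : 0 < / (INR k + 2)) by (apply Rinv_0_lt_compat; lra).
  set (e := / (6400 * E1) / al) in *.
  assert (Hstep : exists s', s <= s' <= T /\ (s' = T \/ mu s' = e * hsum (S k)) /\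
     mu s' - mu s <= e * / (INR k + 2)).
  { simpl hsum; destruct (Rle_dec (mu T) (e * (hsum k + / (INR k + 2)))) as [HT'|HT'].
    - exists T; split; [lra|split; auto]. lra.
    - destruct (cont_IVT mu s T (e * (hsum k + / (INR k + 2)))) as [s' [Hs' E]].
      + apply (cont_derive mu morawetz mu_der).
      + lra.
      + nra.
      + exists s'; split; [lra|split; auto]. lra. }
  destruct Hstep as [s' [Hs' [Hor' Hd]]].
  exists s'; split; [lra|split; auto].
  intros u Hu; destruct (Rle_dec u s) as [Hus|Hus]; [apply Hup; lra|].
  apply (slab_step k s s'); auto; try lra. apply Hc; lra.
Qed.

Lemma apriori_bound k : I0 < / (6400 * E1) / al * hsum k ->
  forall t r, 0 <= t <= T -> Rabs (P t r) <= Dk k.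
Proof.
intros Hk t r Ht; destruct (iteration k) as [s [Hs [Hor Hc]]].
assert (M1 := mu_bound T ltac:(lra)); assert (M2 := mu_mono s T ltac:(lra)).
destruct Hor as [->|E]; [|lra].
apply Hc; auto.
Qed.

End Apriori.

(* All bounds below depend on the nonlinearity only through these properties, hence are uniform in the
   truncation level; the logarithm enters through [adm_growth] alone. *)
Record admissible (Gam : R -> R) (h g : R -> R) : Prop := {
  adm_der : forall y, is_derive h y (g y);
  adm_cont : cont g;
  adm_0 : h 0 = 0;
  adm_prim : forall y, 0 <= RInt h 0 y;
  adm_virial : forall y, 0 <= y * h y - 2 * RInt h 0 y;
  adm_growth : forall D y, Rabs y <= D ->
    g y ^ 2 <= 200 * ln (2 + D ^ 2) * y ^ 2 * (y * h y - 2 * RInt h 0 y);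
  adm_bound : forall D y, Rabs y <= D -> Rabs (h y) <= Gam D /\ RInt h 0 y <= Gam D }.

(** The order of quantifiers is the point: [D] is fixed before [h], [g] and [P]. All constants are
    computed from the data and [Gam], since at time 0 the solution is known. *)
Lemma uniform_apriori_bound Gam P0 dP0 A T : (forall D, 0 <= Gam D) ->
  (forall c, is_derive P0 c (dP0 c)) -> cont dP0 -> 0 < A ->
  (forall c, A <= Rabs c -> P0 c = 0) -> RInt P0 (- A) A = 0 -> 0 <= T ->
  exists D, forall h g P, admissible Gam h g -> c2 P ->
    (forall t r, P t r = duhamel 0 P0 (fun _ x y => - x * h y) P t r) ->
    forall t r, 0 <= t <= T -> Rabs (P t r) <= D.
Proof.
intros HG HdP0 HcdP0 c2_A HP0s HP0m HT.
assert (HP0c := cont_derive P0 dP0 HdP0).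
set (b := A + T + 1); set (b2 := b + T).
destruct (bounded1 P0 A HP0c ltac:(lra)) as [B0 [HB0 HB0']].
destruct (bounded1 dP0 b2 HcdP0 ltac:(unfold b2, b; lra)) as [B1 [HB1 HB1']].
assert (HP0b : forall c, Rabs (P0 c) <= B0).
{ intros c; destruct (Rle_dec (Rabs c) A); auto. rewrite HP0s, Rabs_R0; lra. }
assert (G0 := HG B0).
set (E1 := b * (B0 ^ 2 + b ^ 2 * Gam B0) + 1).
(* Bounds [p] at time 0, where [p = dP0 - r h(U)], for [Rabs r <= b2]. *)
set (q := B1 + b2 * Gam B0).
(* The summand [(1 + 2 * b2) * q] dominates the [L^2] norm of [p] at time 0, since
   [2 * b2 <= (1 + 2 * b2)^2]. *)
set (X0 := 1 + B0 + (1 + 2 * b2) * q).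
assert (Hb : 0 < b) by (unfold b; lra). assert (Hb2 : 0 < b2) by (unfold b2; lra).
assert (HE1 : 0 < E1).
{ unfold E1. sq B0. sq b.
  assert (0 <= b * (B0 ^ 2 + b ^ 2 * Gam B0)); [|lra]. apply Rmult_le_pos; [lra|nra]. }
assert (Hq : 0 <= q) by (unfold q; nra).
assert (HX0 : 1 <= X0) by (unfold X0; nra).
set (C := 2 * (1 + (8 * b2 + 1))).
set (al := ln (3 * X0 ^ 2) + ln (C ^ 2)).
assert (Hal : 0 < al).
{ assert (4 <= C) by (unfold C; lra). unfold al.
  assert (0 < ln (C ^ 2)) by (rewrite <- ln_1; apply ln_increasing; nra).
  assert (0 < ln (3 * X0 ^ 2)) by (rewrite <- ln_1; apply ln_increasing; nra). lra. }
set (e := / (6400 * E1) / al).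
assert (He : 0 < e).
{ apply Rdiv_lt_0_compat; auto; apply Rinv_0_lt_compat; lra. }
destruct (hsum_unbounded ((E1 + 1) / e)) as [k Hk].
exists (C ^ k * X0); intros h g P [a1 a2 a3 a4 a5 a6 a7] HP HPE t r Ht.
assert (Hh := cont_derive h g a1).
destruct (duhamel_C1 0 P0 dP0 (fun _ x y => - x * h y) (fun _ x y => - h y) (fun _ x y => - x * g y) P)
  as [Y [HY [HPr [HPt HYE]]]]; auto; try cont_tac.
{ intros s x y; eapply is_derive_eq.
  - apply (der_mult Ropp (fun _ => h y)); [apply (der_opp (fun x => x)), der_id|apply der_const].
  - ring. }
{ intros s x y; apply (der_scal h), a1. }
assert (HPt' : forall t r, is_derive (fun t => P t r) t (Y t r - r * h (avg 0 P t r))).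
{ intros s x; eapply is_derive_eq; [apply HPt|]. cbv beta; ring. }
assert (HP00 : forall x, P 0 x = P0 x).
{ intros x; rewrite HPE; unfold duhamel; rewrite RI_point, !Rplus_0_r; auto. }
assert (HU0 : forall x, Rabs (avg 0 P 0 x) <= B0).
{ intros x; apply avg_bound; auto. intros; rewrite HP00; auto. }
assert (QU := c2_avg 0 P HP).
assert (QH : cont (fun y => RInt h 0 y)) by cont_tac.
assert (QHU : cont (fun r => RInt h 0 (avg 0 P 0 r))) by (apply (cont_comp1 (fun y => RInt h 0 y)); auto; cont_tac).
assert (Hint : forall x, 0 <= x <= b -> x ^ 2 * RInt h 0 (avg 0 P 0 x) <= b ^ 2 * Gam B0).
{ intros x Hx; apply Rmult_le_compat; auto.
  - apply pow2_ge_0.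
  - apply pow_incr; auto.
  - apply a7; auto. }
assert (Hsq : forall x, P 0 x ^ 2 <= B0 ^ 2).
{ intros x; rewrite HP00, <- pow2_abs; apply pow_incr; split; [apply Rabs_pos|auto]. }
assert (HE : energy h P b 0 <= E1).
{ unfold energy, E1.
  eapply Rle_trans; [apply (RI_le _ (fun _ => B0 ^ 2 + b ^ 2 * Gam B0)); try cont_tac; [lra|]|].
  - intros x Hx; assert (Q1 := Hint x Hx); assert (Q2 := Hsq x); assert (Q3 := Hsq (- x)).
    sq B0. lra.
  - rewrite RI_const; lra. }
assert (HI : incoming_energy h P b 0 <= E1).
{ unfold incoming_energy, E1.
  eapply Rle_trans; [apply (RI_le _ (fun _ => B0 ^ 2 + b ^ 2 * Gam B0)); try cont_tac; [lra|]|].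
  - intros x Hx; assert (Q1 := Hint x Hx); assert (Q2 := Hsq x).
    sq B0. lra.
  - rewrite RI_const; lra. }
assert (Hpn : pnorm h P Y T b 0 <= X0 ^ 2).
{ unfold pnorm; fold b2.
  apply Rle_trans with (RInt (fun _ => q ^ 2) (- b2) b2).
  - apply RI_le; [lra|cont_tac|cont_tac|].
    intros x Hx; rewrite <- pow2_abs; apply pow_incr; split; [apply Rabs_pos|].
    unfold Rminus; eapply Rle_trans; [apply Rabs_triang|]; rewrite Rabs_Ropp, Rabs_mult.
    unfold q; apply Rplus_le_compat.
    + rewrite HYE; unfold duhamel; rewrite RI_point, !Rplus_0_r; apply HB1'; apply Rabs_le; lra.
    + apply Rmult_le_compat; try apply Rabs_pos; [apply Rabs_le; lra|apply a7; auto].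
  - rewrite RI_const.
    apply Rle_trans with (((1 + 2 * b2) * q) ^ 2).
    + rewrite Rpow_mult_distr; apply Rmult_le_compat_r; [apply pow2_ge_0|nra].
    + apply pow_incr; split; [apply Rmult_le_pos; lra|unfold X0; lra]. }
apply (apriori_bound h g P0 dP0 A P Y) with (T := T) (b := b) (X0 := X0) (E1 := E1) (I0 := E1); auto.
- unfold b; lra.
- intros x; eapply Rle_trans; [apply HP0b|]. unfold X0; nra.
- change (E1 < e * hsum k).
  apply Rmult_le_compat_l with (r := e) in Hk; [|lra].
  replace (e * ((E1 + 1) / e)) with (E1 + 1) in Hk by (field; lra). lra.
Qed.

(** * The nonlinearity and its truncations *)

Definition logt (y : R) := ln (2 + y ^ 2).
Definition nonl (y : R) := y ^ 5 * logt y.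
Definition dnonl (y : R) := 5 * y ^ 4 * logt y + 2 * y ^ 6 * / (2 + y ^ 2).

Lemma two_sq_pos y : 0 < 2 + y ^ 2.
Proof. sq y; lra. Qed.

Lemma logt_der y : is_derive logt y (2 * y * / (2 + y ^ 2)).
Proof.
assert (P := two_sq_pos y).
eapply is_derive_eq.
- apply (der_comp ln (fun y => 2 + y ^ 2)); [apply is_derive_Reals, derivable_pt_lim_ln; auto|].
  apply der_plus; [apply der_const|apply der_pow2, der_id].
- cbv beta; field; lra.
Qed.

Lemma inv_der y : is_derive (fun y => / (2 + y ^ 2)) y (- (2 * y) * (/ (2 + y ^ 2)) ^ 2).
Proof.
assert (P := two_sq_pos y).
eapply is_derive_eq.
- apply (is_derive_inv (fun y => 2 + y ^ 2) y (0 + 2 * y * 1)); [|lra].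
  apply der_plus; [apply der_const|apply der_pow2, der_id].
- field; lra.
Qed.

Lemma cont_logt : cont logt. Proof. apply (cont_derive _ _ logt_der). Qed.
Lemma cont_inv2 : cont (fun y => / (2 + y ^ 2)). Proof. apply (cont_derive _ _ inv_der). Qed.

Lemma cont_dnonl : cont dnonl.
Proof. assert (Q1 := cont_logt); assert (Q2 := cont_inv2); unfold dnonl; cont_tac; exact Q2. Qed.

Lemma pow_der n y : is_derive (fun y => y ^ n) y (INR n * y ^ pred n).
Proof. eapply is_derive_eq; [apply (is_derive_pow (fun y => y) n y 1), der_id|ring]. Qed.

Lemma nonl_der y : is_derive nonl y (dnonl y).
Proof.
eapply is_derive_eq; [apply (der_mult (fun y => y ^ 5) logt); [apply pow_der|apply logt_der]|].
unfold dnonl; assert (P := two_sq_pos y); simpl; field; simpl in P; lra.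
Qed.

Lemma logt_half y : / 2 < logt y.
Proof.
unfold logt; apply Rlt_le_trans with (ln 2); [apply ln_lt_2|].
apply ln_le; [lra|]. sq y; lra.
Qed.

Lemma logt_mono x y : 0 <= x <= y -> logt x <= logt y.
Proof.
intros H; unfold logt; apply ln_le; [apply two_sq_pos|].
assert (x ^ 2 <= y ^ 2) by (apply pow_incr; auto); lra.
Qed.

Lemma frac_le_pow4 y : 2 * y ^ 6 * / (2 + y ^ 2) <= 2 * y ^ 4.
Proof.
assert (P := two_sq_pos y). apply Rmult_le_reg_r with (2 + y ^ 2); auto.
rewrite Rmult_assoc, Rinv_l by lra.
replace (y ^ 6) with (y ^ 4 * y ^ 2) by ring.
assert (0 <= y ^ 4) by (replace (y ^ 4) with ((y ^ 2) ^ 2) by ring; apply pow2_ge_0). nra.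
Qed.

Lemma dnonl_pos y : 0 <= dnonl y.
Proof.
unfold dnonl; assert (L := logt_half y); assert (P := two_sq_pos y).
assert (0 <= y ^ 4) by (replace (y ^ 4) with ((y ^ 2) ^ 2) by ring; apply pow2_ge_0).
assert (0 <= y ^ 6) by (replace (y ^ 6) with ((y ^ 3) ^ 2) by ring; apply pow2_ge_0).
assert (0 < / (2 + y ^ 2)) by (apply Rinv_0_lt_compat; auto).
apply Rplus_le_le_0_compat; apply Rmult_le_pos; lra.
Qed.

Lemma dnonl_mono x y : 0 <= x <= y -> dnonl x <= dnonl y.
Proof.
intros H; unfold dnonl; apply Rplus_le_compat.
- assert (L := logt_half x); assert (M := logt_mono x y H).
  assert (x ^ 4 <= y ^ 4) by (apply pow_incr; auto).
  assert (0 <= x ^ 4) by (apply pow_le; lra).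
  apply Rmult_le_compat; lra.
(* In this form the rational term is a product of two nonnegative increasing factors. *)
- assert (E : forall z, 2 * z ^ 6 * / (2 + z ^ 2) = 2 * z ^ 4 * (1 - 2 * / (2 + z ^ 2))).
  { intros z; assert (P := two_sq_pos z); field; lra. }
  rewrite !E.
  assert (Px := two_sq_pos x); assert (x ^ 2 <= y ^ 2) by (apply pow_incr; auto).
  assert (/ (2 + y ^ 2) <= / (2 + x ^ 2)) by (apply Rinv_le_contravar; lra).
  assert (x ^ 4 <= y ^ 4) by (apply pow_incr; auto).
  assert (0 <= x ^ 4) by (apply pow_le; lra).
  assert (/ (2 + x ^ 2) <= / 2).
  { apply Rinv_le_contravar; [lra|]. sq x; lra. }
  apply Rmult_le_compat; lra.
Qed.

(** [9 = 5 + 4]: the rational term is at most [2 y^4], hence at most [4 y^4 logt y] because [logt]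
    exceeds one half. *)
Lemma dnonl_growth y : dnonl y <= 9 * (y ^ 4 * logt y).
Proof.
unfold dnonl; assert (F := frac_le_pow4 y); assert (L := logt_half y).
assert (0 <= y ^ 4) by (replace (y ^ 4) with ((y ^ 2) ^ 2) by ring; apply pow2_ge_0).
nra.
Qed.

Lemma logt_even y : logt (- y) = logt y.
Proof. unfold logt; f_equal; ring. Qed.

Lemma nonl_odd y : nonl (- y) = - nonl y.
Proof. unfold nonl; rewrite logt_even; ring. Qed.

(** * Truncated nonlinearities *)

Section Truncation.
Variable n : R.
Hypothesis Hn : 0 < n.

(* [trunc] agrees with [nonl] on [[-n, n]] and is affine outside. *)
Definition dtrunc (y : R) := dnonl (Rmin (Rabs y) n).
Definition trunc (y : R) := RInt dtrunc 0 y.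

Lemma cont_dtrunc : cont dtrunc.
Proof. assert (Q := cont_dnonl); unfold dtrunc; cont_tac. Qed.

Lemma trunc_der y : is_derive trunc y (dtrunc y).
Proof. apply RI_FTC, cont_dtrunc. Qed.

Lemma cont_trunc : cont trunc. Proof. apply (cont_derive _ _ trunc_der). Qed.

Lemma dtrunc_even y : dtrunc (- y) = dtrunc y.
Proof. unfold dtrunc; rewrite Rabs_Ropp; auto. Qed.

Lemma dtrunc_pos y : 0 <= dtrunc y. Proof. apply dnonl_pos. Qed.

Lemma min_range y : 0 <= Rmin (Rabs y) n <= Rabs y /\ Rmin (Rabs y) n <= n.
Proof.
repeat split; [apply Rmin_glb; [apply Rabs_pos|lra]|apply Rmin_l|apply Rmin_r].
Qed.

Lemma dtrunc_le_n y : dtrunc y <= dnonl n.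
Proof. destruct (min_range y); apply dnonl_mono; lra. Qed.

Lemma dtrunc_le y D : Rabs y <= D -> dtrunc y <= dnonl D.
Proof. intros; destruct (min_range y); apply dnonl_mono; lra. Qed.

Lemma dtrunc_mono x y : 0 <= x <= y -> dtrunc x <= dtrunc y.
Proof.
intros H; unfold dtrunc; rewrite !Rabs_pos_eq by lra; apply dnonl_mono.
split; [apply Rmin_glb; lra|apply Rle_min_compat_r; lra].
Qed.

Lemma dtrunc_eq y : Rabs y <= n -> dtrunc y = dnonl (Rabs y).
Proof. intros; unfold dtrunc; rewrite Rmin_left; auto. Qed.

Lemma RI_odd (g : R -> R) y : cont g -> (forall x, g (- x) = g x) -> RInt g 0 (- y) = - RInt g 0 y :> R.
Proof.
intros Hg He; assert (E := RI_lin g (-1) 0 0 y Hg).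
replace (-1 * 0 + 0) with 0 in E by ring; replace (-1 * y + 0) with (- y) in E by ring.
rewrite <- E, (RI_ext (fun x => g (-1 * x + 0)) g); [ring|].
intros x _; rewrite <- He; f_equal; ring.
Qed.

Lemma RI_even (g : R -> R) y : cont g -> (forall x, g (- x) = - g x) -> RInt g 0 (- y) = RInt g 0 y :> R.
Proof.
intros Hg He; assert (E := RI_lin g (-1) 0 0 y Hg).
replace (-1 * 0 + 0) with 0 in E by ring; replace (-1 * y + 0) with (- y) in E by ring.
rewrite <- E, (RI_ext (fun x => g (-1 * x + 0)) (fun x => -1 * g x)).
- rewrite RI_scal by auto; ring.
- intros x _; replace (-1 * x + 0) with (- x) by ring; rewrite He; ring.
Qed.

Lemma trunc_odd y : trunc (- y) = - trunc y.
Proof. apply RI_odd; [apply cont_dtrunc|apply dtrunc_even]. Qed.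

Lemma trunc_0 : trunc 0 = 0. Proof. apply RI_point. Qed.

Lemma trunc_eq_pos y : 0 <= y <= n -> trunc y = nonl y.
Proof.
intros Hy; unfold trunc.
rewrite (RI_ext dtrunc dnonl).
- rewrite (RI_derive nonl dnonl 0 y nonl_der cont_dnonl).
  real_eq; replace (nonl 0) with 0 by (unfold nonl; ring); ring.
- rewrite Rmin_left, Rmax_right by lra; intros x Hx.
  rewrite dtrunc_eq, Rabs_pos_eq; auto; try lra. rewrite Rabs_pos_eq; lra.
Qed.

Lemma trunc_eq y : Rabs y <= n -> trunc y = nonl y.
Proof.
intros Hy; destruct (Rle_dec 0 y).
- apply trunc_eq_pos; rewrite Rabs_pos_eq in Hy; lra.
- replace y with (- - y) by ring; rewrite trunc_odd, nonl_odd, trunc_eq_pos; auto.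
  rewrite Rabs_left in Hy; lra.
Qed.

Lemma trunc_le_pos y : 0 <= y -> 0 <= trunc y <= y * dtrunc y.
Proof.
intros Hy; assert (Q := cont_dtrunc); split.
- apply RI_ge_0; auto; intros; apply dtrunc_pos.
- unfold trunc; apply Rle_trans with (RInt (fun _ => dtrunc y) 0 y).
  + apply RI_le; auto; [cont_tac|]. intros; apply dtrunc_mono; lra.
  + rewrite RI_const; lra.
Qed.

Definition virial y := y * trunc y - 2 * RInt trunc 0 y.

Lemma virial_even y : virial (- y) = virial y.
Proof.
unfold virial; rewrite RI_even by (auto using cont_trunc, trunc_odd).
rewrite trunc_odd; ring.
Qed.

Lemma virial_der y : is_derive virial y (y * dtrunc y - trunc y).
Proof.
eapply is_derive_eq.
- apply der_minus; [apply der_mult; [apply der_id|apply trunc_der]|].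
  apply der_scal, RI_FTC, cont_trunc.
- cbv beta; real_eq; ring.
Qed.

Lemma virial_0 : virial 0 = 0.
Proof. unfold virial; rewrite RI_point; ring. Qed.

Lemma virial_mono x y : 0 <= x <= y -> virial x <= virial y.
Proof.
intros H; apply (derive_le_mono virial _ x y ltac:(lra) virial_der).
intros z Hz; destruct (trunc_le_pos z); lra.
Qed.

(** Both sides vanish at 0, and the derivative of their difference is
    [x^5 logt x + x^7 / (2 + x^2)], which is nonnegative. *)
Lemma virial_lower y : 0 <= y <= n -> / 2 * (y ^ 6 * logt y) <= virial y.
Proof.
intros Hy.
assert (E : virial 0 - / 2 * (0 ^ 6 * logt 0) <= virial y - / 2 * (y ^ 6 * logt y)).
{ apply (derive_le_mono (fun y => virial y - / 2 * (y ^ 6 * logt y))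
   (fun y => y * dtrunc y - trunc y - / 2 * (INR 6 * y ^ 5 * logt y + y ^ 6 * (2 * y * / (2 + y ^ 2))))).
  - lra.
  - intros x; apply der_minus; [apply virial_der|].
    apply der_scal, (der_mult (fun y => y ^ 6) logt); [apply (pow_der 6)|apply logt_der].
  - intros x Hx; rewrite trunc_eq_pos, dtrunc_eq, Rabs_pos_eq by (rewrite ?Rabs_pos_eq; lra).
    unfold nonl, dnonl; assert (L := logt_half x); assert (P := two_sq_pos x).
    assert (0 <= x ^ 5) by (apply pow_le; lra). assert (0 <= x ^ 7) by (apply pow_le; lra).
    assert (0 < / (2 + x ^ 2)) by (apply Rinv_0_lt_compat; auto).
    assert (0 <= x ^ 5 * logt x) by (apply Rmult_le_pos; lra).
    assert (0 <= x ^ 7 * / (2 + x ^ 2)) by (apply Rmult_le_pos; lra).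
    replace (INR 6) with 6 by (simpl; ring).
    replace (x * (5 * x ^ 4 * logt x + 2 * x ^ 6 * / (2 + x ^ 2)) - x ^ 5 * logt x -
      / 2 * (6 * x ^ 5 * logt x + x ^ 6 * (2 * x * / (2 + x ^ 2))))
      with (x ^ 5 * logt x + x ^ 7 * / (2 + x ^ 2)) by (field; lra). lra. }
rewrite virial_0 in E; replace (0 ^ 6) with 0 in E by ring; lra.
Qed.
End Truncation.

(** [D * dnonl D] bounds the truncation and [D^2 * dnonl D] its primitive on [[-D, D]], at every
    truncation level; the absolute value keeps the sum nonnegative for all real [D]. *)
Definition Gam (D : R) := (Rabs D + D ^ 2) * dnonl (Rabs D).

Lemma Gam_pos D : 0 <= Gam D.
Proof.
apply Rmult_le_pos; [|apply dnonl_pos].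
sq D; assert (0 <= Rabs D) by apply Rabs_pos; lra.
Qed.

(** The truncated derivative sees [y] only through [z = Rmin y n], while the virial increases beyond
    [n]; so the inequality at [z] suffices and no constant depends on [n]. There [9^2 = 81] is
    compared with half of 200. *)
Lemma trunc_growth_pos n D y : 0 < n -> 0 <= y <= D ->
  dtrunc n y ^ 2 <= 200 * ln (2 + D ^ 2) * y ^ 2 * virial n y.
Proof.
intros Hn Hy; set (z := Rmin y n).
assert (Hz : 0 <= z <= y /\ z <= n).
{ unfold z; repeat split; [apply Rmin_glb; lra|apply Rmin_l|apply Rmin_r]. }
assert (E : dtrunc n y = dnonl z) by (unfold dtrunc; rewrite Rabs_pos_eq by lra; reflexivity).
assert (G := dnonl_growth z); assert (P := dnonl_pos z); assert (L := logt_half z).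
assert (M : logt z <= ln (2 + D ^ 2)) by (apply (logt_mono z D); lra).
assert (V : / 2 * (z ^ 6 * logt z) <= virial n y).
{ eapply Rle_trans; [apply (virial_lower n); lra|apply virial_mono; lra]. }
assert (z4 : 0 <= z ^ 4) by (apply pow_le; lra). assert (z6 : 0 <= z ^ 6) by (apply pow_le; lra).
assert (zy : z ^ 2 <= y ^ 2) by (apply pow_incr; lra).
assert (z2 : 0 <= z ^ 2) by apply pow2_ge_0.
rewrite E.
apply Rle_trans with ((9 * (z ^ 4 * logt z)) ^ 2); [apply pow_incr; lra|].
apply Rle_trans with (200 * ln (2 + D ^ 2) * z ^ 2 * (/ 2 * (z ^ 6 * logt z))).
- replace ((9 * (z ^ 4 * logt z)) ^ 2) with (81 * logt z * (z ^ 8 * logt z)) by ring.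
  replace (200 * ln (2 + D ^ 2) * z ^ 2 * (/ 2 * (z ^ 6 * logt z)))
    with (100 * ln (2 + D ^ 2) * (z ^ 8 * logt z)) by field.
  apply Rmult_le_compat_r; [|lra].
  apply Rmult_le_pos; [apply pow_le; lra|lra].
- apply Rmult_le_compat; auto.
  + apply Rmult_le_pos; [lra|auto].
  + apply Rmult_le_pos; [lra|apply Rmult_le_pos; lra].
  + apply Rmult_le_compat_l; lra.
Qed.

Lemma trunc_admissible n : 0 < n -> admissible Gam (trunc n) (dtrunc n).
Proof.
intros Hn; split.
- apply trunc_der; auto.
- apply cont_dtrunc; auto.
- apply trunc_0.
- assert (H : forall y, 0 <= y -> 0 <= RInt (trunc n) 0 y).
  { intros y Hy; apply RI_ge_0; [auto|apply cont_trunc; auto|].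
    intros x Hx; apply trunc_le_pos; auto; lra. }
  intros y; destruct (Rle_dec 0 y); auto.
  rewrite <- (Ropp_involutive y), RI_even; [apply H; lra|apply cont_trunc; auto|apply trunc_odd; auto].
- assert (H : forall y, 0 <= y -> 0 <= virial n y).
  { intros y Hy; rewrite <- (virial_0 n); apply virial_mono; lra. }
  intros y; change (0 <= virial n y); destruct (Rle_dec 0 y); auto.
  rewrite <- (Ropp_involutive y), virial_even by auto; apply H; lra.
- intros D y Hy; change (dtrunc n y ^ 2 <= 200 * ln (2 + D ^ 2) * y ^ 2 * virial n y).
  destruct (Rle_dec 0 y).
  + apply trunc_growth_pos; auto. rewrite Rabs_pos_eq in Hy; lra.
  + rewrite <- (Ropp_involutive y), virial_even, dtrunc_even by auto.
    replace ((- - y) ^ 2) with ((- y) ^ 2) by ring.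
    apply trunc_growth_pos; auto. rewrite Rabs_left in Hy; lra.
- intros D y Hy; assert (P := Rabs_pos y).
  assert (HD : Rabs D = D) by (apply Rabs_pos_eq; lra).
  assert (A1 : forall x, Rabs x <= D -> Rabs (trunc n x) <= D * dnonl D).
  { intros x Hx. assert (Px := Rabs_pos x).
    assert (W := mvt_bound (trunc n) (dtrunc n) 0 x (dnonl D) (trunc_der n)).
    rewrite trunc_0, !Rminus_0_r in W.
    apply Rle_trans with (dnonl D * Rabs x); [apply W|].
    - intros z Hz; rewrite Rabs_pos_eq by apply dtrunc_pos; apply dtrunc_le; auto.
      revert Hz Hx; abs_lra.
    - rewrite Rmult_comm; apply Rmult_le_compat_r; [apply dnonl_pos|auto]. }
  assert (Pd := dnonl_pos D).
  assert (D0 : 0 <= D) by lra.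
  assert (0 <= D * dnonl D) by nra. assert (0 <= D ^ 2 * dnonl D) by (apply Rmult_le_pos; [apply pow2_ge_0|auto]).
  unfold Gam; rewrite HD; split.
  + specialize (A1 y Hy); lra.
  + assert (W := mvt_bound (fun y => RInt (trunc n) 0 y) (trunc n) 0 y (D * dnonl D)).
    rewrite RI_point, !Rminus_0_r in W.
    eapply Rle_trans; [apply Rle_abs|].
    eapply Rle_trans; [apply W|].
    * intros x; apply RI_FTC, cont_trunc; auto.
    * intros z Hz; apply A1; revert Hz Hy; abs_lra.
    * apply Rle_trans with (D * dnonl D * D); [apply Rmult_le_compat_l; auto|]. lra.
Qed.

Definition Gtr (n : R) (_ x y : R) := - x * trunc n y.

Lemma c3_Gtr n : 0 < n -> c3 (Gtr n).
Proof. intros Hn; assert (Q := cont_trunc n); unfold Gtr; cont_tac. Qed.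

Lemma lip_Gtr n K : 0 < n -> 0 <= K -> lipschitz_on (Gtr n) (K * dnonl n) K.
Proof.
intros Hn HK s x y y' Hs; unfold Gtr.
replace (- x * trunc n y - - x * trunc n y') with (- x * (trunc n y - trunc n y')) by ring.
rewrite Rabs_mult, Rabs_Ropp, Rmult_assoc.
assert (P := Rabs_pos s).
apply Rmult_le_compat; try apply Rabs_pos; [lra|].
apply (mvt_bound (trunc n) (dtrunc n)); [apply trunc_der; auto|].
intros z _; rewrite Rabs_pos_eq by apply dtrunc_pos; apply dtrunc_le_n; auto.
Qed.

Lemma trunc_solution n P0 : 0 < n -> cont P0 ->
  exists P, c2 P /\ forall t r, P t r = duhamel 0 P0 (Gtr n) P t r.
Proof.
intros Hn H0; apply picard; auto; [apply c3_Gtr; auto|].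
intros K HK; exists (K * dnonl n); apply lip_Gtr; auto.
Qed.

(** Reversing both time and radius preserves the lines [t + r = const] as a family and the form of
    the equation. It converts bounds for positive times into bounds for negative ones. *)
Lemma reflect_solution n P0 P : 0 < n -> c2 P -> (forall t r, P t r = duhamel 0 P0 (Gtr n) P t r) ->
  let P' := fun t r => P (- t) (- r) in
  c2 P' /\ forall t r, P' t r = duhamel 0 (fun c => P0 (- c)) (Gtr n) P' t r.
Proof.
intros Hn HP HPE P'.
assert (HP' : c2 P') by (unfold P'; cont_tac).
split; auto; intros t r; unfold P' at 1; rewrite HPE; unfold duhamel.
replace (- r + - t) with (- (r + t)) by ring; f_equal.
assert (Q := cont_trunc n); assert (QU := c2_avg 0 P HP); assert (QU' := c2_avg 0 P' HP').
assert (EU : forall s x, avg 0 P' s x = avg 0 P (- s) (- x)).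
{ intros s x; unfold avg, P'; f_equal; apply RI_ext; intros y _; do 2 f_equal; ring. }
unfold Gtr.
assert (L := RI_lin (fun s => - (- (r + t) - s) * trunc n (avg 0 P s (- (r + t) - s))) (-1) 0 0 t ltac:(cont_tac)).
replace (-1 * 0 + 0) with 0 in L by ring; replace (-1 * t + 0) with (- t) in L by ring.
rewrite <- L, <- RI_scal by cont_tac.
apply RI_ext; intros s _; rewrite EU.
replace (- (r + t - s)) with (- (r + t) - (-1 * s + 0)) by ring.
replace (-1 * s + 0) with (- s) by ring. ring.
Qed.

(** * Global solution of the characteristic equation *)

(** The square of the positive part is C^1 and its cube is C^2; these powers supply the spatial
    weights and the cutoff without any smooth bump function. *)
Definition ppart (x : R) := Rmax 0 x.

Lemma cont_ppart : cont ppart. Proof. unfold ppart; cont_tac. Qed.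

Lemma ppart2_der x : is_derive (fun x => ppart x ^ 2) x (2 * ppart x).
Proof.
apply is_derive_Reals; intros eps He; exists (mkposreal _ He); intros h Hh Hhe; simpl in Hhe.
replace ((ppart (x + h) ^ 2 - ppart x ^ 2) / h - 2 * ppart x)
  with ((ppart (x + h) ^ 2 - ppart x ^ 2 - h * (2 * ppart x)) / h) by (field; auto).
unfold Rdiv; rewrite Rabs_mult, Rabs_inv.
assert (P := Rabs_pos_lt h Hh).
apply Rmult_lt_reg_r with (Rabs h); auto.
rewrite Rmult_assoc, Rinv_l, Rmult_1_r by lra.
apply Rle_lt_trans with (Rabs h * Rabs h); [|apply Rmult_lt_compat_r; auto].
rewrite <- Rabs_mult, (Rabs_pos_eq (h * h)) by nra.
apply Rabs_le; unfold ppart, Rmax; repeat destruct Rle_dec; split; nra.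
Qed.

Lemma ppart3_der x : is_derive (fun x => ppart x ^ 3) x (3 * ppart x ^ 2).
Proof.
apply is_derive_ext with (fun x => x * ppart x ^ 2).
- intros y; unfold ppart, Rmax; destruct Rle_dec; [simpl; ring|simpl; ring].
- eapply is_derive_eq; [apply der_mult; [apply der_id|apply ppart2_der]|].
  unfold ppart, Rmax; destruct Rle_dec; [ring|ring].
Qed.

Section Data.

Variables (V0 dV0 ddV0 V1 dV1 : R -> R).
Hypotheses (HV0 : forall x, is_derive V0 x (dV0 x)) (HdV0 : forall x, is_derive dV0 x (ddV0 x))
  (HddV0 : cont ddV0) (HV1 : forall x, is_derive V1 x (dV1 x)) (HdV1 : cont dV1)
  (V1odd : forall x, V1 (- x) = - V1 x).

Let P0 x := dV0 x + V1 x.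

Lemma cont_P0 : cont P0.
Proof.
assert (Q1 := cont_derive _ _ HdV0); assert (Q2 := cont_derive _ _ HV1); unfold P0; cont_tac.
Qed.

(** With [V0] and [V1] cut off separately, the new data are [(chi V0)' + chi V1]. The first term
    integrates to zero by its support, the second because it is odd. *)
Lemma cutoff_data K : 0 <= K -> exists (Pc dPc : R -> R) (A : R), (forall c, is_derive Pc c (dPc c)) /\ cont dPc /\
  0 < A /\ (forall c, A <= Rabs c -> Pc c = 0) /\ RInt Pc (- A) A = 0 /\
  (forall c, Rabs c <= K -> Pc c = P0 c).
Proof.
intros HK.
(* [chi] equals 1 where [r^2 <= K^2] and 0 where [r^2 >= K^2 + 1]. The cubes make it C^2, as needed
   since [dPc] contains its second derivative. *)
set (q := fun r => r ^ 2 - K ^ 2).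
set (s := fun r => 1 - ppart (q r) ^ 3).
set (chi := fun r => ppart (s r) ^ 3).
set (ds := fun r => - (2 * r * (3 * ppart (q r) ^ 2))).
set (dchi := fun r => ds r * (3 * ppart (s r) ^ 2)).
set (dds := fun r => - (2 * (3 * ppart (q r) ^ 2) + 2 * r * (3 * (2 * r * (2 * ppart (q r)))))).
set (ddchi := fun r => dds r * (3 * ppart (s r) ^ 2) + ds r * (3 * (ds r * (2 * ppart (s r))))).
assert (Dq : forall r, is_derive q r (2 * r)).
{ intros r; eapply is_derive_eq; [apply der_minus; [apply der_pow2, der_id|apply der_const]|]. cbv beta; ring. }
assert (Ds : forall r, is_derive s r (ds r)).
{ intros r; eapply is_derive_eq.
  - apply der_minus; [apply der_const|]. apply (der_comp (fun x => ppart x ^ 3) q); [apply ppart3_der|apply Dq].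
  - unfold ds; cbv beta; ring. }
assert (Dchi : forall r, is_derive chi r (dchi r)).
{ intros r; apply (der_comp (fun x => ppart x ^ 3) s); [apply ppart3_der|apply Ds]. }
assert (Dds : forall r, is_derive ds r (dds r)).
{ intros r; eapply is_derive_eq.
  - apply der_opp, der_mult; [apply der_scal, der_id|apply der_scal].
    apply (der_comp (fun x => ppart x ^ 2) q); [apply ppart2_der|apply Dq].
  - unfold dds; cbv beta; ring. }
assert (Ddchi : forall r, is_derive dchi r (ddchi r)).
{ intros r; apply (der_mult ds (fun r => 3 * ppart (s r) ^ 2)); [apply Dds|].
  apply (der_scal (fun r => ppart (s r) ^ 2)).
  apply (der_comp (fun x => ppart x ^ 2) s); [apply ppart2_der|apply Ds]. }
assert (C1 := cont_ppart).
assert (Cq := cont_derive _ _ Dq); assert (Cs := cont_derive _ _ Ds); assert (Cds := cont_derive _ _ Dds).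
assert (Cchi := cont_derive _ _ Dchi); assert (Cdchi := cont_derive _ _ Ddchi).
assert (Cdds : cont dds) by (unfold dds; cont_tac).
assert (Cddchi : cont ddchi) by (unfold ddchi; cont_tac).
assert (C2 := cont_derive _ _ HV0); assert (C3 := cont_derive _ _ HdV0); assert (C4 := cont_derive _ _ HV1).
assert (Hout : forall c, K + 1 <= Rabs c -> chi c = 0 /\ dchi c = 0).
{ intros c Hc.
  assert (Hq : 1 <= q c) by (unfold q; rewrite <- (pow2_abs c); nra).
  assert (Hs : s c <= 0).
  { unfold s; assert (E : ppart (q c) = q c) by (unfold ppart; apply Rmax_right; lra).
    rewrite E; assert (1 <= q c ^ 3) by (apply pow_R1_Rle; auto). lra. }
  assert (E : ppart (s c) = 0) by (unfold ppart; apply Rmax_left; auto).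
  unfold chi, dchi; rewrite E; split; ring. }
assert (Hin : forall c, Rabs c <= K -> chi c = 1 /\ dchi c = 0).
{ intros c Hc.
  assert (P := Rabs_pos c).
  assert (Hq : q c <= 0) by (unfold q; rewrite <- (pow2_abs c); nra).
  assert (E : ppart (q c) = 0) by (unfold ppart; apply Rmax_left; auto).
  assert (Es : s c = 1) by (unfold s; rewrite E; ring).
  assert (E1 : ppart 1 = 1) by (unfold ppart; apply Rmax_right; lra).
  unfold chi, dchi, ds; rewrite Es, E1, E; split; ring. }
assert (Heven : forall c, chi (- c) = chi c).
{ intros c; unfold chi, s, q; replace ((- c) ^ 2) with (c ^ 2) by ring; auto. }
exists (fun c => (dchi c * V0 c + chi c * dV0 c) + chi c * V1 c),
  (fun c => (ddchi c * V0 c + dchi c * dV0 c + (dchi c * dV0 c + chi c * ddV0 c))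
    + (dchi c * V1 c + chi c * dV1 c)), (K + 1).
split; [|split; [|split; [|split; [|split]]]].
- intros c; apply (der_plus (fun c => dchi c * V0 c + chi c * dV0 c) (fun c => chi c * V1 c));
    [apply (der_plus (fun c => dchi c * V0 c) (fun c => chi c * dV0 c))|]; apply der_mult; auto.
- cont_tac.
- lra.
- intros c Hc; destruct (Hout c Hc) as [-> ->]; ring.
- rewrite RI_plus by cont_tac.
  rewrite (RI_derive (fun c => chi c * V0 c)).
  + rewrite RI_sym_split by cont_tac.
    rewrite RI_null by (intros; rewrite Heven, V1odd; ring).
    destruct (Hout (K + 1)) as [-> _]; [rewrite Rabs_pos_eq; lra|].
    destruct (Hout (- (K + 1))) as [-> _]; [rewrite Rabs_Ropp, Rabs_pos_eq; lra|]. real_eq; ring.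
  + intros x; apply der_mult; auto.
  + cont_tac.
- intros c Hc; destruct (Hin c Hc) as [-> ->]; unfold P0; ring.
Qed.

(** On the cone, [P] coincides with the solution of the same truncated equation for cut off data, to
    which the uniform bound applies. *)
Lemma solution_bound K : 0 <= K -> exists D, forall n P, 0 < n -> c2 P ->
  (forall t r, P t r = duhamel 0 P0 (Gtr n) P t r) ->
  forall t r, Rabs t + Rabs r <= K -> Rabs (P t r) <= D.
Proof.
intros HK.
destruct (cutoff_data K HK) as [Pc [dPc [A [H1 [H2 [H3 [H4 [H5 H6]]]]]]]].
destruct (uniform_apriori_bound Gam Pc dPc A K Gam_pos H1 H2 H3 H4 H5 HK) as [D1 HD1].
destruct (uniform_apriori_bound Gam (fun c => Pc (- c)) (fun c => - dPc (- c)) A K) as [D2 HD2]; auto.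
{ apply Gam_pos. }
{ intros c; eapply is_derive_eq; [apply (der_comp Pc Ropp); [apply H1|apply (der_opp (fun x => x)), der_id]|].
  ring. }
{ cont_tac. }
{ intros c Hc; apply H4; rewrite Rabs_Ropp; auto. }
{ assert (Cc := cont_derive _ _ H1).
  rewrite RI_sym_split in H5 |- * by cont_tac. etransitivity; [|exact H5]; apply RI_ext; intros; rewrite Ropp_involutive; real_eq; ring. }
exists (Rmax D1 D2); intros n P Hn HP HPE t r Htr.
assert (Cc := cont_derive _ _ H1).
destruct (trunc_solution n Pc Hn Cc) as [Q [HQ HQE]].
assert (E : P t r = Q t r).
{ apply (duhamel_unique 0 P0 Pc (Gtr n) P Q (K * dnonl n) K); auto.
  - apply c3_Gtr; auto.
  - apply lip_Gtr; auto.
  - intros c Hc; symmetry; auto. }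
rewrite E.
assert (Pt := Rabs_pos t); assert (Pr := Rabs_pos r).
destruct (Rle_dec 0 t) as [Ht|Ht].
- eapply Rle_trans; [|apply Rmax_l].
  apply (HD1 (trunc n) (dtrunc n) Q); auto; [apply trunc_admissible; auto|].
  rewrite Rabs_pos_eq in Htr by auto; lra.
- destruct (reflect_solution n Pc Q Hn HQ HQE) as [HQ' HQE'].
  eapply Rle_trans; [|apply Rmax_r].
  replace (Q t r) with (Q (- (- t)) (- (- r))) by (f_equal; ring).
  apply (HD2 (trunc n) (dtrunc n) (fun t r => Q (- t) (- r))); auto; [apply trunc_admissible; auto|].
  rewrite Rabs_left in Htr by lra; lra.
Qed.

(** From index [N K] on, the solutions on the cone of size [K] stay below their truncation level.
    They then solve the true equation there and coincide, so they can be glued over growing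
    cones. *)
Lemma global_solution : exists P, c2 P /\
  forall t r, P t r = duhamel 0 P0 (fun _ x y => - x * nonl y) P t r.
Proof.
assert (HP0 := cont_P0).
destruct (choice (fun (n : nat) P => c2 P /\ forall t r, P t r = duhamel 0 P0 (Gtr (INR n + 1)) P t r))
  as [Pn HPn].
{ intros n; apply trunc_solution; auto. assert (Q := pos_INR n); lra. }
(* The condition [0 <= K] comes after the choice of [N], so that [choice] yields a function of every
   real [K]. *)
assert (HN : forall K, exists N : nat, 0 <= K -> forall n, (N <= n)%nat ->
  forall t r, Rabs t + Rabs r <= K -> Rabs (Pn n t r) <= INR N).
{ intros K; destruct (Rle_dec 0 K) as [HK|HK]; [|exists O; intros; lra].
  destruct (solution_bound K HK) as [D HD].
  destruct (INR_unbounded D) as [N HN]; exists N; intros _ n Hn t r Htr.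
  destruct (HPn n) as [Q1 Q2]. left; eapply Rle_lt_trans; [|exact HN].
  apply (HD (INR n + 1) (Pn n)); auto. assert (Q := pos_INR n); lra. }
destruct (choice _ HN) as [N HNb]; clear HN.
assert (HU : forall K n, 0 <= K -> (N K <= n)%nat -> forall t r, Rabs t + Rabs r <= K ->
  Rabs (avg 0 (Pn n) t r) <= INR (N K) + 1).
{ intros K n HK Hn t r Htr; apply avg_bound; [apply HPn|].
  intros x Hx; assert (B := HNb K HK n Hn t (x * r) (cone_scal t r x K Hx Htr)); lra. }
assert (Htrue : forall K n m, 0 <= K -> (N K <= n)%nat -> (N K <= m)%nat -> forall t r, Rabs t + Rabs r <= K ->
  Pn n t r = duhamel 0 P0 (Gtr (INR m + 1)) (Pn n) t r /\
  Pn n t r = duhamel 0 P0 (fun _ x y => - x * nonl y) (Pn n) t r).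
{ intros K n m HK Hn Hm t r Htr; destruct (HPn n) as [_ E].
  assert (I1 := le_INR _ _ Hn); assert (I2 := le_INR _ _ Hm).
  split; rewrite E at 1; unfold duhamel; f_equal; apply RI_ext; intros s Hs; unfold Gtr;
    assert (Hc := cone_path t r s Hs); assert (B := HU K n HK Hn s (r + t - s) ltac:(lra));
    rewrite !trunc_eq by lra; reflexivity. }
assert (Heq : forall K n m, 0 <= K -> (N K <= n)%nat -> (N K <= m)%nat -> forall t r, Rabs t + Rabs r <= K ->
  Pn n t r = Pn m t r).
{ intros K n m HK Hn Hm t r Htr.
  assert (Q : 0 < INR m + 1) by (assert (Q := pos_INR m); lra).
  apply (duhamel_unique 0 P0 P0 (Gtr (INR m + 1)) (Pn n) (Pn m) (K * dnonl (INR m + 1)) K); auto.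
  - apply c3_Gtr; auto.
  - apply HPn.
  - apply HPn.
  - apply lip_Gtr; auto.
  - intros t' r' H'; apply (Htrue K n m); auto.
  - intros t' r' _; apply HPn. }
set (P := fun t r => Pn (N (Rabs t + Rabs r)) t r).
assert (Hloc : forall K t r, 0 <= K -> Rabs t + Rabs r <= K -> P t r = Pn (N K) t r).
{ intros K t r HK Htr; unfold P.
  assert (Pt := Rabs_pos t); assert (Pr := Rabs_pos r).
  set (m := Nat.max (N (Rabs t + Rabs r)) (N K)).
  transitivity (Pn m t r).
  - apply (Heq (Rabs t + Rabs r)); try lra; unfold m; lia.
  - apply (Heq K); try lra; unfold m; lia. }
exists P; split.
- intros [t0 r0].
  set (K := Rabs t0 + Rabs r0 + 2).
  assert (Pt := Rabs_pos t0); assert (Pr := Rabs_pos r0).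
  apply continuous_ext_loc with (fun z : R * R => Pn (N K) (fst z) (snd z)).
  + exists (mkposreal 1 Rlt_0_1); intros [t r] [Bt Br]; simpl in *.
    change (Rabs (t - t0) < 1) in Bt; change (Rabs (r - r0) < 1) in Br.
    symmetry; apply Hloc; unfold K; [lra|].
    assert (Rabs t <= Rabs t0 + Rabs (t - t0)).
    { replace t with (t0 + (t - t0)) at 1 by ring; apply Rabs_triang. }
    assert (Rabs r <= Rabs r0 + Rabs (r - r0)).
    { replace r with (r0 + (r - r0)) at 1 by ring; apply Rabs_triang. }
    lra.
  + apply HPn.
- intros t r; set (K := Rabs t + Rabs r).
  assert (Pt := Rabs_pos t); assert (Pr := Rabs_pos r).
  assert (HK : 0 <= K) by (unfold K; lra).
  rewrite (Hloc K t r HK (Rle_refl _)).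
  destruct (Htrue K (N K) (N K) HK (le_n _) (le_n _) t r (Rle_refl _)) as [_ E].
  rewrite E; unfold duhamel; f_equal; apply RI_ext; intros s Hs.
  assert (Hc := cone_path t r s Hs). do 2 f_equal.
  unfold avg; f_equal; apply RI_ext; intros x Hx.
  rewrite Rmin_left, Rmax_right in Hx by lra.
  f_equal; symmetry; apply Hloc; auto. apply cone_scal; auto; unfold K; lra.
Qed.

End Data.

(** * Smoothness in time and radius *)

(** Derivatives are existential witnesses, so that closure under operations is proved by exhibiting
    formulas. *)
Fixpoint Ck1 (k : nat) (f : R -> R) : Prop :=
  cont f /\ match k with
  | O => True
  | S k' => exists f' : R -> R, (forall x, is_derive f x (f' x)) /\ Ck1 k' f'
  end.

Fixpoint Ck2 (k : nat) (f : R -> R -> R) : Prop :=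
  c2 f /\ match k with
  | O => True
  | S k' => exists ft fr : R -> R -> R, (forall t r, is_derive (fun t => f t r) t (ft t r)) /\
      (forall t r, is_derive (f t) r (fr t r)) /\ Ck2 k' ft /\ Ck2 k' fr
  end.

Lemma Ck1_cont k f : Ck1 k f -> cont f.
Proof. destruct k; intros [H _]; exact H. Qed.

Lemma Ck2_c2 k f : Ck2 k f -> c2 f.
Proof. destruct k; intros [H _]; exact H. Qed.

Lemma Ck1_pred k f : Ck1 (S k) f -> Ck1 k f.
Proof.
revert f; induction k as [|k IH]; intros f [Hc [f' [H1 H2]]]; split; auto.
exists f'; auto.
Qed.

Lemma Ck2_pred k f : Ck2 (S k) f -> Ck2 k f.
Proof.
revert f; induction k as [|k IH]; intros f [Hc [ft [fr [H1 [H2 [H3 H4]]]]]]; split; auto.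
exists ft, fr; auto.
Qed.

Lemma Ck1_const k c : Ck1 k (fun _ => c).
Proof.
revert c; induction k as [|k IH]; intros c; (split; [cont_tac|]); auto.
exists (fun _ => 0); split; auto. intros; apply der_const.
Qed.

Lemma Ck1_id k : Ck1 k (fun x => x).
Proof.
destruct k; (split; [cont_tac|]); auto. exists (fun _ => 1); split; [intros; apply der_id|apply Ck1_const].
Qed.

Lemma Ck1_plus k f g : Ck1 k f -> Ck1 k g -> Ck1 k (fun x => f x + g x).
Proof.
revert f g; induction k as [|k IH]; intros f g [Hf Hf'] [Hg Hg']; (split; [cont_tac|]); auto.
destruct Hf' as [f' [F1 F2]], Hg' as [g' [G1 G2]].
exists (fun x => f' x + g' x); split; auto. intros; apply der_plus; auto.
Qed.

Lemma Ck1_mult k f g : Ck1 k f -> Ck1 k g -> Ck1 k (fun x => f x * g x).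
Proof.
revert f g; induction k as [|k IH]; intros f g Hf Hg.
- destruct Hf as [Hf _], Hg as [Hg _]; split; auto; cont_tac.
- assert (Pf := Ck1_pred _ _ Hf); assert (Pg := Ck1_pred _ _ Hg).
  destruct Hf as [Hf [f' [F1 F2]]], Hg as [Hg [g' [G1 G2]]]; split; [cont_tac|].
  exists (fun x => f' x * g x + f x * g' x); split; [intros; apply der_mult; auto|].
  apply Ck1_plus; auto.
Qed.

Lemma Ck2_const k c : Ck2 k (fun _ _ => c).
Proof.
revert c; induction k as [|k IH]; intros c; (split; [cont_tac|]); auto.
exists (fun _ _ => 0), (fun _ _ => 0).
split; [intros; apply der_const|split; [intros; apply der_const|auto]].
Qed.

Lemma Ck2_snd k : Ck2 k (fun _ r => r).
Proof.
destruct k; (split; [cont_tac|]); auto. exists (fun _ _ => 0), (fun _ _ => 1).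
split; [intros; apply der_const|split; [intros; apply der_id|split; apply Ck2_const]].
Qed.

Lemma Ck2_plus k f g : Ck2 k f -> Ck2 k g -> Ck2 k (fun t r => f t r + g t r).
Proof.
revert f g; induction k as [|k IH]; intros f g [Hf Hf'] [Hg Hg']; (split; [cont_tac|]); auto.
destruct Hf' as [ft [fr [F1 [F2 [F3 F4]]]]], Hg' as [gt [gr [G1 [G2 [G3 G4]]]]].
exists (fun t r => ft t r + gt t r), (fun t r => fr t r + gr t r).
split; [intros; apply (der_plus (fun t => f t r) (fun t => g t r)); auto|].
split; [intros; apply (der_plus (f t) (g t)); auto|auto].
Qed.

Lemma Ck2_mult k f g : Ck2 k f -> Ck2 k g -> Ck2 k (fun t r => f t r * g t r).
Proof.
revert f g; induction k as [|k IH]; intros f g Hf Hg.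
- destruct Hf as [Hf _], Hg as [Hg _]; split; auto; cont_tac.
- assert (Pf := Ck2_pred _ _ Hf); assert (Pg := Ck2_pred _ _ Hg).
  destruct Hf as [Hf [ft [fr [F1 [F2 [F3 F4]]]]]], Hg as [Hg [gt [gr [G1 [G2 [G3 G4]]]]]]; split; [cont_tac|].
  exists (fun t r => ft t r * g t r + f t r * gt t r), (fun t r => fr t r * g t r + f t r * gr t r).
  split; [intros; apply (der_mult (fun t => f t r) (fun t => g t r)); auto|].
  split; [intros; apply (der_mult (f t) (g t)); auto|].
  split; apply Ck2_plus; auto.
Qed.

Lemma Ck2_opp k f : Ck2 k f -> Ck2 k (fun t r => - f t r).
Proof.
intros Hf; replace (fun t r => - f t r) with (fun t r => (fun _ _ => -1) t r * f t r).
- apply Ck2_mult; auto; apply Ck2_const.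
- extensionality t; extensionality r; ring.
Qed.

Lemma Ck2_comp k g f : Ck1 k g -> Ck2 k f -> Ck2 k (fun t r => g (f t r)).
Proof.
revert g f; induction k as [|k IH]; intros g f Hg Hf.
- destruct Hf as [Hf _], Hg as [Hg _]; split; auto; cont_tac.
- assert (Pf := Ck2_pred _ _ Hf).
  destruct Hf as [Hf [ft [fr [F1 [F2 [F3 F4]]]]]], Hg as [Hg [g' [G1 G2]]]; split; [cont_tac|].
  exists (fun t r => ft t r * g' (f t r)), (fun t r => fr t r * g' (f t r)).
  split; [intros; apply (der_comp g (fun t => f t r)); auto|].
  split; [intros; apply (der_comp g (f t)); auto|].
  split; apply Ck2_mult; auto.
Qed.

Lemma Ck2_avg k j f : Ck2 k f -> Ck2 k (avg j f).
Proof.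
revert j f; induction k as [|k IH]; intros j f [Hf Hf']; (split; [apply c2_avg; auto|]); auto.
destruct Hf' as [ft [fr [F1 [F2 [F3 F4]]]]].
exists (avg j ft), (avg (S j) fr).
split; [intros; apply avg_der_t; auto; apply (Ck2_c2 k); auto|].
split; [intros; apply avg_der_r; auto; apply (Ck2_c2 k); auto|auto].
Qed.

(** The derivative in [r] solves an equation with the same coefficient [a], the weight exponent
    raised by one and a new inhomogeneous term containing [avg j Z]. Hence the induction is over all
    [j], [b] and [z]. *)
Lemma duhamel_linear_regular k j a b z Z : Ck2 k a -> Ck2 k b -> Ck1 k z -> c2 Z ->
  (forall t r, Z t r = duhamel j z (fun s x y => b s x + a s x * y) Z t r) -> Ck2 k Z.
Proof.
revert j a b z Z; induction k as [|k IH]; intros j a b z Z Ha Hb Hz HZ HZE; [split; auto|].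
assert (Pa := Ck2_pred _ _ Ha); assert (Pb := Ck2_pred _ _ Hb); assert (Pz := Ck1_pred _ _ Hz).
assert (PZ := IH j a b z Z Pa Pb Pz HZ HZE).
destruct Ha as [Ca [at_ [ar [A1 [A2 [A3 A4]]]]]], Hb as [Cb [bt [br [B1 [B2 [B3 B4]]]]]], Hz as [Cz [z' [Z1 Z2]]].
assert (Car := Ck2_c2 _ _ A4); assert (Cbr := Ck2_c2 _ _ B4).
destruct (duhamel_C1 j z z' (fun s x y => b s x + a s x * y) (fun s x y => br s x + ar s x * y)
  (fun s x _ => a s x) Z) as [Y [HY [Hr [Ht HYE]]]]; auto; try cont_tac.
- apply (Ck1_cont k); auto.
- intros s x y; eapply is_derive_eq.
  + apply (der_plus (b s) (fun x => a s x * y)); [apply B2|apply (der_mult (a s) (fun _ => y)); [apply A2|apply der_const]].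
  + ring.
- intros s x y; eapply is_derive_eq.
  + apply (der_plus (fun _ => b s x) (fun y => a s x * y)); [apply der_const|apply der_scal, der_id].
  + ring.
- assert (PA := Ck2_avg k j Z PZ).
  assert (PY : Ck2 k Y).
  { apply (IH (S j) a (fun s x => br s x + ar s x * avg j Z s x) z' Y); auto.
    apply Ck2_plus; auto; apply Ck2_mult; auto. }
  split; auto.
  exists (fun t r => Y t r + (b t r + a t r * avg j Z t r)), Y.
  split; [exact Ht|split; [exact Hr|split; auto]].
  apply Ck2_plus; auto; apply Ck2_plus; auto; apply Ck2_mult; auto.
Qed.

Lemma Ck1_inv k : Ck1 k (fun y => / (2 + y ^ 2)).
Proof.
induction k as [|k IH]; (split; [apply cont_inv2|]); auto.
exists (fun y => -2 * y * (/ (2 + y ^ 2) * / (2 + y ^ 2))); split.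
- intros x; eapply is_derive_eq; [apply inv_der|]. ring.
- apply Ck1_mult; [apply Ck1_mult; [apply Ck1_const|apply Ck1_id]|apply Ck1_mult; auto].
Qed.

Lemma Ck1_pow k n : Ck1 k (fun y => y ^ n).
Proof.
induction n as [|n IH]; simpl; [apply Ck1_const|apply Ck1_mult; auto; apply Ck1_id].
Qed.

Lemma Ck1_logt k : Ck1 k logt.
Proof.
destruct k; (split; [apply cont_logt|]); auto.
exists (fun y => 2 * y * / (2 + y ^ 2)); split; [apply logt_der|].
apply Ck1_mult; [apply Ck1_mult; [apply Ck1_const|apply Ck1_id]|apply Ck1_inv].
Qed.

Lemma Ck1_nonl k : Ck1 k nonl.
Proof. apply Ck1_mult; [apply Ck1_pow|apply Ck1_logt]. Qed.

Lemma Ck1_dnonl k : Ck1 k dnonl.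
Proof.
apply Ck1_plus; apply Ck1_mult; try apply Ck1_logt; try apply Ck1_inv;
  apply Ck1_mult; try apply Ck1_const; apply Ck1_pow.
Qed.

(** Regularity alternates: [P] of class C^k makes the coefficients of the linear equation for [Y] of
    class C^k, hence [Y] too, and then [P] is of class C^(k+1). *)
Lemma duhamel_nonl_regular P0 dP0 P : (forall x, is_derive P0 x (dP0 x)) -> (forall k, Ck1 k dP0) -> c2 P ->
  (forall t r, P t r = duhamel 0 P0 (fun _ x y => - x * nonl y) P t r) ->
  exists Y, (forall t r, is_derive (P t) r (Y t r)) /\
    (forall t r, is_derive (fun t => P t r) t (Y t r - r * nonl (avg 0 P t r))) /\
    (forall k, Ck2 k P) /\ (forall k, Ck2 k Y).
Proof.
intros H0 HdP0 HP HPE.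
assert (Cf := cont_derive _ _ nonl_der); assert (Cdf := cont_dnonl).
destruct (duhamel_C1 0 P0 dP0 (fun _ x y => - x * nonl y) (fun _ x y => - nonl y) (fun _ x y => - x * dnonl y) P)
  as [Y [HY [HPr [HPt HYE]]]]; auto; try cont_tac.
{ apply (Ck1_cont 0), HdP0. }
{ intros s x y; eapply is_derive_eq.
  - apply (der_mult Ropp (fun _ => nonl y)); [apply (der_opp (fun x => x)), der_id|apply der_const].
  - ring. }
{ intros s x y; apply (der_scal nonl), nonl_der. }
assert (HYk : forall k, Ck2 k P -> Ck2 k Y).
{ intros k Pk; assert (PA := Ck2_avg k 0 P Pk).
  apply (duhamel_linear_regular k 1 (fun s x => - x * dnonl (avg 0 P s x)) (fun s x => - nonl (avg 0 P s x)) dP0 Y); auto.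
  - apply Ck2_mult; [apply Ck2_opp, Ck2_snd|apply Ck2_comp; auto; apply Ck1_dnonl].
  - apply Ck2_opp, Ck2_comp; auto; apply Ck1_nonl. }
assert (HPk : forall k, Ck2 k P).
{ induction k as [|k Pk]; [split; auto|].
  assert (PA := Ck2_avg k 0 P Pk); assert (Yk := HYk k Pk).
  split; auto; exists (fun t r => Y t r + - r * nonl (avg 0 P t r)), Y.
  split; [exact HPt|split; [exact HPr|split; auto]].
  apply Ck2_plus; auto; apply Ck2_mult; [apply Ck2_opp, Ck2_snd|apply Ck2_comp; auto; apply Ck1_nonl]. }
exists Y; split; auto; split; [|split; auto].
intros t r; eapply is_derive_eq; [apply HPt|]. cbv beta; ring.
Qed.

Definition smooth2 (f : R -> R -> R) := forall k, Ck2 k f.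

Lemma smooth2_der f : smooth2 f -> exists ft fr : R -> R -> R,
  (forall t r, is_derive (fun t => f t r) t (ft t r)) /\ (forall t r, is_derive (f t) r (fr t r)) /\
  smooth2 ft /\ smooth2 fr.
Proof.
intros Hf; destruct (Hf 1%nat) as [_ [ft [fr [H1 [H2 _]]]]].
exists ft, fr; split; auto; split; auto.
assert (H : forall k, Ck2 k ft /\ Ck2 k fr).
{ intros k; destruct (Hf (S k)) as [_ [ft' [fr' [H1' [H2' [H3' H4']]]]]].
  replace ft with ft'; [replace fr with fr'; auto|]; extensionality t; extensionality r.
  - rewrite <- (is_derive_unique _ _ _ (H2' t r)); apply (is_derive_unique _ _ _ (H2 t r)).
  - rewrite <- (is_derive_unique _ _ _ (H1' t r)); apply (is_derive_unique _ _ _ (H1 t r)). }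
split; intros k; apply H.
Qed.

(** * Radial functions on space *)

(** Smoothness by closure: it suffices to find a class of continuous functions stable under the
    partial derivatives, and no derivative needs to be computed explicitly. *)
Lemma Ck_of_class {V : NormedModule R_AbsRing} (B : list V) (S : (V -> R) -> Prop) :
  (forall f, S f -> forall p, continuous f p) ->
  (forall f, S f -> forall e, In e B -> exists f', S f' /\
     forall p, is_derive (fun h : R => f (plus p (scal h e))) 0 (f' p)) ->
  forall k f, S f -> Ck B k f.
Proof.
intros Hc Hd; induction k as [|k IH]; intros f Hf; simpl; (split; [apply Hc; auto|]); auto.
intros e He; destruct (Hd f Hf e He) as [f' [Hf' H]]; split.
- intros p; exists (f' p); apply H.
- replace (partial e f) with f'; [apply IH; auto|].
  extensionality p; symmetry; apply is_derive_unique, H.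
Qed.

(** The factor [r] in [g' = r b] cancels the [1 / r] in the gradient of the norm. At the origin the
    square root reduces to [Rabs h], which evenness removes. *)
Lemma radial_chain (g b : R -> R) a c : (forall r, is_derive g r (r * b r)) -> (forall r, g (- r) = g r) ->
  0 <= c -> is_derive (fun h => g (sqrt ((a + h) ^ 2 + c))) 0 (a * b (sqrt (a ^ 2 + c))).
Proof.
intros Hg He Hc.
assert (Ha : 0 <= a ^ 2) by apply pow2_ge_0.
destruct (Req_dec (a ^ 2 + c) 0) as [Z|N].
- assert (c = 0) by lra; assert (a = 0) by nra; subst a c.
  apply is_derive_ext with g.
  + intros h; replace ((0 + h) ^ 2 + 0) with (Rsqr h) by (unfold Rsqr; ring).
    rewrite sqrt_Rsqr_abs; unfold Rabs; destruct Rcase_abs; auto.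
  + eapply is_derive_eq; [apply Hg|ring].
- assert (Hp : 0 < a ^ 2 + c) by lra.
  assert (Hs := sqrt_lt_R0 _ Hp).
  eapply is_derive_eq.
  + apply (der_comp g (fun h => sqrt ((a + h) ^ 2 + c))); [apply Hg|].
    apply (der_comp sqrt (fun h => (a + h) ^ 2 + c)).
    * apply is_derive_Reals, derivable_pt_lim_sqrt. rewrite Rplus_0_r; auto.
    * apply der_plus; [apply (der_pow2 (fun h => a + h)), der_plus; [apply der_const|apply der_id]|apply der_const].
  + rewrite !Rplus_0_r; field; lra.
Qed.

Definition X1 (x : R3) : R := fst (fst x).
Definition X2 (x : R3) : R := snd (fst x).
Definition X3 (x : R3) : R := snd x.

Lemma norm3_X x : norm3 x = sqrt (X1 x ^ 2 + X2 x ^ 2 + X3 x ^ 2).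
Proof. destruct x as [[x1 x2] x3]; reflexivity. Qed.

Lemma plus_scal3 (x e : R3) (h : R) : plus x (scal h e)
  = ((X1 x + h * X1 e, X2 x + h * X2 e), X3 x + h * X3 e).
Proof. destruct x as [[x1 x2] x3], e as [[e1 e2] e3]; reflexivity. Qed.

Lemma norm3_nonneg x : 0 <= norm3 x.
Proof. rewrite norm3_X; apply sqrt_pos. Qed.

Lemma basis3_ind (P : R3 -> Prop) : P (1, 0, 0) -> P (0, 1, 0) -> P (0, 0, 1) ->
  forall e, In e basis3 -> P e.
Proof. intros H1 H2 H3 e [<-|[<-|[<-|[]]]]; auto. Qed.

Definition dot (e x : R3) := X1 e * X1 x + X2 e * X2 x + X3 e * X3 x.

Lemma radial_partial (g b : R -> R) : (forall r, is_derive g r (r * b r)) -> (forall r, g (- r) = g r) ->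
  forall e, In e basis3 -> forall x : R3,
  is_derive (fun h : R => g (norm3 (plus x (scal h e)))) 0 (dot e x * b (norm3 x)).
Proof.
intros Hg He.
assert (K : forall e x a c, 0 <= c -> dot e x = a ->
  (forall h, X1 (plus x (scal h e)) ^ 2 + X2 (plus x (scal h e)) ^ 2 + X3 (plus x (scal h e)) ^ 2 = (a + h) ^ 2 + c) ->
  is_derive (fun h : R => g (norm3 (plus x (scal h e)))) 0 (dot e x * b (norm3 x))).
{ intros e x a c Hc Ha H.
  apply is_derive_ext with (fun h => g (sqrt ((a + h) ^ 2 + c))).
  - intros h; rewrite norm3_X, H; reflexivity.
  - rewrite Ha; replace (norm3 x) with (sqrt (a ^ 2 + c)); [apply radial_chain; auto|].
    rewrite norm3_X; f_equal; specialize (H 0); revert H; rewrite plus_scal3; unfold X1, X2, X3; simpl.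
    rewrite !Rmult_0_l, !Rplus_0_r; auto. }
apply (basis3_ind (fun e => forall x : R3,
  is_derive (fun h : R => g (norm3 (plus x (scal h e)))) 0 (dot e x * b (norm3 x)))); intros x.
- apply (K _ x (X1 x) (X2 x ^ 2 + X3 x ^ 2)).
  + sq (X2 x); sq (X3 x); lra.
  + unfold dot, X1, X2, X3; simpl; ring.
  + intros h; rewrite plus_scal3; unfold X1, X2, X3; simpl; ring.
- apply (K _ x (X2 x) (X1 x ^ 2 + X3 x ^ 2)).
  + sq (X1 x); sq (X3 x); lra.
  + unfold dot, X1, X2, X3; simpl; ring.
  + intros h; rewrite plus_scal3; unfold X1, X2, X3; simpl; ring.
- apply (K _ x (X3 x) (X1 x ^ 2 + X2 x ^ 2)).
  + sq (X1 x); sq (X2 x); lra.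
  + unfold dot, X1, X2, X3; simpl; ring.
  + intros h; rewrite plus_scal3; unfold X1, X2, X3; simpl; ring.
Qed.

Lemma dot_partial e i x : is_derive (fun h : R => dot e (plus x (scal h i))) 0 (dot e i).
Proof.
apply is_derive_ext with (fun h => dot e x + h * dot e i).
- intros h; rewrite plus_scal3; unfold dot, X1, X2, X3; simpl; ring.
- eapply is_derive_eq; [apply der_plus; [apply der_const|apply der_mult; [apply der_id|apply der_const]]|].
  cbv beta; ring.
Qed.

Definition even2 (g : R -> R -> R) := forall t r, g t (- r) = g t r.

Lemma even_der (f f' : R -> R) : (forall r, is_derive f r (f' r)) -> (forall r, f (- r) = f r) ->
  forall r, f' (- r) = - f' r.
Proof.
intros H He r.
assert (E : is_derive f r (-1 * f' (- r))).
{ apply is_derive_ext with (fun r => f (- r)); auto.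
  apply (der_comp f Ropp); [apply H|]. eapply is_derive_eq; [apply (der_opp (fun x => x)), der_id|ring]. }
assert (E1 := is_derive_unique _ _ _ E); rewrite (is_derive_unique _ _ _ (H r)) in E1; lra.
Qed.

(* [b] is twice the derivative of [g t] with respect to [r ^ 2]. *)
Lemma even_quotient g : smooth2 g -> even2 g ->
  exists b, smooth2 b /\ even2 b /\ forall t r, is_derive (g t) r (r * b t r).
Proof.
intros Hg He.
destruct (smooth2_der g Hg) as [_ [gr [_ [H2 [_ H4]]]]].
destruct (smooth2_der gr H4) as [_ [grr [_ [H6 [_ H8]]]]].
assert (C8 := Ck2_c2 _ _ (H8 O)).
exists (avg 0 grr); split; [intros k; apply Ck2_avg; auto|].
split; [intros t r; apply avg0_even; auto|].
intros t r; eapply is_derive_eq; [apply H2|].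
rewrite avg0_mult by auto.
rewrite (RI_derive (gr t) (grr t)); [|apply H6|apply (cont_curry grr t C8)].
rewrite (even_der (g t) (gr t)) by auto. field.
Qed.

Lemma even_der_t g gt : (forall t r, is_derive (fun t => g t r) t (gt t r)) -> even2 g -> even2 gt.
Proof.
intros H He t r.
rewrite <- (is_derive_unique _ _ _ (H t r)), <- (is_derive_unique _ _ _ (H t (- r))).
apply Derive_ext; intros; apply He.
Qed.

(** Differentiating an even radial function produces a linear form times another even radial
    function; the class is the algebra these generate, hence stable under all partial
    derivatives. *)
Inductive radial_class : (R * R3 -> R) -> Prop :=
| rc_rad g : smooth2 g -> even2 g -> radial_class (fun p => g (fst p) (norm3 (snd p)))
| rc_dot e : radial_class (fun p => dot e (snd p))
| rc_const c : radial_class (fun _ => c)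
| rc_plus f g : radial_class f -> radial_class g -> radial_class (fun p => f p + g p)
| rc_mult f g : radial_class f -> radial_class g -> radial_class (fun p => f p * g p).

Lemma cont_sqrt : cont sqrt.
Proof. intros x; apply continuous_sqrt. Qed.

Lemma cont_norm3 : cont norm3.
Proof.
assert (Q := cont_sqrt).
replace norm3 with (fun x : R3 => sqrt (fst (fst x) ^ 2 + snd (fst x) ^ 2 + snd x ^ 2)).
- cont_tac.
- extensionality x; symmetry; apply norm3_X.
Qed.

Lemma radial_class_cont f : radial_class f -> cont f.
Proof.
assert (Q := cont_norm3).
induction 1 as [g Hg He|e|c|f g _ IHf _ IHg|f g _ IHf _ IHg].
- assert (Cg := Ck2_c2 _ _ (Hg O)).
  apply (cont_comp2 g (fun p => fst p) (fun p => norm3 (snd p))); auto; [cont_tac|].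
  apply (cont_comp (fun p : R * R3 => snd p) norm3); auto. cont_tac.
- unfold dot; generalize (X1 e) (X2 e) (X3 e); intros a b c; unfold X1, X2, X3; cont_tac.
- cont_tac.
- apply (cont_plus f g); auto.
- apply (cont_mult f g); auto.
Qed.

Lemma plus_scal4 (t : R) (x : R3) (h a : R) (e : R3) :
  plus ((t, x) : R * R3) (scal h ((a, e) : R * R3)) = (t + h * a, plus x (scal h e)).
Proof. reflexivity. Qed.

Lemma plus_scal3_zero (x : R3) (h : R) : plus x (scal h ((0, 0, 0) : R3)) = x.
Proof. rewrite plus_scal3; destruct x as [[x1 x2] x3]; unfold X1, X2, X3; simpl; repeat f_equal; ring. Qed.

Lemma radial_class_der f : radial_class f -> forall e, In e basis4 ->
  exists f', radial_class f' /\ forall p : R * R3, is_derive (fun h : R => f (plus p (scal h e))) 0 (f' p).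
Proof.
intros Hf e He.
induction Hf as [g Hg Hev|i|c|f g Hf IHf Hg IHg|f g Hf IHf Hg IHg].
- destruct He as [<-|He].
  + destruct (smooth2_der g Hg) as [gt [gr [H1 [_ [H3 _]]]]].
    exists (fun p => gt (fst p) (norm3 (snd p))); split; [apply rc_rad; auto; apply (even_der_t g); auto|].
    intros [t x]; apply is_derive_ext with (fun h => g (t + h) (norm3 x)).
    * intros h; rewrite plus_scal4, plus_scal3_zero; simpl; rewrite Rmult_1_r; auto.
    * eapply is_derive_eq.
      -- apply (der_comp (fun s => g s (norm3 x)) (fun h => t + h)); [apply H1|apply der_plus; [apply der_const|apply der_id]].
      -- simpl; rewrite Rplus_0_r; ring.
  + apply in_map_iff in He; destruct He as [e3 [<- He]].
    destruct (even_quotient g Hg Hev) as [b [Hb [Hbe Hd]]].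
    exists (fun p => dot e3 (snd p) * b (fst p) (norm3 (snd p))); split.
    * apply (rc_mult (fun p => dot e3 (snd p)) (fun p => b (fst p) (norm3 (snd p)))); [apply rc_dot|apply rc_rad; auto].
    * intros [t x]; apply is_derive_ext with (fun h : R => g t (norm3 (plus x (scal h e3)))).
      -- intros h; rewrite plus_scal4; simpl; rewrite Rmult_0_r, Rplus_0_r; auto.
      -- apply (radial_partial (g t) (b t)); auto.
- destruct e as [a e3]; exists (fun _ => dot i e3); split; [apply rc_const|].
  intros [t x]; apply (dot_partial i e3 x).
- exists (fun _ => 0); split; [apply rc_const|]. intros; apply der_const.
- destruct IHf as [f' [F1 F2]], IHg as [g' [G1 G2]].
  exists (fun p => f' p + g' p); split; [apply rc_plus; auto|].
  intros p; apply (der_plus (fun h : R => f (plus p (scal h e))) (fun h : R => g (plus p (scal h e)))); auto.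
- destruct IHf as [f' [F1 F2]], IHg as [g' [G1 G2]].
  exists (fun p => f' p * g p + f p * g' p); split; [apply rc_plus; apply rc_mult; auto|].
  intros p; eapply is_derive_eq.
  + apply (der_mult (fun h : R => f (plus p (scal h e))) (fun h : R => g (plus p (scal h e)))); auto.
  + assert (Z : plus p (scal (0 : R) e) = p).
    { rewrite (scal_zero_l (K := R_AbsRing)); apply plus_zero_r. }
    cbv beta; rewrite Z; reflexivity.
Qed.

Lemma radial_class_smooth f : radial_class f -> smooth4 f.
Proof.
intros Hf k; apply (Ck_of_class basis4 radial_class); auto.
- intros g Hg; apply radial_class_cont; auto.
- intros g Hg e He; apply radial_class_der; auto.
Qed.

(** * Existence *)

Lemma axis_regular k (u : R3 -> R) : Ck basis3 k u -> Ck1 k (fun r => u (r, 0, 0)).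
Proof.
assert (Hax : cont (fun r : R => ((r, 0, 0) : R3))) by cont_tac.
revert u; induction k as [|k IH]; intros u [Hc Hd]; (split; [apply (cont_comp _ u Hax); exact Hc|]); auto.
destruct (Hd (1, 0, 0)) as [He Hk]; [left; auto|].
exists (fun r => partial (1, 0, 0) u (r, 0, 0)); split; [|apply IH; auto].
intros r; destruct (He (r, 0, 0)) as [l Hl].
assert (E : partial ((1, 0, 0) : R3) u (r, 0, 0) = l) by (apply is_derive_unique, Hl).
apply is_derive_ext with (fun x => (fun h : R => u (plus (r, 0, 0) (scal h ((1, 0, 0) : R3)))) (x - r)).
- intros x; cbv beta; rewrite plus_scal3; unfold X1, X2, X3; simpl; f_equal; repeat f_equal; ring.
- eapply is_derive_eq.
  + apply (der_comp (fun h : R => u (plus (r, 0, 0) (scal h ((1, 0, 0) : R3)))) (fun x => x - r)).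
    * rewrite Rminus_diag; exact Hl.
    * apply der_minus; [apply der_id|apply der_const].
  + transitivity l; [ring|symmetry; exact E].
Qed.

Lemma smooth1_der f : (forall k, Ck1 k f) -> exists f' : R -> R, (forall x, is_derive f x (f' x)) /\ forall k, Ck1 k f'.
Proof.
intros Hf; destruct (Hf 1%nat) as [_ [f' [H1 _]]]; exists f'; split; auto.
intros k; destruct (Hf (S k)) as [_ [g [G1 G2]]].
replace f' with g; auto.
extensionality x; rewrite <- (is_derive_unique _ _ _ (G1 x)); apply (is_derive_unique _ _ _ (H1 x)).
Qed.

(** Allows division by [r], including at [r = 0], of the identities known for [v = r u]. *)
Lemma cont_zero_at_0 f : cont f -> (forall r, r * f r = 0) -> forall r, f r = 0.
Proof.
intros Hf H r.
assert (Hn : forall r, r <> 0 -> f r = 0).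
{ intros s Hs; destruct (Rmult_integral _ _ (H s)); auto; contradiction. }
destruct (Req_dec r 0) as [->|N]; auto.
destruct (Req_dec (f 0) 0) as [|N]; auto; exfalso.
destruct (Hf 0 (ball (f 0) (mkposreal _ (Rabs_pos_lt _ N))) (locally_ball _ _)) as [[d Hd0] Hd].
assert (B : ball (f 0) (Rabs (f 0)) (f (d / 2))).
{ apply Hd; change (Rabs (d / 2 - 0) < d); rewrite Rminus_0_r, Rabs_pos_eq; lra. }
change (Rabs (f (d / 2) - f 0) < Rabs (f 0)) in B.
rewrite Hn, Rminus_0_l, Rabs_Ropp in B; lra.
Qed.

Section RadialWave.

Variables (P Y : R -> R -> R).
Let U := avg 0 P.
Let p t r := Y t r - r * nonl (U t r).
Hypotheses (HP : smooth2 P) (HY : smooth2 Y) (HPr : forall t r, is_derive (P t) r (Y t r))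
  (HPt : forall t r, is_derive (fun t => P t r) t (p t r)).

Lemma U_smooth : smooth2 U. Proof. intros k; apply Ck2_avg, HP. Qed.

Lemma U_even : even2 U. Proof. intros t r; apply avg0_even, (Ck2_c2 _ _ (HP O)). Qed.

Lemma r_mul_dt_avg t r : r * avg 0 p t r = (P t r - P t (- r)) / 2.
Proof.
apply (r_mul_U_der_t nonl dnonl P Y); auto using nonl_der, (Ck2_c2 _ _ (HP O)), (Ck2_c2 _ _ (HY O)).
Qed.

Lemma r_mul_dr_avg t r : r * avg 1 Y t r + U t r = (P t r + P t (- r)) / 2.
Proof.
apply (r_mul_U_der_r P Y); auto using nonl_der, (Ck2_c2 _ _ (HP O)), (Ck2_c2 _ _ (HY O)).
Qed.

(** Here [B = U_r / r] and [BB = B_r / r], so [3 B + r^2 BB] is the Laplacian of a radial function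
    written without singular quotients. The identities for [v_tt] and [v_rr] give the equation
    multiplied by [r]. *)
Lemma radial_equation : exists Ut Utt B BB : R -> R -> R,
  smooth2 B /\ even2 B /\
  (forall t r, is_derive (fun t => U t r) t (Ut t r)) /\
  (forall t r, is_derive (fun t => Ut t r) t (Utt t r)) /\
  (forall t r, is_derive (U t) r (r * B t r)) /\
  (forall t r, is_derive (B t) r (r * BB t r)) /\
  (forall t r, r * Ut t r = (P t r - P t (- r)) / 2) /\
  (forall t r, - Utt t r + (3 * B t r + r ^ 2 * BB t r) = nonl (U t r)).
Proof.
assert (HU := U_smooth); assert (HUe := U_even).
destruct (smooth2_der U HU) as [Ut [Ur [T1 [_ [T2 _]]]]].
destruct (smooth2_der Ut T2) as [Utt [_ [T3 [_ [T4 _]]]]].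
destruct (even_quotient U HU HUe) as [B [HB [HBe HBd]]].
destruct (even_quotient B HB HBe) as [BB [HBB [_ HBBd]]].
assert (CP := Ck2_c2 _ _ (HP O)); assert (CY := Ck2_c2 _ _ (HY O)).
assert (CU := Ck2_c2 _ _ (HU O)); assert (Cf := cont_derive _ _ nonl_der).
assert (Cp : c2 p) by (unfold p; cont_tac).
assert (EUt : forall t r, avg 0 p t r = Ut t r).
{ intros t r; rewrite <- (is_derive_unique _ _ _ (T1 t r)); symmetry; apply is_derive_unique.
  apply avg_der_t; auto. }
assert (EUr : forall t r, avg 1 Y t r = r * B t r).
{ intros t r; rewrite <- (is_derive_unique _ _ _ (HBd t r)); symmetry; apply is_derive_unique.
  apply avg_der_r; auto. }
assert (R1 : forall t r, r * Ut t r = (P t r - P t (- r)) / 2).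
{ intros t r; rewrite <- EUt; apply r_mul_dt_avg. }
assert (R2 : forall t r, r * (r * B t r) + U t r = (P t r + P t (- r)) / 2).
{ intros t r; rewrite <- EUr; apply r_mul_dr_avg. }
assert (S1 : forall t r, r * Utt t r = (Y t r - Y t (- r)) / 2 - r * nonl (U t r)).
{ intros t r.
  assert (DA : is_derive (fun t => r * Ut t r) t (r * Utt t r)) by (apply der_scal, T3).
  assert (DB : is_derive (fun t => r * Ut t r) t ((Y t r - Y t (- r)) / 2 - r * nonl (U t r))).
  { apply is_derive_ext with (fun t => / 2 * (P t r - P t (- r))).
    - intros s; rewrite R1; real_eq; field.
    - eapply is_derive_eq; [apply der_scal, der_minus; apply HPt|].
      unfold p; rewrite HUe; field. }
  rewrite <- (is_derive_unique _ _ _ DA); apply (is_derive_unique _ _ _ DB). }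
assert (S2 : forall t r, 3 * (r * B t r) + r ^ 2 * (r * BB t r) = (Y t r - Y t (- r)) / 2).
{ intros t r.
  assert (DA : is_derive (fun r => r * (r * B t r) + U t r) r
     ((1 * (r * B t r) + r * (1 * B t r + r * (r * BB t r))) + r * B t r)).
  { apply (der_plus (fun r => r * (r * B t r)) (U t)); [|apply HBd].
    apply (der_mult (fun r => r) (fun r => r * B t r)); [apply der_id|].
    apply (der_mult (fun r => r) (B t)); [apply der_id|apply HBBd]. }
  assert (DB : is_derive (fun r => r * (r * B t r) + U t r) r ((Y t r - Y t (- r)) / 2)).
  { apply is_derive_ext with (fun r => / 2 * (P t r + P t (- r))).
    - intros s; rewrite R2; real_eq; field.
    - eapply is_derive_eq.
      + apply der_scal, der_plus; [apply HPr|apply (der_comp (P t) Ropp); [apply HPr|apply (der_opp (fun x => x)), der_id]].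
      + field. }
  rewrite <- (is_derive_unique _ _ _ DB), (is_derive_unique _ _ _ DA); ring. }
exists Ut, Utt, B, BB.
split; [auto|split; [auto|split; [auto|split; [auto|split; [auto|split; [auto|split; [auto|]]]]]]].
intros t r.
assert (CB := Ck2_c2 _ _ (HB O)); assert (CBB := Ck2_c2 _ _ (HBB O)); assert (CUtt := Ck2_c2 _ _ (T4 O)).
apply Rminus_diag_uniq.
apply (cont_zero_at_0 (fun r => - Utt t r + (3 * B t r + r ^ 2 * BB t r) - nonl (U t r))); [cont_tac|].
intros s; specialize (S1 t s); specialize (S2 t s).
replace (s * (- Utt t s + (3 * B t s + s ^ 2 * BB t s) - nonl (U t s)))
  with (- (s * Utt t s) + (3 * (s * B t s) + s ^ 2 * (s * BB t s)) - s * nonl (U t s)) by ring.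
rewrite S1, S2; ring.
Qed.

Lemma radial_solves_wave : solves_wave (fun p => U (fst p) (norm3 (snd p))).
Proof.
destruct radial_equation as [Ut [Utt [B [BB [HB [HBe [T1 [T2 [DA [DB [_ E]]]]]]]]]]].
intros t x; cbv beta; simpl fst; simpl snd.
refine (eq_trans _ (E t (norm3 x))); f_equal.
- f_equal; simpl.
  rewrite (Derive_ext _ (fun t => Ut t (norm3 x))) by (intros s; apply is_derive_unique, T1).
  apply is_derive_unique, T2.
- assert (G : forall e, In e basis3 -> forall y, X1 e ^ 2 + X2 e ^ 2 + X3 e ^ 2 = 1 /\
    partial e (partial e (fun y => U t (norm3 y))) y
    = B t (norm3 y) + dot e y ^ 2 * BB t (norm3 y)).
  { intros e He y.
    assert (N1 : X1 e ^ 2 + X2 e ^ 2 + X3 e ^ 2 = 1).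
    { revert e He; apply (basis3_ind (fun e => X1 e ^ 2 + X2 e ^ 2 + X3 e ^ 2 = 1)); unfold X1, X2, X3; simpl; ring. }
    split; auto.
    assert (F : partial e (fun y => U t (norm3 y)) = fun y => dot e y * B t (norm3 y)).
    { extensionality z; apply is_derive_unique.
      apply (radial_partial (U t) (B t)); auto; intros; apply U_even. }
    rewrite F; apply is_derive_unique.
    eapply is_derive_eq.
    - apply (der_mult (fun h : R => dot e (plus y (scal h e))) (fun h : R => B t (norm3 (plus y (scal h e))))).
      + apply dot_partial.
      + apply (radial_partial (B t) (BB t)); auto; intros; apply HBe.
    - assert (Z : plus y (scal (0 : R) e) = y).
      { rewrite (scal_zero_l (K := R_AbsRing)); apply plus_zero_r. }
      cbv beta; rewrite Z; unfold dot at 1; simpl in N1 |- *.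
      replace (X1 e * X1 e + X2 e * X2 e + X3 e * X3 e) with 1 by (rewrite <- N1; ring). ring. }
  assert (N2 : norm3 x ^ 2 = X1 x ^ 2 + X2 x ^ 2 + X3 x ^ 2).
  { rewrite norm3_X; apply pow2_sqrt.
    sq (X1 x); sq (X2 x);
    sq (X3 x); lra. }
  unfold laplacian, basis3; simpl map; simpl fold_right.
  transitivity ((B t (norm3 x) + dot (1, 0, 0) x ^ 2 * BB t (norm3 x))
    + ((B t (norm3 x) + dot (0, 1, 0) x ^ 2 * BB t (norm3 x))
    + ((B t (norm3 x) + dot (0, 0, 1) x ^ 2 * BB t (norm3 x)) + 0))).
  { apply (f_equal2 Rplus); [exact (proj2 (G (1, 0, 0) ltac:(simpl; auto) x))|].
    apply (f_equal2 Rplus); [exact (proj2 (G (0, 1, 0) ltac:(simpl; auto) x))|].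
    apply (f_equal2 Rplus); [exact (proj2 (G (0, 0, 1) ltac:(simpl; auto) x))|reflexivity]. }
  rewrite N2; unfold dot, X1, X2, X3; simpl; ring.
Qed.

End RadialWave.

Lemma norm3_axis r : 0 <= r -> norm3 (r, 0, 0) = r.
Proof.
intros Hr; simpl; replace (r * (r * 1) + 0 * (0 * 1) + 0 * (0 * 1)) with (Rsqr r) by (unfold Rsqr; ring).
apply sqrt_Rsqr; auto.
Qed.

Theorem radial_existence u0 u1 : smooth3 u0 -> smooth3 u1 -> spherically_symmetric u0 -> spherically_symmetric u1 ->
  exists u, smooth4 u /\ solves_wave u /\ has_initial_data u u0 u1.
Proof.
intros Hu0 Hu1 Hs0 Hs1.
set (f0 := fun r => u0 (r, 0, 0)); set (f1 := fun r => u1 (r, 0, 0)).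
assert (D0 : forall k, Ck1 k f0) by (intros k; apply axis_regular, Hu0).
assert (DF1 : forall k, Ck1 k f1) by (intros k; apply axis_regular, Hu1).
assert (even_axis : forall u, spherically_symmetric u -> forall r, u (- r, 0, 0) = u (r, 0, 0)).
{ intros u Hs r; apply Hs; simpl; f_equal; ring. }
assert (E0 : forall r, f0 (- r) = f0 r) by (intros; apply even_axis; auto).
assert (E1 : forall r, f1 (- r) = f1 r) by (intros; apply even_axis; auto).
destruct (smooth1_der f0 D0) as [df0 [A1 A2]]; destruct (smooth1_der df0 A2) as [ddf0 [A3 A4]].
destruct (smooth1_der f1 DF1) as [df1 [A5 A6]].
assert (O0 := even_der f0 df0 A1 E0).
set (V0 := fun r => r * f0 r); set (dV0 := fun r => f0 r + r * df0 r).
set (ddV0 := fun r => 2 * df0 r + r * ddf0 r).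
set (V1 := fun r => r * f1 r); set (dV1 := fun r => f1 r + r * df1 r).
assert (B1 : forall x, is_derive V0 x (dV0 x)).
{ intros x; eapply is_derive_eq; [apply der_mult; [apply der_id|apply A1]|]. unfold dV0; ring. }
assert (B2 : forall x, is_derive dV0 x (ddV0 x)).
{ intros x; eapply is_derive_eq; [apply der_plus; [apply A1|apply der_mult; [apply der_id|apply A3]]|].
  unfold ddV0; ring. }
assert (B3 : forall x, is_derive V1 x (dV1 x)).
{ intros x; eapply is_derive_eq; [apply der_mult; [apply der_id|apply A5]|]. unfold dV1; ring. }
assert (R1 : forall k, Ck1 k ddV0).
{ intros k; apply Ck1_plus; apply Ck1_mult; auto; [apply Ck1_const|apply Ck1_id]. }
assert (R2 : forall k, Ck1 k dV1).
{ intros k; apply Ck1_plus; auto; apply Ck1_mult; auto; apply Ck1_id. }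
destruct (global_solution V0 dV0 ddV0 V1 dV1) as [P [CP HPE]]; auto.
{ apply (Ck1_cont 0), R1. }
{ apply (Ck1_cont 0), R2. }
{ intros x; unfold V1; rewrite E1; ring. }
set (P0 := fun x => dV0 x + V1 x) in *.
destruct (duhamel_nonl_regular P0 (fun x => ddV0 x + dV1 x) P) as [Y [HPr [HPt [HP HY]]]]; auto.
{ intros x; apply der_plus; auto. }
{ intros k; apply Ck1_plus; auto. }
destruct (radial_equation P Y HP HY HPr HPt) as [Ut [Utt [B [BB [_ [_ [T1 [T2 [_ [_ [R3' _]]]]]]]]]]].
assert (HP0 : forall r, P 0 r = P0 r).
{ intros r; rewrite HPE; unfold duhamel; rewrite RI_point, !Rplus_0_r; auto. }
assert (HU := U_smooth P HP).
assert (CU := Ck2_c2 _ _ (HU O)).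
assert (Cf0 := Ck1_cont _ _ (D0 O)); assert (Cf1 := Ck1_cont _ _ (DF1 O)).
assert (CP0 : cont P0).
{ apply (cont_plus dV0 V1); [apply (cont_derive _ _ B2)|apply (cont_derive _ _ B3)]. }
assert (I0 : forall r, avg 0 P 0 r = f0 r).
{ intros r; apply Rminus_diag_uniq; apply (cont_zero_at_0 (fun r => avg 0 P 0 r - f0 r)); [cont_tac|].
  intros s; rewrite Rmult_minus_distr_l, avg0_mult by auto.
  rewrite (RI_ext (P 0) P0) by (intros; apply HP0).
  assert (CdV0 := cont_derive _ _ B2); assert (CV1 := cont_derive _ _ B3).
  unfold P0; rewrite RI_plus by auto.
  rewrite (RI_derive V0 dV0) by auto.
  rewrite (RI_sym_split V1) by auto.
  rewrite RI_null by (intros x; unfold V1; rewrite E1; ring).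
  unfold V0; rewrite E0; field. }
assert (I1 : forall r, Ut 0 r = f1 r).
(* The continuity of [Ut], needed to divide by [r], is obtained by identifying it with a derivative
   known to be smooth. *)
{ destruct (smooth2_der _ HU) as [Ut' [_ [T1' [_ [T2' _]]]]].
  assert (Eq : Ut = Ut').
  { extensionality t; extensionality r.
    rewrite <- (is_derive_unique _ _ _ (T1 t r)); apply (is_derive_unique _ _ _ (T1' t r)). }
  assert (CUt := Ck2_c2 _ _ (T2' O)); rewrite <- Eq in CUt.
  intros r; apply Rminus_diag_uniq; apply (cont_zero_at_0 (fun r => Ut 0 r - f1 r)); [cont_tac|].
  intros s; rewrite Rmult_minus_distr_l, R3', !HP0; unfold P0, dV0, V1.
  rewrite E0, E1, O0; field. }
exists (fun p => avg 0 P (fst p) (norm3 (snd p))).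
split; [|split].
- apply radial_class_smooth, (rc_rad (avg 0 P)); auto. apply (U_even P HP).
- apply (radial_solves_wave P Y); auto.
- intros x; simpl; split.
  + rewrite I0; apply Hs0, norm3_axis, norm3_nonneg.
  + rewrite <- (Hs1 (norm3 x, 0, 0) x (norm3_axis _ (norm3_nonneg x))).
    change (u1 (norm3 x, 0, 0)) with (f1 (norm3 x)); rewrite <- I1.
    apply is_derive_unique, T1.
Qed.

(** * Integrals over boxes *)

Definition c4 (f : R -> R -> R -> R -> R) : Prop :=
  cont (fun z : R * R * R * R => f (fst (fst (fst z))) (snd (fst (fst z))) (snd (fst z)) (snd z)).

Lemma cont_comp4 {T : UniformSpace} (g : R -> R -> R -> R -> R) (a b c d : T -> R) :
  c4 g -> cont a -> cont b -> cont c -> cont d -> cont (fun z => g (a z) (b z) (c z) (d z)).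
Proof.
intros Hg Ha Hb Hc Hd.
apply (cont_comp (fun z => (a z, b z, c z, d z))
   (fun p : R * R * R * R => g (fst (fst (fst p))) (snd (fst (fst p))) (snd (fst p)) (snd p))); auto.
cont_tac.
Qed.

Ltac cont_tac4 := repeat first
  [ cont_step
  | match goal with
    | |- c4 _ => unfold c4; cbv beta
    | H : c4 ?g |- cont (fun z => ?g' (@?a z) (@?b z) (@?c z) (@?d z)) =>
        constr_eq g g'; apply (cont_comp4 g a b c d H)
    end ].

Lemma bounded4 (f : R -> R -> R -> R -> R) M : c4 f -> 0 <= M ->
  exists B, 0 <= B /\ forall t x y z, Rabs t <= M -> Rabs x <= M -> Rabs y <= M -> Rabs z <= M ->
    Rabs (f t x y z) <= B.
Proof.
intros Hf HM.
destruct (sup_segment (fun (p : R * R * R) z => f (fst (fst p)) (snd (fst p)) (snd p) z) (-M) M)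
  as [m [Hm [H1 _]]]; [lra|exact Hf|].
destruct (bounded3 (fun t x y => m (t, x, y)) M M M) as [B [HB H2]]; auto.
{ unfold c3; apply (cont_comp (fun z : R * R * R => (fst (fst z), snd (fst z), snd z)) m); auto; cont_tac. }
exists B; split; auto; intros t x y z Ht Hx Hy Hz.
eapply Rle_trans; [apply (H1 (t, x, y) z); apply Rabs_le_between; auto|].
eapply Rle_trans; [apply Rle_abs|auto].
Qed.

(** Differentiating [f t y - f t 0], the integral of [fx t], under the integral sign represents [ft]
    as a primitive of [fxt] in [x]. *)
Lemma schwarz_mixed (f ft fx ftx fxt : R -> R -> R) :
  c2 fx -> c2 fxt -> c2 ftx ->
  (forall t x, is_derive (fun t => f t x) t (ft t x)) -> (forall t x, is_derive (f t) x (fx t x)) ->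
  (forall t x, is_derive (ft t) x (ftx t x)) -> (forall t x, is_derive (fun t => fx t x) t (fxt t x)) ->
  forall t x, fxt t x = ftx t x.
Proof.
intros Cx Cxt Ctx Ht Hx Htx Hxt t x.
assert (E : forall y, ft t y - ft t 0 = RInt (fxt t) 0 y).
{ intros y.
  assert (A : is_derive (fun t => f t y - f t 0) t (ft t y - ft t 0)) by (apply der_minus; apply Ht).
  assert (B : is_derive (fun t => f t y - f t 0) t (RInt (fxt t) 0 y)).
  { apply is_derive_ext with (fun t => RInt (fx t) 0 y).
    - intros s; apply (RI_derive (f s) (fx s)); [apply Hx|apply (cont_curry fx s Cx)].
    - apply derive_RInt_param; auto. intros s; apply (cont_curry fx s Cx). }
  rewrite <- (is_derive_unique _ _ _ A); apply (is_derive_unique _ _ _ B). }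
assert (A : is_derive (ft t) x (fxt t x)).
{ apply is_derive_ext with (fun y => ft t 0 + RInt (fxt t) 0 y).
  - intros y; rewrite <- E; real_eq; ring.
  - eapply is_derive_eq; [apply der_plus; [apply der_const|apply RI_FTC, (cont_curry fxt t Cxt)]|ring]. }
rewrite <- (is_derive_unique _ _ _ A); apply (is_derive_unique _ _ _ (Htx t x)).
Qed.

Lemma gronwall_zero (E dE : R -> R) C T : (forall t, is_derive E t (dE t)) -> E 0 = 0 ->
  (forall t, 0 <= E t) -> (forall t, 0 <= t <= T -> dE t <= C * E t) ->
  forall t, 0 <= t <= T -> E t = 0.
Proof.
intros HE H0 Hp HC t Ht.
assert (A : - (E 0 * exp (- C * 0)) <= - (E t * exp (- C * t))).
{ apply (derive_le_mono (fun t => - (E t * exp (- C * t)))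
   (fun t => - (dE t * exp (- C * t) + E t * (- C * exp (- C * t))))).
  - lra.
  - intros s; apply (der_opp (fun t => E t * exp (- C * t))).
    apply (der_mult E (fun t => exp (- C * t))); [apply HE|].
    apply (der_comp exp (fun t => - C * t)); [apply is_derive_exp|].
    eapply is_derive_eq; [apply der_scal, der_id|ring].
  - intros s Hs; assert (X := HC s ltac:(lra)); assert (P := exp_pos (- C * s)).
    replace (- (dE s * exp (- C * s) + E s * (- C * exp (- C * s))))
      with ((C * E s - dE s) * exp (- C * s)) by ring.
    apply Rmult_le_pos; lra. }
rewrite H0 in A; assert (P := exp_pos (- C * t)); specialize (Hp t).
assert (E t * exp (- C * t) <= 0) by lra.
destruct (Rle_lt_or_eq_dec _ _ Hp) as [L|L]; auto.
assert (0 < E t * exp (- C * t)) by (apply Rmult_lt_0_compat; auto). lra.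
Qed.

Definition box (f : R -> R -> R -> R) (M : R) : R :=
  RInt (fun x => RInt (fun y => RInt (fun z => f x y z) (-M) M) (-M) M) (-M) M.

Lemma box_plus f g M : c3 f -> c3 g -> box (fun x y z => f x y z + g x y z) M = box f M + box g M.
Proof.
intros Hf Hg; unfold box; rewrite <- RI_plus by cont_tac; apply RI_ext; intros x _.
rewrite <- RI_plus by cont_tac; apply RI_ext; intros y _; rewrite <- RI_plus by cont_tac; auto.
Qed.

Lemma box_scal c f M : c3 f -> box (fun x y z => c * f x y z) M = c * box f M.
Proof.
intros Hf; unfold box; rewrite <- RI_scal by cont_tac; apply RI_ext; intros x _.
rewrite <- RI_scal by cont_tac; apply RI_ext; intros y _; rewrite <- RI_scal by cont_tac; auto.
Qed.

Lemma box_le f g M : c3 f -> c3 g -> 0 <= M ->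
  (forall x y z, -M <= x <= M -> -M <= y <= M -> -M <= z <= M -> f x y z <= g x y z) ->
  box f M <= box g M.
Proof.
intros Hf Hg HM H; unfold box.
apply RI_le; [lra|cont_tac|cont_tac|]; intros x Hx.
apply RI_le; [lra|cont_tac|cont_tac|]; intros y Hy.
apply RI_le; [lra|cont_tac|cont_tac|]; intros z Hz; auto.
Qed.

Lemma box_pos_zero f M : c3 f -> 0 < M ->
  (forall x y z, 0 <= f x y z) -> box f M = 0 ->
  forall x y z, -M < x < M -> -M < y < M -> -M < z < M -> f x y z = 0.
Proof.
intros Hf HM Hp H0 x y z Hx Hy Hz.
assert (P1 : forall x y, 0 <= RInt (fun z => f x y z) (-M) M).
{ intros; apply RI_ge_0; [lra|cont_tac|auto]. }
assert (P2 : forall x, 0 <= RInt (fun y => RInt (fun z => f x y z) (-M) M) (-M) M).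
{ intros; apply RI_ge_0; [lra|cont_tac|auto]. }
assert (Z1 := RI_ge_0_zero (fun x => RInt (fun y => RInt (fun z => f x y z) (-M) M) (-M) M) (-M) M
  ltac:(lra) ltac:(cont_tac) (fun x _ => P2 x) H0 x Hx).
assert (Z2 := RI_ge_0_zero (fun y => RInt (fun z => f x y z) (-M) M) (-M) M
  ltac:(lra) ltac:(cont_tac) (fun y _ => P1 x y) Z1 y Hy).
apply (RI_ge_0_zero (fun z => f x y z) (-M) M ltac:(lra) ltac:(cont_tac) (fun z _ => Hp x y z) Z2 z Hz).
Qed.

Lemma box_derive (f df : R -> R -> R -> R -> R) M t : c4 f -> c4 df ->
  (forall t x y z, is_derive (fun t => f t x y z) t (df t x y z)) ->
  is_derive (fun t => box (f t) M) t (box (df t) M).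
Proof.
intros Hf Hd H; unfold box.
apply (derive_RInt_param (fun t x => RInt (fun y => RInt (fun z => f t x y z) (-M) M) (-M) M)
  (fun t x => RInt (fun y => RInt (fun z => df t x y z) (-M) M) (-M) M)); [intros s; cont_tac4|cont_tac4|].
intros s x.
apply (derive_RInt_param (fun t y => RInt (fun z => f t x y z) (-M) M)
  (fun t y => RInt (fun z => df t x y z) (-M) M)); [intros s'; cont_tac4|cont_tac4|].
intros s' y.
apply (derive_RInt_param (fun t z => f t x y z) (fun t z => df t x y z)); [intros s''; cont_tac4|cont_tac4|].
intros s'' z; apply H.
Qed.

Section Divergence.
Variables (F1 F2 F3 d1 d2 d3 : R -> R -> R -> R) (M : R).
Hypotheses (C1 : c3 d1) (C2 : c3 d2) (C3 : c3 d3)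
  (H1 : forall x y z, is_derive (fun x => F1 x y z) x (d1 x y z))
  (H2 : forall x y z, is_derive (fun y => F2 x y z) y (d2 x y z))
  (H3 : forall x y z, is_derive (fun z => F3 x y z) z (d3 x y z))
  (B1 : forall y z, F1 M y z = 0 /\ F1 (-M) y z = 0)
  (B2 : forall x z, F2 x M z = 0 /\ F2 x (-M) z = 0)
  (B3 : forall x y, F3 x y M = 0 /\ F3 x y (-M) = 0).

(** For each term Fubini makes the integration in the direction of its derivative innermost, where
    it yields boundary values only. *)
Lemma box_divergence : box (fun x y z => d1 x y z + d2 x y z + d3 x y z) M = 0.
Proof.
rewrite (box_plus (fun x y z => d1 x y z + d2 x y z) d3) by cont_tac.
rewrite (box_plus d1 d2) by cont_tac; unfold box.
assert (E3 : RInt (fun x => RInt (fun y => RInt (fun z => d3 x y z) (-M) M) (-M) M) (-M) M = 0 :> R).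
{ apply RI_null; intros x; apply RI_null; intros y.
  rewrite (RI_derive (fun z => F3 x y z)) by (auto; cont_tac).
  destruct (B3 x y) as [-> ->]; real_eq; ring. }
assert (E2 : RInt (fun x => RInt (fun y => RInt (fun z => d2 x y z) (-M) M) (-M) M) (-M) M = 0 :> R).
{ apply RI_null; intros x.
  rewrite (fubini (fun y z => d2 x y z)) by cont_tac.
  apply RI_null; intros z.
  rewrite (RI_derive (fun y => F2 x y z)) by (auto; cont_tac).
  destruct (B2 x z) as [-> ->]; real_eq; ring. }
assert (E1 : RInt (fun x => RInt (fun y => RInt (fun z => d1 x y z) (-M) M) (-M) M) (-M) M = 0 :> R).
{ rewrite (fubini (fun x y => RInt (fun z => d1 x y z) (-M) M)) by cont_tac.
  apply RI_null; intros y.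
  rewrite (fubini (fun x z => d1 x y z)) by cont_tac.
  apply RI_null; intros z.
  rewrite (RI_derive (fun x => F1 x y z)) by (auto; cont_tac).
  destruct (B1 y z) as [-> ->]; real_eq; ring. }
rewrite E1, E2, E3; ring.
Qed.
End Divergence.

(** * Energy in shrinking boxes *)

Section BoxUniqueness.

Variables (w wt w1 w2 w3 wtt wt1 wt2 wt3 w11 w22 w33 : R -> R -> R -> R -> R) (M L : R).
Hypotheses (HM : 0 < M) (HL : 0 <= L)
  (Cw : c4 w) (Cwt : c4 wt) (Cw1 : c4 w1) (Cw2 : c4 w2) (Cw3 : c4 w3) (Cwtt : c4 wtt)
  (Cwt1 : c4 wt1) (Cwt2 : c4 wt2) (Cwt3 : c4 wt3) (Cw11 : c4 w11) (Cw22 : c4 w22) (Cw33 : c4 w33)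
  (Dt : forall t x y z, is_derive (fun t => w t x y z) t (wt t x y z))
  (Dtt : forall t x y z, is_derive (fun t => wt t x y z) t (wtt t x y z))
  (D1t : forall t x y z, is_derive (fun t => w1 t x y z) t (wt1 t x y z))
  (D2t : forall t x y z, is_derive (fun t => w2 t x y z) t (wt2 t x y z))
  (D3t : forall t x y z, is_derive (fun t => w3 t x y z) t (wt3 t x y z))
  (Dt1 : forall t x y z, is_derive (fun x => wt t x y z) x (wt1 t x y z))
  (Dt2 : forall t x y z, is_derive (fun y => wt t x y z) y (wt2 t x y z))
  (Dt3 : forall t x y z, is_derive (fun z => wt t x y z) z (wt3 t x y z))
  (D11 : forall t x y z, is_derive (fun x => w1 t x y z) x (w11 t x y z))
  (D22 : forall t x y z, is_derive (fun y => w2 t x y z) y (w22 t x y z))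
  (D33 : forall t x y z, is_derive (fun z => w3 t x y z) z (w33 t x y z))
  (Hwave : forall t x y z, 0 <= t <= M -> Rabs x <= M -> Rabs y <= M -> Rabs z <= M ->
     Rabs (wtt t x y z - (w11 t x y z + w22 t x y z + w33 t x y z)) <= L * Rabs (w t x y z))
  (H0 : forall x y z, w 0 x y z = 0 /\ wt 0 x y z = 0 /\ w1 0 x y z = 0 /\ w2 0 x y z = 0 /\ w3 0 x y z = 0).

(** For [0 <= t <= M] it vanishes where [Rabs x >= M - t], and its square [q] is C^1. A product of
    one such weight per coordinate fits iterated one-dimensional integrals, and speed one in each
    coordinate suffices. *)
Let s t x := ppart ((M - t) ^ 2 - x ^ 2).
Let q t x := s t x ^ 2.
Let qt t x := 2 * s t x * (- 2 * (M - t)).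
Let qx t x := 2 * s t x * (- 2 * x).

Lemma q_der_t t x : is_derive (fun t => q t x) t (qt t x).
Proof.
eapply is_derive_eq.
- apply (der_comp (fun v => ppart v ^ 2) (fun t => (M - t) ^ 2 - x ^ 2)); [apply ppart2_der|].
  apply der_minus; [|apply der_const].
  apply (der_pow2 (fun t => M - t)), der_minus; [apply der_const|apply der_id].
- unfold qt, s; ring.
Qed.

Lemma q_der_x t x : is_derive (q t) x (qx t x).
Proof.
eapply is_derive_eq.
- apply (der_comp (fun v => ppart v ^ 2) (fun x => (M - t) ^ 2 - x ^ 2)); [apply ppart2_der|].
  apply der_minus; [apply der_const|apply der_pow2, der_id].
- unfold qx, s; cbv beta; ring.
Qed.

Lemma c2_s : c2 s. Proof. assert (Q := cont_ppart); unfold s; cont_tac. Qed.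
Lemma c2_q : c2 q. Proof. assert (Q := c2_s); unfold q; cont_tac. Qed.
Lemma c2_qt : c2 qt. Proof. assert (Q := c2_s); unfold qt; cont_tac. Qed.
Lemma c2_qx : c2 qx. Proof. assert (Q := c2_s); unfold qx; cont_tac. Qed.

Lemma q_pos t x : 0 <= q t x. Proof. apply pow2_ge_0. Qed.

(* The weight decreases at least at the speed of propagation. *)
Lemma q_speed t x : 0 <= t <= M -> Rabs (qx t x) <= - qt t x.
Proof.
intros Ht; unfold qx, qt.
destruct (Rle_dec ((M - t) ^ 2 - x ^ 2) 0) as [Hs|Hs].
- replace (s t x) with 0 by (unfold s, ppart; rewrite Rmax_left; lra).
  rewrite !Rmult_0_r, !Rmult_0_l, Rabs_R0; lra.
- assert (Ps : 0 <= s t x) by (unfold s, ppart; apply Rmax_l).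
  assert (Rabs x <= M - t).
  { apply Rsqr_incr_0_var; [|lra]. rewrite <- Rsqr_abs, !Rsqr_pow2; lra. }
  rewrite !Rabs_mult, (Rabs_pos_eq 2), (Rabs_pos_eq (s t x)), (Rabs_left (-2)) by lra. nra.
Qed.

Lemma q_edge t : 0 <= t <= M -> q t M = 0 /\ q t (- M) = 0.
Proof.
intros Ht; assert (E : s t M = 0) by (unfold s, ppart; apply Rmax_left; nra).
assert (E' : s t (- M) = 0) by (unfold s, ppart; apply Rmax_left; nra).
unfold q; rewrite E, E'; split; ring.
Qed.

(** The term [w^2] lets [e] control the right-hand side [L * Rabs w] of the differential
    inequality. *)
Let e t x y z := / 2 * (wt t x y z ^ 2 + w1 t x y z ^ 2 + w2 t x y z ^ 2 + w3 t x y z ^ 2 + w t x y z ^ 2).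
Let de t x y z := wt t x y z * wtt t x y z + w1 t x y z * wt1 t x y z + w2 t x y z * wt2 t x y z
  + w3 t x y z * wt3 t x y z + w t x y z * wt t x y z.
Let phi t x y z := q t x * q t y * q t z.
Let phit t x y z := qt t x * q t y * q t z + q t x * qt t y * q t z + q t x * q t y * qt t z.

Lemma e_der t x y z : is_derive (fun t => e t x y z) t (de t x y z).
Proof.
eapply is_derive_eq.
- apply (der_scal (fun t => wt t x y z ^ 2 + w1 t x y z ^ 2 + w2 t x y z ^ 2 + w3 t x y z ^ 2 + w t x y z ^ 2)).
  apply (der_plus (fun t => wt t x y z ^ 2 + w1 t x y z ^ 2 + w2 t x y z ^ 2 + w3 t x y z ^ 2) (fun t => w t x y z ^ 2));
    [|apply (der_pow2 (fun t => w t x y z)), Dt].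
  apply (der_plus (fun t => wt t x y z ^ 2 + w1 t x y z ^ 2 + w2 t x y z ^ 2) (fun t => w3 t x y z ^ 2));
    [|apply (der_pow2 (fun t => w3 t x y z)), D3t].
  apply (der_plus (fun t => wt t x y z ^ 2 + w1 t x y z ^ 2) (fun t => w2 t x y z ^ 2));
    [|apply (der_pow2 (fun t => w2 t x y z)), D2t].
  apply (der_plus (fun t => wt t x y z ^ 2) (fun t => w1 t x y z ^ 2));
    [apply (der_pow2 (fun t => wt t x y z)), Dtt|apply (der_pow2 (fun t => w1 t x y z)), D1t].
- unfold de; field.
Qed.

Lemma phi_der t x y z : is_derive (fun t => phi t x y z) t (phit t x y z).
Proof.
eapply is_derive_eq.
- apply (der_mult (fun t => q t x * q t y) (fun t => q t z));
    [apply (der_mult (fun t => q t x) (fun t => q t y))|]; apply q_der_t.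
- unfold phit; ring.
Qed.

Let E t := box (fun x y z => phi t x y z * e t x y z) M.
Let dE t := box (fun x y z => phit t x y z * e t x y z + phi t x y z * de t x y z) M.

Lemma c4_e : c4 e. Proof. unfold e; cont_tac4. Qed.
Lemma c4_de : c4 de. Proof. unfold de; cont_tac4. Qed.
Lemma c4_phi : c4 phi. Proof. assert (Q1 := c2_q); unfold phi; cont_tac4. Qed.
Lemma c4_phit : c4 phit. Proof. assert (Q1 := c2_q); assert (Q2 := c2_qt); unfold phit; cont_tac4. Qed.

Lemma E_der t : is_derive E t (dE t).
Proof.
assert (Q1 := c4_e); assert (Q2 := c4_de); assert (Q3 := c4_phi); assert (Q4 := c4_phit).
apply (box_derive (fun t x y z => phi t x y z * e t x y z)
  (fun t x y z => phit t x y z * e t x y z + phi t x y z * de t x y z)); [cont_tac4|cont_tac4|].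
intros t' x y z; apply (der_mult (fun t => phi t x y z) (fun t => e t x y z)); [apply phi_der|apply e_der].
Qed.

Lemma e_pos t x y z : 0 <= e t x y z.
Proof.
unfold e; sq (wt t x y z); sq (w1 t x y z);
sq (w2 t x y z); sq (w3 t x y z);
sq (w t x y z); lra.
Qed.

Lemma phi_pos t x y z : 0 <= phi t x y z.
Proof. unfold phi; apply Rmult_le_pos; [apply Rmult_le_pos|]; apply q_pos. Qed.

(** Flux through the moving faces, [k * (a * b)], is outweighed by the loss [l * c] from the
    decreasing weight, by [2 |a b| <= a^2 + b^2]. *)
Lemma prod_le_e a b c : 0 <= c -> / 2 * (a ^ 2 + b ^ 2) <= c -> forall k l, Rabs k <= - l -> l * c - k * (a * b) <= 0.
Proof.
intros Hc Hab k l Hk.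
assert (A : Rabs (a * b) <= c).
{ rewrite Rabs_mult, <- (pow2_abs a), <- (pow2_abs b) in *.
  sq (Rabs a - Rabs b). lra. }
assert (B : Rabs (k * (a * b)) <= - l * c).
{ rewrite Rabs_mult; apply Rmult_le_compat; auto; apply Rabs_pos. }
apply Rabs_le_between in B; lra.
Qed.

Let d1 t x y z := qx t x * q t y * q t z * (wt t x y z * w1 t x y z)
  + phi t x y z * (wt1 t x y z * w1 t x y z + wt t x y z * w11 t x y z).
Let d2 t x y z := q t x * qx t y * q t z * (wt t x y z * w2 t x y z)
  + phi t x y z * (wt2 t x y z * w2 t x y z + wt t x y z * w22 t x y z).
Let d3 t x y z := q t x * q t y * qx t z * (wt t x y z * w3 t x y z)
  + phi t x y z * (wt3 t x y z * w3 t x y z + wt t x y z * w33 t x y z).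

Lemma flux_zero t : 0 <= t <= M -> box (fun x y z => d1 t x y z + d2 t x y z + d3 t x y z) M = 0.
Proof.
intros Ht; assert (Q1 := c2_q); assert (Q2 := c2_qx); assert (Q3 := c4_phi).
destruct (q_edge t Ht) as [E1 E2].
assert (K1 : forall x y z, is_derive (fun x => phi t x y z * (wt t x y z * w1 t x y z)) x (d1 t x y z)).
{ intros x y z; eapply is_derive_eq.
  - apply (der_mult (fun x => q t x * q t y * q t z) (fun x => wt t x y z * w1 t x y z)).
    + apply (der_mult (fun x => q t x * q t y) (fun _ => q t z)); [|apply der_const].
      apply (der_mult (q t) (fun _ => q t y)); [apply q_der_x|apply der_const].
    + apply (der_mult (fun x => wt t x y z) (fun x => w1 t x y z)); auto.
  - unfold d1, phi; ring. }
assert (K2 : forall x y z, is_derive (fun y => phi t x y z * (wt t x y z * w2 t x y z)) y (d2 t x y z)).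
{ intros x y z; eapply is_derive_eq.
  - apply (der_mult (fun y => q t x * q t y * q t z) (fun y => wt t x y z * w2 t x y z)).
    + apply (der_mult (fun y => q t x * q t y) (fun _ => q t z)); [|apply der_const].
      apply (der_mult (fun _ => q t x) (q t)); [apply der_const|apply q_der_x].
    + apply (der_mult (fun y => wt t x y z) (fun y => w2 t x y z)); auto.
  - unfold d2, phi; ring. }
assert (K3 : forall x y z, is_derive (fun z => phi t x y z * (wt t x y z * w3 t x y z)) z (d3 t x y z)).
{ intros x y z; eapply is_derive_eq.
  - apply (der_mult (fun z => q t x * q t y * q t z) (fun z => wt t x y z * w3 t x y z)).
    + apply (der_mult (fun _ => q t x * q t y) (q t)); [apply der_const|apply q_der_x].
    + apply (der_mult (fun z => wt t x y z) (fun z => w3 t x y z)); auto.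
  - unfold d3, phi; ring. }
apply (box_divergence (fun x y z => phi t x y z * (wt t x y z * w1 t x y z))
  (fun x y z => phi t x y z * (wt t x y z * w2 t x y z))
  (fun x y z => phi t x y z * (wt t x y z * w3 t x y z)) (d1 t) (d2 t) (d3 t)); auto;
  try (unfold d1, d2, d3; cont_tac4; fail);
  intros; unfold phi; rewrite E1, E2; split; ring.
Qed.

(** Subtracting the divergence of the energy flux, whose integral is zero, makes the estimate
    pointwise: second derivatives remain only in the combination bounded by [Hwave], and derivatives
    of the weight only in combinations handled by [prod_le_e]. *)
Lemma dE_bound t : 0 <= t <= M -> dE t <= (2 * L + 1) * E t.
Proof.
intros Ht; assert (Q1 := c2_q); assert (Q2 := c2_qx); assert (Q3 := c4_phi); assert (Q4 := c4_phit).
assert (Q5 := c4_e); assert (Q6 := c4_de).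
assert (Qd : c3 (fun x y z => d1 t x y z + d2 t x y z + d3 t x y z)) by (unfold d1, d2, d3; cont_tac4).
assert (Qe : c3 (fun x y z => phi t x y z * e t x y z)) by cont_tac4.
apply Rle_trans with (box (fun x y z => (d1 t x y z + d2 t x y z + d3 t x y z)
   + (2 * L + 1) * (phi t x y z * e t x y z)) M).
2:{ rewrite (box_plus (fun x y z => d1 t x y z + d2 t x y z + d3 t x y z)
      (fun x y z => (2 * L + 1) * (phi t x y z * e t x y z))) by (auto; cont_tac4).
    rewrite flux_zero by auto. rewrite (box_scal (2 * L + 1) (fun x y z => phi t x y z * e t x y z)) by auto.
    unfold E; lra. }
assert (Ql : c3 (fun x y z => phit t x y z * e t x y z + phi t x y z * de t x y z)) by cont_tac4.
assert (Qr : c3 (fun x y z => (d1 t x y z + d2 t x y z + d3 t x y z) + (2 * L + 1) * (phi t x y z * e t x y z))).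
{ unfold c3 in *. apply (cont_plus (fun p : R * R * R => d1 t (fst (fst p)) (snd (fst p)) (snd p)
   + d2 t (fst (fst p)) (snd (fst p)) (snd p) + d3 t (fst (fst p)) (snd (fst p)) (snd p))
   (fun p : R * R * R => (2 * L + 1) * (phi t (fst (fst p)) (snd (fst p)) (snd p) * e t (fst (fst p)) (snd (fst p)) (snd p)))).
  - exact Qd.
  - cont_tac4. }
apply (box_le _ _ M Ql Qr); [lra|].
intros x y z Hx Hy Hz.
assert (ax : Rabs x <= M) by (apply Rabs_le; lra).
assert (ay : Rabs y <= M) by (apply Rabs_le; lra).
assert (az : Rabs z <= M) by (apply Rabs_le; lra).
assert (W := Hwave t x y z Ht ax ay az).
assert (Ep := e_pos t x y z).
set (a := wt t x y z) in *; set (c := w t x y z) in *.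
assert (S0 : 0 <= a ^ 2 /\ 0 <= w1 t x y z ^ 2 /\ 0 <= w2 t x y z ^ 2 /\ 0 <= w3 t x y z ^ 2 /\ 0 <= c ^ 2)
  by (repeat split; apply pow2_ge_0).
destruct S0 as [S1 [S2 [S3 [S4 S5]]]].
assert (Ee : e t x y z = / 2 * (a ^ 2 + w1 t x y z ^ 2 + w2 t x y z ^ 2 + w3 t x y z ^ 2 + c ^ 2)) by reflexivity.
assert (I1 := prod_le_e a (w1 t x y z) (e t x y z) Ep ltac:(lra) (qx t x) (qt t x) (q_speed t x Ht)).
assert (I2 := prod_le_e a (w2 t x y z) (e t x y z) Ep ltac:(lra) (qx t y) (qt t y) (q_speed t y Ht)).
assert (I3 := prod_le_e a (w3 t x y z) (e t x y z) Ep ltac:(lra) (qx t z) (qt t z) (q_speed t z Ht)).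
set (b := wtt t x y z - (w11 t x y z + w22 t x y z + w33 t x y z)) in *.
(* The product with the wave defect [b] costs at most [L * e], the term from differentiating [w^2]
   at most [e]. *)
assert (J : a * b + c * a <= (2 * L + 1) * e t x y z).
{ assert (T1 : a * b <= Rabs a * (L * Rabs c)).
  { eapply Rle_trans; [apply Rle_abs|]; rewrite Rabs_mult; apply Rmult_le_compat_l; [apply Rabs_pos|auto]. }
  assert (T2 : Rabs a * Rabs c <= e t x y z).
  { assert (X : 0 <= (Rabs a - Rabs c) ^ 2) by apply pow2_ge_0.
    rewrite Ee, <- (pow2_abs a), <- (pow2_abs c). lra. }
  assert (T3 : c * a <= e t x y z).
  { eapply Rle_trans; [apply Rle_abs|]; rewrite Rabs_mult; lra. }
  assert (T4 : L * (Rabs a * Rabs c) <= L * e t x y z) by (apply Rmult_le_compat_l; auto).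
  assert (0 <= L * e t x y z) by (apply Rmult_le_pos; auto). lra. }
assert (Pp := phi_pos t x y z).
assert (N1 : q t y * q t z * (qt t x * e t x y z - qx t x * (a * w1 t x y z)) <= 0).
{ assert (0 <= q t y * q t z) by (apply Rmult_le_pos; apply q_pos). nra. }
assert (N2 : q t x * q t z * (qt t y * e t x y z - qx t y * (a * w2 t x y z)) <= 0).
{ assert (0 <= q t x * q t z) by (apply Rmult_le_pos; apply q_pos). nra. }
assert (N3 : q t x * q t y * (qt t z * e t x y z - qx t z * (a * w3 t x y z)) <= 0).
{ assert (0 <= q t x * q t y) by (apply Rmult_le_pos; apply q_pos). nra. }
assert (N4 : phi t x y z * (a * b + c * a) <= phi t x y z * ((2 * L + 1) * e t x y z)) by (apply Rmult_le_compat_l; auto).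
apply Rminus_le.
replace (phit t x y z * e t x y z + phi t x y z * de t x y z -
  (d1 t x y z + d2 t x y z + d3 t x y z + (2 * L + 1) * (phi t x y z * e t x y z)))
 with (q t y * q t z * (qt t x * e t x y z - qx t x * (a * w1 t x y z))
  + q t x * q t z * (qt t y * e t x y z - qx t y * (a * w2 t x y z))
  + q t x * q t y * (qt t z * e t x y z - qx t z * (a * w3 t x y z))
  + (phi t x y z * (a * b + c * a) - phi t x y z * ((2 * L + 1) * e t x y z))); [lra|].
unfold phit, de, d1, d2, d3, a, b, c; ring.
Qed.

Lemma box_vanish t x y z : 0 <= t <= M -> Rabs x < M - t -> Rabs y < M - t -> Rabs z < M - t -> w t x y z = 0.
Proof.
intros Ht Hx Hy Hz.
assert (Q3 := c4_phi); assert (Q5 := c4_e).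
assert (Hpos : forall t x y z, 0 <= phi t x y z * e t x y z).
{ intros; apply Rmult_le_pos; [apply phi_pos|apply e_pos]. }
assert (EZ : E t = 0).
{ apply (gronwall_zero E dE (2 * L + 1) M E_der); auto.
  - unfold E, box; apply RI_null; intros x'; apply RI_null; intros y'; apply RI_null; intros z'.
    destruct (H0 x' y' z') as [h1 [h2 [h3 [h4 h5]]]]; unfold e; rewrite h1, h2, h3, h4, h5; real_eq; ring.
  - intros u; unfold E, box.
    apply RI_ge_0; [lra|cont_tac4|]; intros; apply RI_ge_0; [lra|cont_tac4|]; intros; apply RI_ge_0; [lra|cont_tac4|]; auto.
  - apply dE_bound. }
assert (Z := box_pos_zero (fun x y z => phi t x y z * e t x y z) M ltac:(cont_tac4) HM (Hpos t) EZ x y z).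
assert (Hr : forall v, Rabs v < M - t -> -M < v < M) by (intros v Hv; apply Rabs_def2 in Hv; lra).
specialize (Z (Hr x Hx) (Hr y Hy) (Hr z Hz)).
assert (Hq : forall v, Rabs v < M - t -> 0 < q t v).
{ intros v Hv; unfold q; apply pow_lt; unfold s, ppart.
  assert (Pv := Rabs_pos v).
  assert (v ^ 2 < (M - t) ^ 2) by (rewrite <- (pow2_abs v); nra).
  rewrite Rmax_right; lra. }
assert (Pq : 0 < phi t x y z) by (unfold phi; apply Rmult_lt_0_compat; [apply Rmult_lt_0_compat|]; auto).
apply Rmult_integral in Z; destruct Z as [Z|Z]; [lra|].
unfold e in Z.
sq (wt t x y z); sq (w1 t x y z);
sq (w2 t x y z); sq (w3 t x y z);
sq (w t x y z).
assert (W2 : w t x y z ^ 2 = 0) by lra.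
destruct (Req_dec (w t x y z) 0) as [|N]; auto; apply (pow_nonzero _ 2) in N; contradiction.
Qed.

End BoxUniqueness.

(** * Uniqueness *)

(** [partial] is a derivative at parameter 0; translation along [e] gives the derivative at every
    parameter. *)
Lemma Ck_derive {V : NormedModule R_AbsRing} (B : list V) k (f : V -> R) e : Ck B (S k) f -> In e B ->
  forall (p : V) (s : R), is_derive (fun h : R => f (plus p (scal h e))) s (partial e f (plus p (scal s e))).
Proof.
intros [_ H] He p s; destruct (H e He) as [Hex _].
set (q := plus p (scal s e)).
destruct (Hex q) as [l Hl].
assert (E : partial e f q = l) by (apply is_derive_unique, Hl).
rewrite E.
apply is_derive_ext with (fun h : R => (fun k : R => f (plus q (scal k e))) (h - s)).
- intros h; cbv beta; unfold q; apply (f_equal f).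
  rewrite <- plus_assoc; apply (f_equal (plus p)).
  transitivity (scal (plus (s : R_AbsRing) (h - s)) e); [symmetry; exact (@scal_distr_r R_Ring (NormedModule.ModuleSpace R_AbsRing V) s (h - s) e)|].
  apply (f_equal (fun k : R => scal k e)); change (s + (h - s) = h); ring.
- eapply is_derive_eq.
  + apply (der_comp (fun k : R => f (plus q (scal k e))) (fun h => h - s)).
    * rewrite Rminus_diag; exact Hl.
    * apply der_minus; [apply der_id|apply der_const].
  + ring.
Qed.

Definition cur (f : R * R3 -> R) (t x y z : R) : R := f (t, ((x, y), z)).
Definition bt : R * R3 := (1, (0, 0, 0)).
Definition b1 : R * R3 := (0, (1, 0, 0)).
Definition b2 : R * R3 := (0, (0, 1, 0)).
Definition b3 : R * R3 := (0, (0, 0, 1)).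

Lemma smooth4_partial f e : smooth4 f -> In e basis4 -> smooth4 (partial e f).
Proof. intros Hf He k; destruct (Hf (S k)) as [_ H]; apply (H e He). Qed.

Lemma smooth4_cont f : smooth4 f -> c4 (cur f).
Proof.
intros Hf; assert (Cf : cont f) by (destruct (Hf O) as [H _]; exact H).
unfold c4, cur.
apply (cont_comp (fun z : R * R * R * R =>
  ((fst (fst (fst z)), ((snd (fst (fst z)), snd (fst z)), snd z)) : R * R3)) f); auto.
unfold R3; cont_tac.
Qed.

Lemma in_bt : In bt basis4. Proof. simpl; auto. Qed.
Lemma in_b1 : In b1 basis4. Proof. simpl; auto. Qed.
Lemma in_b2 : In b2 basis4. Proof. simpl; auto. Qed.
Lemma in_b3 : In b3 basis4. Proof. simpl; auto. Qed.

Lemma plus_scal_cur (t x y z h a k1 k2 k3 : R) :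
  plus ((t, ((x, y), z)) : R * R3) (scal h ((a, ((k1, k2), k3)) : R * R3))
  = (t + h * a, ((x + h * k1, y + h * k2), z + h * k3)).
Proof. reflexivity. Qed.

Lemma cur_der_t f : smooth4 f -> forall t x y z, is_derive (fun t => cur f t x y z) t (cur (partial bt f) t x y z).
Proof.
intros Hf t x y z; assert (D := Ck_derive basis4 0 f bt (Hf 1%nat) in_bt (0, ((x, y), z)) t).
assert (E : forall h, plus ((0, ((x, y), z)) : R * R3) (scal h bt) = (h, ((x, y), z))).
{ intros h; unfold bt; rewrite plus_scal_cur, ?Rmult_0_r, ?Rmult_1_r, ?Rplus_0_r, ?Rplus_0_l; reflexivity. }
rewrite E in D; apply (is_derive_ext _ _ _ _ (fun h => f_equal f (E h)) D).
Qed.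

Lemma cur_der_1 f : smooth4 f -> forall t x y z, is_derive (fun x => cur f t x y z) x (cur (partial b1 f) t x y z).
Proof.
intros Hf t x y z; assert (D := Ck_derive basis4 0 f b1 (Hf 1%nat) in_b1 (t, ((0, y), z)) x).
assert (E : forall h, plus ((t, ((0, y), z)) : R * R3) (scal h b1) = (t, ((h, y), z))).
{ intros h; unfold b1; rewrite plus_scal_cur, ?Rmult_0_r, ?Rmult_1_r, ?Rplus_0_r, ?Rplus_0_l; reflexivity. }
rewrite E in D; apply (is_derive_ext _ _ _ _ (fun h => f_equal f (E h)) D).
Qed.

Lemma cur_der_2 f : smooth4 f -> forall t x y z, is_derive (fun y => cur f t x y z) y (cur (partial b2 f) t x y z).
Proof.
intros Hf t x y z; assert (D := Ck_derive basis4 0 f b2 (Hf 1%nat) in_b2 (t, ((x, 0), z)) y).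
assert (E : forall h, plus ((t, ((x, 0), z)) : R * R3) (scal h b2) = (t, ((x, h), z))).
{ intros h; unfold b2; rewrite plus_scal_cur, ?Rmult_0_r, ?Rmult_1_r, ?Rplus_0_r, ?Rplus_0_l; reflexivity. }
rewrite E in D; apply (is_derive_ext _ _ _ _ (fun h => f_equal f (E h)) D).
Qed.

Lemma cur_der_3 f : smooth4 f -> forall t x y z, is_derive (fun z => cur f t x y z) z (cur (partial b3 f) t x y z).
Proof.
intros Hf t x y z; assert (D := Ck_derive basis4 0 f b3 (Hf 1%nat) in_b3 (t, ((x, y), 0)) z).
assert (E : forall h, plus ((t, ((x, y), 0)) : R * R3) (scal h b3) = (t, ((x, y), h))).
{ intros h; unfold b3; rewrite plus_scal_cur, ?Rmult_0_r, ?Rmult_1_r, ?Rplus_0_r, ?Rplus_0_l; reflexivity. }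
rewrite E in D; apply (is_derive_ext _ _ _ _ (fun h => f_equal f (E h)) D).
Qed.

Section Mixed.
Variable f : R * R3 -> R.
Hypothesis Hf : smooth4 f.
Let P2 e e' (He : In e basis4) (He' : In e' basis4) := smooth4_partial _ e' (smooth4_partial f e Hf He) He'.

Lemma mixed_1 t x y z : cur (partial bt (partial b1 f)) t x y z = cur (partial b1 (partial bt f)) t x y z.
Proof.
assert (Q1 := smooth4_partial f b1 Hf in_b1); assert (Qt := smooth4_partial f bt Hf in_bt).
assert (C1 := smooth4_cont _ Q1); assert (C2 := smooth4_cont _ (P2 b1 bt in_b1 in_bt));
assert (C3 := smooth4_cont _ (P2 bt b1 in_bt in_b1)).
apply (schwarz_mixed (fun t x => cur f t x y z) (fun t x => cur (partial bt f) t x y z)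
  (fun t x => cur (partial b1 f) t x y z) (fun t x => cur (partial b1 (partial bt f)) t x y z)
  (fun t x => cur (partial bt (partial b1 f)) t x y z)); try cont_tac4; intros.
- apply cur_der_t; auto.
- apply cur_der_1; auto.
- apply cur_der_1; auto.
- apply cur_der_t; auto.
Qed.

Lemma mixed_2 t x y z : cur (partial bt (partial b2 f)) t x y z = cur (partial b2 (partial bt f)) t x y z.
Proof.
assert (Q1 := smooth4_partial f b2 Hf in_b2); assert (Qt := smooth4_partial f bt Hf in_bt).
assert (C1 := smooth4_cont _ Q1); assert (C2 := smooth4_cont _ (P2 b2 bt in_b2 in_bt));
assert (C3 := smooth4_cont _ (P2 bt b2 in_bt in_b2)).
apply (schwarz_mixed (fun t y => cur f t x y z) (fun t y => cur (partial bt f) t x y z)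
  (fun t y => cur (partial b2 f) t x y z) (fun t y => cur (partial b2 (partial bt f)) t x y z)
  (fun t y => cur (partial bt (partial b2 f)) t x y z)); try cont_tac4; intros.
- apply cur_der_t; auto.
- apply cur_der_2; auto.
- apply cur_der_2; auto.
- apply cur_der_t; auto.
Qed.

Lemma mixed_3 t x y z : cur (partial bt (partial b3 f)) t x y z = cur (partial b3 (partial bt f)) t x y z.
Proof.
assert (Q1 := smooth4_partial f b3 Hf in_b3); assert (Qt := smooth4_partial f bt Hf in_bt).
assert (C1 := smooth4_cont _ Q1); assert (C2 := smooth4_cont _ (P2 b3 bt in_b3 in_bt));
assert (C3 := smooth4_cont _ (P2 bt b3 in_bt in_b3)).
apply (schwarz_mixed (fun t z => cur f t x y z) (fun t z => cur (partial bt f) t x y z)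
  (fun t z => cur (partial b3 f) t x y z) (fun t z => cur (partial b3 (partial bt f)) t x y z)
  (fun t z => cur (partial bt (partial b3 f)) t x y z)); try cont_tac4; intros.
- apply cur_der_t; auto.
- apply cur_der_3; auto.
- apply cur_der_3; auto.
- apply cur_der_t; auto.
Qed.

Lemma partial_slice t e : partial (e : R3) (fun y => f (t, y)) = fun y => partial ((0, e) : R * R3) f (t, y).
Proof.
extensionality y; unfold partial; apply Derive_ext; intros h.
rewrite plus_scal4, Rmult_0_r, Rplus_0_r; reflexivity.
Qed.
End Mixed.

Lemma wave_cur f : smooth4 f -> solves_wave f -> forall t x y z,
  cur (partial bt (partial bt f)) t x y z - (cur (partial b1 (partial b1 f)) t x y z
   + cur (partial b2 (partial b2 f)) t x y z + cur (partial b3 (partial b3 f)) t x y z) = - nonl (cur f t x y z).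
Proof.
intros Hf Hw t x y z.
assert (E := Hw t ((x, y), z)).
assert (E1 : Derive_n (fun s => f (s, (x, y, z))) 2 t = cur (partial bt (partial bt f)) t x y z).
{ simpl; rewrite (Derive_ext _ (fun t => cur (partial bt f) t x y z)).
  - apply is_derive_unique, cur_der_t, smooth4_partial; auto using in_bt.
  - intros s; apply is_derive_unique, (cur_der_t f Hf). }
assert (E2 : laplacian (fun y => f (t, y)) (x, y, z) = cur (partial b1 (partial b1 f)) t x y z
   + (cur (partial b2 (partial b2 f)) t x y z + (cur (partial b3 (partial b3 f)) t x y z + 0))).
{ assert (S : forall e : R3, partial e (partial e (fun y => f (t, y))) (x, y, z)
     = partial ((0, e) : R * R3) (partial ((0, e) : R * R3) f) (t, (x, y, z))).
  { intros e; rewrite (partial_slice f t e), (partial_slice (partial ((0, e) : R * R3) f) t e); reflexivity. }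
  apply (f_equal2 Rplus); [exact (S (1, 0, 0))|].
  apply (f_equal2 Rplus); [exact (S (0, 1, 0))|].
  apply (f_equal2 Rplus); [exact (S (0, 0, 1))|reflexivity]. }
assert (E3 : - Derive_n (fun s => f (s, (x, y, z))) 2 t + laplacian (fun y => f (t, y)) (x, y, z)
  = nonl (cur f t x y z)) by exact E.
rewrite E1, E2 in E3; rewrite <- E3; ring.
Qed.

(** The sign [sg] treats both directions of time at once. The difference solves a linear wave
    inequality on a bounded region, with a constant depending on the two given solutions, so no
    growth condition enters. *)
Lemma forward_uniqueness u v sg : smooth4 u -> smooth4 v -> solves_wave u -> solves_wave v ->
  sg * sg = 1 -> (forall x, u (0, x) = v (0, x)) ->
  (forall x, partial bt u (0, x) = partial bt v (0, x)) ->
  forall t x y z, 0 <= t -> cur u (sg * t) x y z = cur v (sg * t) x y z.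
Proof.
intros Hu Hv Wu Wv Hsg I0 I1 t x y z Ht.
set (M := t + Rabs x + Rabs y + Rabs z + 1).
assert (Px := Rabs_pos x); assert (Py := Rabs_pos y); assert (Pz := Rabs_pos z).
assert (HM : 0 < M) by (unfold M; lra).
assert (Hsa : Rabs sg = 1).
{ assert (Rabs sg * Rabs sg = 1) by (rewrite <- Rabs_mult, Hsg, Rabs_R1; auto).
  assert (0 <= Rabs sg) by apply Rabs_pos. nra. }
assert (S1 : forall e, In e basis4 -> smooth4 (partial e u) /\ smooth4 (partial e v)).
{ intros; split; apply smooth4_partial; auto. }
assert (S2 : forall e e', In e basis4 -> In e' basis4 -> smooth4 (partial e' (partial e u)) /\ smooth4 (partial e' (partial e v))).
{ intros e e' He He'; split; apply smooth4_partial; auto; apply S1; auto. }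
assert (Cu := smooth4_cont u Hu); assert (Cv := smooth4_cont v Hv).
destruct (bounded4 (cur u) M Cu ltac:(lra)) as [B [HB HBu]].
destruct (bounded4 (cur v) M Cv ltac:(lra)) as [B' [HB' HBv]].
(* Every value between [u] and [v] in the box is at most [B + B'] in size, so [L] is a Lipschitz
   constant of the nonlinearity there. *)
destruct (bounded1 dnonl (B + B') cont_dnonl ltac:(lra)) as [L [HL HLb]].
(* Each derivative in [t] multiplies [k] by [sg]; the second one restores 1 because
   [sg * sg = 1]. *)
set (d := fun (k : R) (f g : R * R3 -> R) (t x y z : R) => k * (cur f (sg * t) x y z - cur g (sg * t) x y z)).
assert (dc : forall k f g, smooth4 f -> smooth4 g -> c4 (d k f g)).
{ intros k f g Hf Hg; assert (Q1 := smooth4_cont f Hf); assert (Q2 := smooth4_cont g Hg); unfold d; cont_tac4. }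
assert (dt : forall k f g, smooth4 f -> smooth4 g -> forall t x y z,
  is_derive (fun t => d k f g t x y z) t (d (k * sg) (partial bt f) (partial bt g) t x y z)).
{ intros k f g Hf Hg s a b c; eapply is_derive_eq.
  - apply (der_scal (fun t => cur f (sg * t) a b c - cur g (sg * t) a b c)), der_minus.
    + apply (der_comp (fun t => cur f t a b c) (fun t => sg * t)); [apply cur_der_t; auto|apply der_scal, der_id].
    + apply (der_comp (fun t => cur g t a b c) (fun t => sg * t)); [apply cur_der_t; auto|apply der_scal, der_id].
  - unfold d; ring. }
assert (dx1 : forall k f g, smooth4 f -> smooth4 g -> forall t x y z,
  is_derive (fun x => d k f g t x y z) x (d k (partial b1 f) (partial b1 g) t x y z)).
{ intros k f g Hf Hg s a b c; apply (der_scal (fun x => cur f (sg * s) x b c - cur g (sg * s) x b c)).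
  apply (der_minus (fun x => cur f (sg * s) x b c) (fun x => cur g (sg * s) x b c)); apply cur_der_1; auto. }
assert (dx2 : forall k f g, smooth4 f -> smooth4 g -> forall t x y z,
  is_derive (fun y => d k f g t x y z) y (d k (partial b2 f) (partial b2 g) t x y z)).
{ intros k f g Hf Hg s a b c; apply (der_scal (fun y => cur f (sg * s) a y c - cur g (sg * s) a y c)).
  apply (der_minus (fun y => cur f (sg * s) a y c) (fun y => cur g (sg * s) a y c)); apply cur_der_2; auto. }
assert (dx3 : forall k f g, smooth4 f -> smooth4 g -> forall t x y z,
  is_derive (fun z => d k f g t x y z) z (d k (partial b3 f) (partial b3 g) t x y z)).
{ intros k f g Hf Hg s a b c; apply (der_scal (fun z => cur f (sg * s) a b z - cur g (sg * s) a b z)).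
  apply (der_minus (fun z => cur f (sg * s) a b z) (fun z => cur g (sg * s) a b z)); apply cur_der_3; auto. }
assert (W0 : forall x y z, d 1 u v 0 x y z = 0).
{ intros a b c.
  assert (E : cur u (sg * 0) a b c = cur v (sg * 0) a b c) by (rewrite Rmult_0_r; exact (I0 ((a, b), c))).
  unfold d; rewrite E; ring. }
assert (zero_der : forall (F : R -> R) a l, (forall b, F b = 0) -> is_derive F a l -> l = 0).
{ intros F a l HF Hd; rewrite <- (is_derive_unique _ _ _ Hd).
  rewrite (Derive_ext F (fun _ => 0)) by auto; apply Derive_const. }
destruct (S1 bt in_bt) as [Sut Svt]; destruct (S1 b1 in_b1) as [Su1 Sv1].
destruct (S1 b2 in_b2) as [Su2 Sv2]; destruct (S1 b3 in_b3) as [Su3 Sv3].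
destruct (S2 bt bt in_bt in_bt) as [Sutt Svtt]; destruct (S2 b1 b1 in_b1 in_b1) as [Su11 Sv11].
destruct (S2 b2 b2 in_b2 in_b2) as [Su22 Sv22]; destruct (S2 b3 b3 in_b3 in_b3) as [Su33 Sv33].
destruct (S2 bt b1 in_bt in_b1) as [Sut1 Svt1]; destruct (S2 bt b2 in_bt in_b2) as [Sut2 Svt2].
destruct (S2 bt b3 in_bt in_b3) as [Sut3 Svt3].
assert (X1t : forall t x y z, is_derive (fun t => d 1 (partial b1 u) (partial b1 v) t x y z) t
  (d (1 * sg) (partial b1 (partial bt u)) (partial b1 (partial bt v)) t x y z)).
{ intros s a b c; eapply is_derive_eq; [apply (dt 1 _ _ Su1 Sv1)|].
  unfold d; rewrite (mixed_1 u Hu), (mixed_1 v Hv); reflexivity. }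
assert (X2t : forall t x y z, is_derive (fun t => d 1 (partial b2 u) (partial b2 v) t x y z) t
  (d (1 * sg) (partial b2 (partial bt u)) (partial b2 (partial bt v)) t x y z)).
{ intros s a b c; eapply is_derive_eq; [apply (dt 1 _ _ Su2 Sv2)|].
  unfold d; rewrite (mixed_2 u Hu), (mixed_2 v Hv); reflexivity. }
assert (X3t : forall t x y z, is_derive (fun t => d 1 (partial b3 u) (partial b3 v) t x y z) t
  (d (1 * sg) (partial b3 (partial bt u)) (partial b3 (partial bt v)) t x y z)).
{ intros s a b c; eapply is_derive_eq; [apply (dt 1 _ _ Su3 Sv3)|].
  unfold d; rewrite (mixed_3 u Hu), (mixed_3 v Hv); reflexivity. }
assert (Hw : forall t x y z, 0 <= t <= M -> Rabs x <= M -> Rabs y <= M -> Rabs z <= M ->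
  Rabs (d (1 * sg * sg) (partial bt (partial bt u)) (partial bt (partial bt v)) t x y z
   - (d 1 (partial b1 (partial b1 u)) (partial b1 (partial b1 v)) t x y z
    + d 1 (partial b2 (partial b2 u)) (partial b2 (partial b2 v)) t x y z
    + d 1 (partial b3 (partial b3 u)) (partial b3 (partial b3 v)) t x y z)) <= L * Rabs (d 1 u v t x y z)).
{ intros s a b c Hs Ha Hb Hc.
  assert (Eu := wave_cur u Hu Wu (sg * s) a b c); assert (Ev := wave_cur v Hv Wv (sg * s) a b c).
  replace (1 * sg * sg) with 1 by (rewrite Rmult_assoc, Hsg; ring).
  unfold d; rewrite !Rmult_1_l.
  match goal with |- Rabs ?X <= _ =>
    replace X with (- (nonl (cur u (sg * s) a b c) - nonl (cur v (sg * s) a b c))) by lra end.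
  rewrite Rabs_Ropp.
  assert (Hss : Rabs (sg * s) <= M) by (rewrite Rabs_mult, Hsa, Rabs_pos_eq; lra).
  assert (Bu := HBu (sg * s) a b c Hss Ha Hb Hc); assert (Bv := HBv (sg * s) a b c Hss Ha Hb Hc).
  apply (mvt_bound nonl dnonl); [apply nonl_der|].
  intros r Hr; apply HLb; revert Hr Bu Bv; clear - HB HB'; abs_lra. }
assert (Wt0 : forall x y z, d (1 * sg) (partial bt u) (partial bt v) 0 x y z = 0).
{ intros a b c.
  assert (E : cur (partial bt u) (sg * 0) a b c = cur (partial bt v) (sg * 0) a b c)
    by (rewrite Rmult_0_r; exact (I1 ((a, b), c))).
  unfold d; rewrite E; ring. }
assert (R : d 1 u v t x y z = 0).
{ apply (box_vanish _ _ _ _ _ _ _ _ _ _ _ _ M L HM HL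
    (dc 1 _ _ Hu Hv) (dc (1 * sg) _ _ Sut Svt) (dc 1 _ _ Su1 Sv1) (dc 1 _ _ Su2 Sv2) (dc 1 _ _ Su3 Sv3)
    (dc (1 * sg * sg) _ _ Sutt Svtt)
    (dc (1 * sg) _ _ Sut1 Svt1) (dc (1 * sg) _ _ Sut2 Svt2) (dc (1 * sg) _ _ Sut3 Svt3)
    (dc 1 _ _ Su11 Sv11) (dc 1 _ _ Su22 Sv22) (dc 1 _ _ Su33 Sv33)
    (dt 1 _ _ Hu Hv) (dt (1 * sg) _ _ Sut Svt) X1t X2t X3t
    (dx1 (1 * sg) _ _ Sut Svt) (dx2 (1 * sg) _ _ Sut Svt) (dx3 (1 * sg) _ _ Sut Svt)
    (dx1 1 _ _ Su1 Sv1) (dx2 1 _ _ Su2 Sv2) (dx3 1 _ _ Su3 Sv3) Hw); [|unfold M; lra..].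
  intros a b c; split; [apply W0|split; [apply Wt0|split; [|split]]].
  - apply (zero_der (fun a => d 1 u v 0 a b c) a); [intros; apply W0|apply (dx1 1 _ _ Hu Hv)].
  - apply (zero_der (fun b => d 1 u v 0 a b c) b); [intros; apply W0|apply (dx2 1 _ _ Hu Hv)].
  - apply (zero_der (fun c => d 1 u v 0 a b c) c); [intros; apply W0|apply (dx3 1 _ _ Hu Hv)]. }
unfold d in R; lra.
Qed.

Theorem wave_uniqueness u v u0 u1 : smooth4 u -> smooth4 v -> solves_wave u -> solves_wave v ->
  has_initial_data u u0 u1 -> has_initial_data v u0 u1 -> u = v.
Proof.
intros Hu Hv Wu Wv Iu Iv.
assert (I0 : forall x, u (0, x) = v (0, x)).
{ intros x; destruct (Iu x) as [-> _], (Iv x) as [-> _]; auto. }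
assert (I1 : forall x, partial bt u (0, x) = partial bt v (0, x)).
{ intros [[x y] z].
  assert (Eu := is_derive_unique _ _ _ (cur_der_t u Hu 0 x y z)).
  assert (Ev := is_derive_unique _ _ _ (cur_der_t v Hv 0 x y z)).
  transitivity (Derive (fun t => cur u t x y z) 0); [symmetry; exact Eu|].
  transitivity (Derive (fun t => cur v t x y z) 0); [|exact Ev].
  transitivity (u1 (x, y, z)); [apply (Iu (x, y, z))|symmetry; apply (Iv (x, y, z))]. }
extensionality p; destruct p as [t [[x y] z]]; change (cur u t x y z = cur v t x y z).
destruct (Rle_dec 0 t) as [Ht|Ht].
- assert (E := forward_uniqueness u v 1 Hu Hv Wu Wv ltac:(ring) I0 I1 t x y z Ht).
  rewrite Rmult_1_l in E; exact E.
- assert (E := forward_uniqueness u v (-1) Hu Hv Wu Wv ltac:(ring) I0 I1 (- t) x y z ltac:(lra)).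
  replace (-1 * - t) with t in E by ring; exact E.
Qed.

Theorem theorem1p1 (u0 u1 : R3 -> R)
  (hu0 : smooth3 u0) (hu1 : smooth3 u1)
  (hs0 : spherically_symmetric u0) (hs1 : spherically_symmetric u1) :
  exists! u : R * R3 -> R,
    smooth4 u /\ solves_wave u /\ has_initial_data u u0 u1.
Proof.
destruct (radial_existence u0 u1 hu0 hu1 hs0 hs1) as [u [Su [Wu Iu]]].
exists u; split; [auto|].
intros v [Sv [Wv Iv]]; apply (wave_uniqueness u v u0 u1); auto.
Qed.
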